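(* Let $\rho_0\in C^\infty(\mathbb{T}^2)$, $\rho_0\not\equiv 0$, be odd in $x_2$. In addition, assume that $\rho_0$ is even in $x_1$, that $\rho_0=0$ for $x_1=0$, and that $\rho_0\ge 0$ in $D:=[0,\pi]^2$. Assume that there is a global-in-time smooth solution $\rho(x,t)$ to the IPM equation in $\mathbb{T}^2$ with initial data $\rho_0$. Then for every $s>-\frac12$ there is a finite constant $C(s,\rho_0)$, depending only on $s$ and $\rho_0$, such that $$\int_0^\infty \|\partial_{x_1}\rho(t)\|_{\dot H^s(\mathbb{T}^2)}^{-\frac{2}{2s+1}}\,dt\le C(s,\rho_0),$$ which implies $$\limsup_{t\to\infty} t^{-(s+\frac12)}\|\rho(t)\|_{\dot H^{s+1}(\mathbb{T}^2)}\ \ge\ \limsup_{t\to\infty} t^{-(s+\frac12)}\|\partial_{x_1}\rho(t)\|_{\dot H^{s}(\mathbb{T}^2)}=\infty\quad\text{for all } s>-\tfrac12 .$$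
   Context: $\mathbb{T}^2=[-\pi,\pi)^2$ is the 2D torus. The IPM equation in $\mathbb{T}^2$ is $\partial_t\rho+(u\cdot\nabla)\rho=0$, $\nabla\cdot u=0$, $u+\nabla p=-(0,\rho)$, where the velocity is given by the Biot-Savart law $u=\nabla^\perp(-\Delta)^{-1}\partial_{x_1}\rho$, $\nabla^\perp=(-\partial_{x_2},\partial_{x_1})$. For mean-zero $f$, $(-\Delta)^{-1}f=\sum_{k\in\mathbb{Z}^2\setminus\{(0,0)\}}|k|^{-2}\hat f(k)e^{ik\cdot x}$, where $\hat f(k)=\frac{1}{(2\pi)^2}\int_{\mathbb{T}^2}e^{-ik\cdot x}f(x)\,dx$. A global-in-time smooth solution is a solution that is smooth on $\mathbb{T}^2\times[0,\infty)$ with $\rho(\cdot,0)=\rho_0$. Homogeneous Sobolev norm: $\|f\|_{\dot H^s(\mathbb{T}^2)}^2=(2\pi)^2\sum_{k\in\mathbb{Z}^2\setminus\{(0,0)\}}|k|^{2s}|\hat f(k)|^2$ (for $s=0$ and mean-zero $f$, such as $\partial_{x_1}\rho$, this is the $L^2$ norm). *)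

(* Defs.v *)
From HB Require Import structures.
From mathcomp Require Import all_boot all_order all_algebra.
From mathcomp Require Import all_classical all_reals all_analysis.
From mathcomp Require Import complex.
Set Implicit Arguments.
Unset Strict Implicit.
Unset Printing Implicit Defensive.
Import Order.TTheory GRing.Theory Num.Theory.
Import numFieldNormedType.Exports.
Local Open Scope classical_set_scope.
Local Open Scope ring_scope.

(* Functions on the torus [-pi, pi)^2 are represented by functions of two real
   variables that are 2pi-periodic in each of them; time-dependent functions
   are written [rho t x1 x2], and only their values at t >= 0 matter. *)

Section Torus.
Variable R : realType.
Implicit Types (f : R -> R -> R) (g : R -> R -> R -> R).

Definition periodic2 f : Prop :=
  forall x1 x2, f (x1 + 2 * pi) x2 = f x1 x2 /\ f x1 (x2 + 2 * pi) = f x1 x2.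

Definition dx1 f : R -> R -> R := fun x1 x2 => derive1 (fun y => f y x2) x1.
Definition dx2 f : R -> R -> R := fun x1 x2 => derive1 (fun y => f x1 y) x2.

Definition derivable_x1 f : Prop :=
  forall x1 x2, derivable (fun y => f y x2) x1 1.
Definition derivable_x2 f : Prop :=
  forall x1 x2, derivable (fun y => f x1 y) x2 1.

Fixpoint Ck2 (n : nat) f : Prop :=
  continuous (fun z : R * R => f z.1 z.2) /\
  match n with
  | 0%N => True
  | m.+1 => [/\ derivable_x1 f, derivable_x2 f, Ck2 m (dx1 f) & Ck2 m (dx2 f)]
  end.

Definition smooth_torus f : Prop := periodic2 f /\ forall n, Ck2 n f.

(* Time derivative within [0, +oo): two-sided for t > 0, one-sided at t = 0. *)
Definition dt_filter (t : R) : set_system R :=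
  within [set h | 0 <= t + h] (0 : R)^'.

Definition dt_quot g (t x1 x2 : R) : R -> R :=
  fun h => h^-1 * (g (t + h) x1 x2 - g t x1 x2).

Definition dt g : R -> R -> R -> R :=
  fun t x1 x2 => lim (dt_quot g t x1 x2 @ dt_filter t).

Definition derivable_t g : Prop :=
  forall t x1 x2, 0 <= t -> cvg (dt_quot g t x1 x2 @ dt_filter t).

(* C^n on R^2 x [0, +oo), up to and including the boundary t = 0. *)
Fixpoint Ck_evol (n : nat) g : Prop :=
  {within [set z : R * R * R | 0 <= z.1.1],
    continuous (fun z => g z.1.1 z.1.2 z.2)} /\
  match n with
  | 0%N => True
  | m.+1 =>
    [/\ derivable_t g,
        forall t, 0 <= t -> derivable_x1 (g t) /\ derivable_x2 (g t),
        Ck_evol m (dt g),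
        Ck_evol m (fun t => dx1 (g t))
      & Ck_evol m (fun t => dx2 (g t))]
  end.

Definition smooth_evol g : Prop :=
  (forall t, 0 <= t -> periodic2 (g t)) /\ forall n, Ck_evol n g.

Definition torus : set (R * R) := `[- pi, pi[%classic `*` `[- pi, pi[%classic.

Definition dot (k : int * int) (x1 x2 : R) : R :=
  k.1%:~R * x1 + k.2%:~R * x2.

Definition cexp (a : R) : R[i] := (cos a +i* sin a)%C.

Definition torus_integral (F : R -> R -> R[i]) : R[i] :=
  let mu := (lebesgue_measure \x lebesgue_measure)%E in
  ((\int[mu]_(z in torus) complex.Re (F z.1 z.2)) +i*
   (\int[mu]_(z in torus) complex.Im (F z.1 z.2)))%C.

Definition fourier f (k : int * int) : R[i] :=
  (((2 * pi) ^+ 2)^-1)%:C%C *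
  torus_integral (fun x1 x2 => cexp (- dot k x1 x2) * (f x1 x2)%:C%C).

Definition kabs (k : int * int) : R :=
  Num.sqrt (k.1%:~R ^+ 2 + k.2%:~R ^+ 2).

Definition inv_laplacian_term f (x1 x2 : R) (k : int * int) : R[i] :=
  ((kabs k ^+ 2)^-1)%:C%C * fourier f k * cexp (dot k x1 x2).

Definition box_index (N i j : nat) : int * int :=
  ((i%:Z - N%:Z)%R, (j%:Z - N%:Z)%R).

(* The sum over k in Z^2 \ {0} is the limit of the partial sums over the boxes
   [-N, N]^2. The box is symmetric and f is real, so the partial sums are
   real and taking their real part loses nothing. For smooth f the series
   converges absolutely, so the order of summation is immaterial. *)
Definition inv_laplacian f (x1 x2 : R) : R :=
  limn (fun N : nat =>
    complex.Re
      (\sum_(i < N.*2.+1) \sum_(j < N.*2.+1 |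
          box_index N i j != (0, 0))
        inv_laplacian_term f x1 x2 (box_index N i j))).

Definition biot_savart1 f : R -> R -> R :=
  fun x1 x2 => - dx2 (inv_laplacian (dx1 f)) x1 x2.
Definition biot_savart2 f : R -> R -> R :=
  dx1 (inv_laplacian (dx1 f)).

Definition ipm_solution (rho : R -> R -> R -> R) : Prop :=
  exists u1 u2 p : R -> R -> R -> R,
    (forall t, 0 <= t ->
      [/\ derivable_x1 (u1 t), derivable_x2 (u2 t),
          derivable_x1 (p t), derivable_x2 (p t) & periodic2 (p t)]) /\
    (forall t x1 x2, 0 <= t ->
      [/\ dt rho t x1 x2 + u1 t x1 x2 * dx1 (rho t) x1 x2
                         + u2 t x1 x2 * dx2 (rho t) x1 x2 = 0,
          dx1 (u1 t) x1 x2 + dx2 (u2 t) x1 x2 = 0,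
          u1 t x1 x2 + dx1 (p t) x1 x2 = 0,
          u2 t x1 x2 + dx2 (p t) x1 x2 = - rho t x1 x2
        & u1 t x1 x2 = biot_savart1 (rho t) x1 x2 /\
          u2 t x1 x2 = biot_savart2 (rho t) x1 x2]).

Definition global_smooth_solution (rho0 : R -> R -> R)
    (rho : R -> R -> R -> R) : Prop :=
  [/\ smooth_evol rho, ipm_solution rho
    & forall x1 x2, rho 0 x1 x2 = rho0 x1 x2].

(* [normc] is the modulus as an element of R; the norm is a priori in
   [0, +oo], the series having nonnegative terms. *)
Definition sobolev_sqnorm (s : R) f : \bar R :=
  (((2 * pi) ^+ 2)%:E *
   \esum_(k in [set k : int * int | (k != (0, 0))%R])
      (kabs k `^ (2 * s) * ComplexField.Normc.normc (fourier f k) ^+ 2)%:E)%E.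

Definition sobolev_norm (s : R) f : \bar R :=
  poweR (sobolev_sqnorm s f) 2^-1.

(* ||f||^(-2/(2s+1)), with value +oo when ||f|| = 0: extended-real inversion
   satisfies 0^-1 = +oo, whereas poweR sends 0 to 0 for negative exponents. *)
Definition sobolev_weight (s : R) f : \bar R :=
  ((poweR (sobolev_norm s f) (2 / (2 * s + 1)))^-1)%E.

End Torus.

(* Main.v *)
Require Import Defs.
From HB Require Import structures.
From mathcomp Require Import all_boot all_order all_algebra.
From mathcomp Require Import all_classical all_reals all_analysis.
From mathcomp Require Import complex.
From mathcomp Require Import ring lra zify.
Set Implicit Arguments.
Unset Strict Implicit.
Unset Printing Implicit Defensive.
Import Order.TTheory GRing.Theory Num.Theory.
Import numFieldNormedType.Exports.
Local Open Scope classical_set_scope.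
Local Open Scope ring_scope.

(** The coefficients b_n(t), n >= 1, of rho(t) against cos(n x1) sin(x2) on the
    upper half Q = [-pi,pi] x [0,pi] of the torus control everything.

    By uniqueness the symmetries of rho0 persist, so u is tangent to the
    boundary of Q and u1 = 0 on x1 = 0; hence 0 <= rho <= max |rho0| on Q, rho
    vanishes on x1 = 0, and the mass of rho in Q is conserved. Boundedness and
    mass give a lower bound c0 > 0, depending on rho0 only, for the integral of
    rho sin(x2) over Q. As rho is nonnegative and vanishes to second order on
    x1 = 0, Fejer summation at x1 = 0 turns this into c0 <= 2 sum_n |b_n|.

    The potential energy, the integral of x2 rho over Q, is bounded and decays
    at rate D(t), the integral of |u|^2 over Q, and D >= pi^-2 sum_n b_n^2. On the
    other hand the H^s norm of the x1-derivative bounds sum_n n^(2+2s) b_n^2.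
    Interpolating c0 <= 2 sum_n |b_n| between these two sums with Cauchy-Schwarz
    gives ||d_1 rho||^(-2/(2s+1)) <= C D, and D is integrable in time. Were the
    limsup finite, the left-hand side would be at least c/t for large t. *)

(** * Calculus on the plane *)

Section Continuity.
Context {R : realType}.
Local Notation mu := (@lebesgue_measure R).

(** The constant may depend on [rho0] only, while no derivative of the solution is controlled
    uniformly in time. The bound rho <= K (1 - cos x1) that quantifies the vanishing on the axis has
    such an uncontrolled K, depending on the solution and on t; but K enters only through a Fejer
    remainder of size K/N and disappears as N grows. What survives, the maximum and the mass, is
    fixed by the data.

    The profile sin(x2) serves twice: it vanishes on the horizontal sides of Q, which makes the test
    field behind the bound on D tangent there, and it is positive inside, so that its integral
    against rho is bounded below by means of the mass.

    With a = 2s + 1, the assumption s > -1/2 means that the sum of n^-(1+a) converges. If A bounds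
    the sum of b_n^2 and B that of n^(1+a) b_n^2, interpolation yields A >= th B^(-1/a); as B is a
    multiple of the squared norm, this is the exponent -2/(2s+1).

    The Biot-Savart series serves only for the regularity of the velocity that integration by parts
    requires; the estimates on the velocity then rest on Darcy's law with a periodic pressure. *)

Lemma open_measurable_prod (U : set (R * R)) : open U -> measurable U.
Proof.
move=> oU.
(* The product sigma-algebra is generated by rectangles, so [U] is written as a countable union of
   open squares with rational centre and radius [1 / (n + 1)]. *)
pose box (q : rat * rat * nat) : set (R * R) :=
  `]ratr q.1.1 - q.2.+1%:R^-1, ratr q.1.1 + q.2.+1%:R^-1[%classic `*`
  `]ratr q.1.2 - q.2.+1%:R^-1, ratr q.1.2 + q.2.+1%:R^-1[%classic.
pose F q : set (R * R) := [set z | box q `<=` U /\ box q z].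
have -> : U = \bigcup_q F q.
  apply/seteqP; split=> [z Uz|z [q _ [+]]]; last exact.
  have [e /= e0 eU] : nbhs_ball z U by rewrite nbhs_ballE; exact: open_nbhs_nbhs.
  have [n n1] : exists n : nat, n.+1%:R^-1 < e / 2.
    have [n _ /(_ n (leqnn n))] := near_infty_natSinv_lt (PosNum (divr_gt0 e0 (ltr0n R 2))).
    by exists n.
  have n0 : 0 < n.+1%:R^-1 :> R by rewrite invr_gt0.
  pose u : R := n.+1%:R^-1; rewrite -/u in n0 n1.
  have rat_near (x : R) : exists q : rat, ratr q \in `]x - u, x + u[.
    by apply: rat_in_itvoo; lra.
  have [q1 +] := rat_near z.1; rewrite in_itv/= => /andP[q11 q12].
  have [q2 +] := rat_near z.2; rewrite in_itv/= => /andP[q21 q22].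
  exists (q1, q2, n) => //; split=> [w [/=]|].
    rewrite -/u !in_itv/= => /andP[w1 w2] /andP[w3 w4].
    by apply: eU; split => /=; rewrite /ball/= ltr_norml; apply/andP; split; lra.
  by split; rewrite /= -/u in_itv/=; apply/andP; split; lra.
apply: countable_bigcupT_measurable => // q.
have [bU|bU] := pselect (box q `<=` U); last first.
  rewrite (_ : F q = set0); first exact: measurable0.
  by apply/seteqP; split=> // z [].
rewrite (_ : F q = box q); first by apply: measurableX; exact: measurable_itv.
by apply/seteqP; split=> // z [].
Qed.

Lemma continuous_measurable_prod (f : R * R -> R) :
  continuous f -> measurable_fun setT f.
Proof.
move=> /continuousP cf; apply: (measurability _ (measurable_realfun.RGenOpens.measurableE R)).
move=> _ [_ [a [b ->] <-]]; rewrite setTI; apply: open_measurable_prod.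
exact/cf/interval_open.
Qed.

Lemma continuous_pair1 (S T U : topologicalType) (f : S * T -> U) (y : T) :
  continuous f -> continuous (fun x => f (x, y)).
Proof.
move=> cf x; apply: (@continuous_comp _ _ _ (fun x => (x, y)) f); last exact: cf.
by apply: cvg_pair => /=; [exact: cvg_id|exact: cvg_cst].
Qed.

Lemma continuous_pair2 (S T U : topologicalType) (f : S * T -> U) (x : S) :
  continuous f -> continuous (fun y => f (x, y)).
Proof.
move=> cf y; apply: (@continuous_comp _ _ _ (fun y => (x, y)) f); last exact: cf.
by apply: cvg_pair => /=; [exact: cvg_cst|exact: cvg_id].
Qed.

Lemma continuous_itv_integrable (f : R -> R) a b :
  continuous f -> mu.-integrable `[a, b] (EFin \o f).
Proof.
move=> cf; apply: continuous_compact_integrable; first exact: segment_compact.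
exact: continuous_subspaceT.
Qed.

(* Tube lemma: continuity of a parametric integral over a segment. *)
Lemma continuous_Rintegral_param (S : topologicalType) (f : R -> S -> R) a b :
  continuous (fun z : R * S => f z.1 z.2) ->
  continuous (fun s => \int[mu]_(x in `[a, b]) f x s).
Proof.
move=> cf s; apply/cvgrPdist_le => /= e e0.
have [ba|ab] := ltP b a.
  by near=> t; rewrite set_itv_ge ?bnd_simp -?ltNge// !Rintegral_set0 subrr normr0 ltW.
have cfx t : continuous (f ^~ t) by exact: (continuous_pair1 (y := t) cf).
pose d := e / (b - a + 1).
have d0 : 0 < d by rewrite divr_gt0//; lra.
have /compact_near_coveringP cab := @segment_compact R a b.
have /(_ (nbhs_filter s)) := cab S (nbhs s) (fun t x => `|f x s - f x t| <= d).
have H x : `[a, b]%classic x ->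
    \forall x' \near x & i \near nbhs s, `|f x' s - f x' i| <= d.
  move=> _; have /cvgrPdist_le/(_ (d / 2)) := cf (x, s).
  have d20 : 0 < d / 2 by lra.
  move=> /(_ d20) [[A B] /= [Ax Bs] AB].
  exists (A, B) => // -[x' t] /= [Ax' Bt].
  have h1 := AB (x', t) (conj Ax' Bt).
  have h2 := AB (x', s) (conj Ax' (nbhs_singleton Bs)).
  rewrite /= in h1 h2.
  have -> : f x' s - f x' t = (f x s - f x' t) - (f x s - f x' s) by ring.
  by rewrite (le_trans (ler_normB _ _))//; lra.
move=> /(_ H); apply: filterS => t /= Ht.
rewrite -RintegralB//; [|exact: continuous_itv_integrable..].
apply: (le_trans (le_normr_Rintegral _ _)) => //.
  apply: (@continuous_itv_integrable (fun x => f x s - f x t)).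
  by move=> x; apply: cvgB; [exact: cfx|exact: cfx].
apply: (@le_trans _ _ (\int[mu]_(x in `[a, b]) (cst d x))).
  apply: le_Rintegral => //.
  - apply: (@continuous_itv_integrable (fun x => `|f x s - f x t|)).
    move=> x; apply: cvg_norm; apply: cvgB; [exact: cfx|exact: cfx].
  - by apply: continuous_itv_integrable => x; exact: cvg_cst.
rewrite Rintegral_cst// /d.
have -> : fine (mu `[a, b]) = b - a.
  by rewrite lebesgue_measure_itv/= lte_fin; case: ltP => //= ba; lra.
by rewrite mulrAC ler_pdivrMr; [nra|lra].
Unshelve. all: by end_near. Qed.

End Continuity.

Section Fubini.
Context {R : realType}.
Local Notation mu := (@lebesgue_measure R).
Local Notation mu2 := (mu \x mu)%E.

Definition cont2 (f : R -> R -> R) := continuous (fun z : R * R => f z.1 z.2).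

Lemma cont2_x1 f y : cont2 f -> continuous (f ^~ y).
Proof. by move=> cf; exact: (continuous_pair1 (y := y) cf). Qed.

Lemma cont2_x2 f x : cont2 f -> continuous (f x).
Proof. by move=> cf; exact: (continuous_pair2 (x := x) cf). Qed.

Lemma cont2_swap f : cont2 f -> cont2 (fun x y => f y x).
Proof.
move=> cf z; apply: (@continuous_comp _ _ _ (fun z => (z.2, z.1)) (fun z => f z.1 z.2)).
  by apply: (@cvg_pair _ _ _ _ (nbhs z.2) (nbhs z.1)); [exact: cvg_snd|exact: cvg_fst].
exact: cf.
Qed.

Lemma itv_lebesgue_fin (X : set R) a b :
  measurable X -> X `<=` `[a, b] -> (mu X < +oo)%E.
Proof.
move=> mX Xab; have muab : (mu X <= mu `[a, b])%E by rewrite le_measure ?inE.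
apply: le_lt_trans muab _; rewrite lebesgue_measure_itv/=.
by case: ifPn => // _; rewrite -EFinB ltry.
Qed.

Lemma cont2_bounded f a b c d : cont2 f ->
  exists M, 0 <= M /\ forall x y, a <= x <= b -> c <= y <= d -> `|f x y| <= M.
Proof.
move=> cf.
have [ab|] := pselect (a <= b /\ c <= d); last first.
  by move=> nab; exists 0; split => // x y /andP[? ?] /andP[? ?]; case: nab; split; lra.
have K : compact (`[a, b]%classic `*` `[c, d]%classic : set (R * R)).
  by apply: compact_setX; exact: segment_compact.
have [||z _ Hz] := compact_EVT_max (f := fun z : R * R => `|f z.1 z.2|) _ K.
  by exists (a, c); split; rewrite /= in_itv/= lexx; lra.
- by apply: continuous_subspaceT => z; apply: cvg_norm; exact: cf.
exists `|f z.1 z.2|; split => // x y abx cdy; apply: (Hz (x, y)).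
by rewrite inE; split; rewrite /= in_itv.
Qed.

Section Product.
Variables (f : R -> R -> R) (a b c d : R) (X Y : set (measurableTypeR R)).
Hypotheses (cf : cont2 f) (mX : measurable X) (mY : measurable Y).
Hypotheses (Xab : X `<=` `[a, b]) (Ycd : Y `<=` `[c, d]).

Let fXY : R * R -> R := (fun z => f z.1 z.2) \_ (X `*` Y).

Let int_fXY : mu2.-integrable setT (EFin \o fXY).
Proof.
have mXY : measurable (X `*` Y) by exact: measurableX.
rewrite -restrict_EFin; apply/integrable_restrict => //; rewrite setTI.
have [M [M0 HM]] := cont2_bounded a b c d cf.
apply: measurable_bounded_integrable => //.
- rewrite /= product_measure1E//.
  apply: lte_mul_pinfty; rewrite ?ge0_fin_numE//; first exact: itv_lebesgue_fin Xab.
  exact: itv_lebesgue_fin Ycd.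
- exact: measurable_funS (continuous_measurable_prod cf).
- exists M; split; first exact: num_real.
  move=> t Mt z [/= /Xab /= h1 /Ycd /= h2]; rewrite !in_itv/= in h1 h2.
  by rewrite (le_trans (HM _ _ h1 h2))// ltW.
Qed.

Let intx x : mu.-integrable Y (EFin \o f x).
Proof.
by apply: (@integrableS _ _ _ mu `[c, d]) => //; apply: continuous_itv_integrable; exact: cont2_x2.
Qed.

Let inty y : mu.-integrable X (EFin \o f ^~ y).
Proof.
by apply: (@integrableS _ _ _ mu `[a, b]) => //; apply: continuous_itv_integrable; exact: cont2_x1.
Qed.

(** The integrand is extended by zero off [X * Y], so that Fubini on the whole plane applies.
    Measurable subsets of segments cover both the half-open cell in the definition of the torus and
    closed rectangles. *)
Lemma Rintegral_prod12 :
  \int[mu2]_(z in X `*` Y) f z.1 z.2 = \int[mu]_(x in X) \int[mu]_(y in Y) f x y.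
Proof.
rewrite Rintegral_mkcond -/fXY /Rintegral.
have /= <- := @integral12_prod_meas1 _ _ _ _ _ mu mu _ int_fXY.
rewrite -/(Rintegral mu X _) Rintegral_mkcond; congr fine.
apply: eq_integral => x _; rewrite /fubini_F /= patchE.
case: ifPn => [|] xX.
  rewrite /Rintegral fineK; last exact: (integrable_fin_num mY (intx x)).
  rewrite [RHS]integral_mkcond; apply: eq_integral => y _.
  by rewrite /fXY /= !patchE in_setX/= xX/=; case: ifP.
rewrite integral0_eq// => y _.
by rewrite /fXY /= patchE in_setX/= (negbTE xX).
Qed.

Lemma Rintegral_prod21 :
  \int[mu2]_(z in X `*` Y) f z.1 z.2 = \int[mu]_(y in Y) \int[mu]_(x in X) f x y.
Proof.
rewrite Rintegral_mkcond -/fXY /Rintegral.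
have /= <- := @integral21_prod_meas1 _ _ _ _ _ mu mu _ int_fXY.
rewrite -/(Rintegral mu Y _) Rintegral_mkcond; congr fine.
apply: eq_integral => y _; rewrite /fubini_G /= patchE.
case: ifPn => [|] yY.
  rewrite /Rintegral fineK; last exact: (integrable_fin_num mX (inty y)).
  rewrite [RHS]integral_mkcond; apply: eq_integral => x _.
  by rewrite /fXY /= !patchE in_setX/= yY andbT; case: ifP.
rewrite integral0_eq// => x _.
by rewrite /fXY /= patchE in_setX/= (negbTE yY) andbF.
Qed.

End Product.

End Fubini.

Section IteratedIntegrals.
Context {R : realType}.
Local Notation mu := (@lebesgue_measure R).

Lemma cont_pair (S T U : topologicalType) (f : S -> T) (g : S -> U) :
  continuous f -> continuous g -> continuous (fun z => (f z, g z)).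
Proof.
by move=> cf cg z; apply: (@cvg_pair _ _ _ _ (nbhs (f z)) (nbhs (g z)));
  [exact: cf|exact: cg].
Qed.

Lemma cont_comp (S T U : topologicalType) (f : S -> T) (g : T -> U) :
  continuous f -> continuous g -> continuous (fun z => g (f z)).
Proof. by move=> cf cg z; apply: continuous_comp; [exact: cf|exact: cg]. Qed.

Lemma cont_fst (S T U : topologicalType) (f : S -> T * U) :
  continuous f -> continuous (fun z => (f z).1).
Proof. by move=> cf; apply: (cont_comp cf) => z; exact: cvg_fst. Qed.

Lemma cont_snd (S T U : topologicalType) (f : S -> T * U) :
  continuous f -> continuous (fun z => (f z).2).
Proof. by move=> cf; apply: (cont_comp cf) => z; exact: cvg_snd. Qed.

Lemma cont2_comp (S : topologicalType) (f : R -> R -> R) (h k : S -> R) :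
  cont2 f -> continuous h -> continuous k -> continuous (fun z => f (h z) (k z)).
Proof. by move=> cf ch ck; exact: (cont_comp (cont_pair ch ck) cf). Qed.

Definition cont3 (g : R -> R -> R -> R) :=
  continuous (fun z : R * R * R => g z.1.1 z.1.2 z.2).

Lemma cont3_comp (S : topologicalType) g (h k l : S -> R) :
  cont3 g -> continuous h -> continuous k -> continuous l ->
  continuous (fun z => g (h z) (k z) (l z)).
Proof.
by move=> cg ch ck cl; exact: (cont_comp (cont_pair (cont_pair ch ck) cl) cg).
Qed.

(** Separates the differentiation rules from the algebra: the derivative produced by the rules is
    matched with the wanted expression afterwards, mostly by [ring]. *)
Lemma drv_eq (f : R -> R) (x a b : R) :
  is_derive x 1 f a -> a = b -> is_derive x 1 f b.
Proof. by move=> + <-. Qed.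

Section Derivatives.
Variables (x : R) (f g : R -> R) (df dg : R).

Lemma drv_cst k : is_derive x 1 (fun=> k : R) 0.
Proof. exact: is_derive_cst. Qed.

Lemma drv_id : is_derive x 1 (fun y : R => y) 1.
Proof. exact: is_derive_id. Qed.

Hypotheses (hf : is_derive x 1 f df) (hg : is_derive x 1 g dg).

Lemma drvD : is_derive x 1 (fun y => f y + g y) (df + dg).
Proof. exact: is_deriveD. Qed.

Lemma drvN : is_derive x 1 (fun y => - f y) (- df).
Proof. exact: is_deriveN. Qed.

Lemma drvM : is_derive x 1 (fun y => f y * g y) (df * g x + f x * dg).
Proof.
by apply: (drv_eq (is_deriveM hf hg)); rewrite /GRing.scale/=; ring.
Qed.

Lemma drv_sin : is_derive x 1 (fun y => sin (f y)) (df * cos (f x)).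
Proof.
by have := is_derive1_comp (is_derive_sin (f x)) hf; rewrite mulrC.
Qed.

Lemma drv_cos : is_derive x 1 (fun y => cos (f y)) (- (df * sin (f x))).
Proof.
by have := is_derive1_comp (is_derive_cos (f x)) hf; rewrite mulNr mulrC.
Qed.

End Derivatives.

Lemma drv_continuous (f df : R -> R) :
  (forall x : R, is_derive x 1 f (df x)) -> continuous f.
Proof.
by move=> dF x; apply/differentiable_continuous/derivable1_diffP; case: (dF x).
Qed.

Lemma FTC_Rintegral (F f : R -> R) a b : a <= b -> continuous f ->
  (forall x : R, is_derive x 1 F (f x)) -> \int[mu]_(x in `[a, b]) f x = F b - F a.
Proof.
move=> ab cf dF; have cF := drv_continuous dF.
move: ab; rewrite le_eqVlt => /predU1P[<-|ab].
  by rewrite set_itv1 Rintegral_set1 subrr.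
rewrite /Rintegral (@continuous_FTC2 _ _ F)//.
- exact: continuous_subspaceT.
- split => [x _| |]; first by case: (dF x).
    by apply: cvg_at_right_filter; exact: cF.
  by apply: cvg_at_left_filter; exact: cF.
- by move=> x _; rewrite derive1E; case: (dF x).
Qed.

Lemma Rintegral_cst_itv (a b k : R) : a <= b ->
  \int[mu]_(x in `[a, b]) k = k * (b - a).
Proof.
move=> ab; transitivity (k * b - k * a); last by ring.
apply: (FTC_Rintegral (F := fun x => k * x)) => //.
- by move=> x; exact: cvg_cst.
- move=> x; apply: (drv_eq (drvM (drv_cst x k) (drv_id x))).
  by rewrite mul0r mulr1 add0r.
Qed.

Lemma Rintegral_itv_eq0 (g : R -> R) a b x0 : a < b -> continuous g ->
  (forall x, a <= x <= b -> 0 <= g x) -> \int[mu]_(x in `[a, b]) g x = 0 ->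
  a <= x0 <= b -> g x0 = 0.
Proof.
move=> ab cg g0 ig0 /andP[ax0 x0b]; apply/eqP; rewrite eq_le.
rewrite g0 ?ax0// andbT leNgt; apply/negP => gx0.
have /cvgrPdist_lt/(_ (g x0 / 2)) := cg x0.
have gx02 : 0 < g x0 / 2 by lra.
move=> /(_ gx02) /nbhs_ballP [e /= e0 He].
(* An interval around [x0] cut down to [[a, b]]; because [a < b], it keeps positive length even when
   [x0] is an endpoint. On it [g] exceeds [g x0 / 2]. *)
pose u := Num.max a (x0 - e / 2); pose v := Num.min b (x0 + e / 2).
have uv : u < v by rewrite /u /v lt_min !gt_max; apply/andP; split; apply/andP; split; lra.
have au : a <= u by rewrite /u le_max lexx.
have vb : v <= b by rewrite /v ge_min lexx.
have sub : `[u, v]%classic `<=` `[a, b].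
  by move=> x /=; rewrite !in_itv/= => /andP[h1 h2]; apply/andP; split; lra.
have : g x0 / 2 * (v - u) <= \int[mu]_(x in `[u, v]) g x.
  rewrite -(Rintegral_cst_itv _ (ltW uv)); apply: le_Rintegral => //.
  - by apply: (@continuous_itv_integrable _ (cst (g x0 / 2))) => x; exact: cvg_cst.
  - exact: continuous_itv_integrable.
  - move=> x /=; rewrite in_itv/= => /andP[].
    rewrite /u /v ge_max le_min => /andP[h1 h2] /andP[h3 h4].
    have : `|g x0 - g x| < g x0 / 2.
      by apply: He; rewrite /ball/= ltr_norml; apply/andP; split; lra.
    by rewrite ltr_norml => /andP[_]; lra.
have : \int[mu]_(x in `[u, v]) g x <= \int[mu]_(x in `[a, b]) g x.
  apply: fine_le.
  - by apply: integrable_fin_num => //; exact: continuous_itv_integrable.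
  - by apply: integrable_fin_num => //; exact: continuous_itv_integrable.
  apply: ge0_subset_integral => //.
    apply: measurable_int; exact: continuous_itv_integrable.
rewrite ig0; have : 0 < g x0 / 2 * (v - u) by rewrite mulr_gt0 ?subr_gt0.
lra.
Qed.

(** The maximum of [|ft|] over the closed rectangle is the dominating constant. The hypotheses on
    [f] are confined to an open interval of parameters because the densities below are
    differentiable in time for positive times only. *)
Lemma is_derive_Rintegral_param (f ft : R -> R -> R) a b u v t :
  u < t < v -> (forall s, u < s < v -> continuous (f s)) -> cont2 ft ->
  (forall s x : R, u < s < v -> is_derive s 1 (f ^~ x) (ft s x)) ->
  is_derive t 1 (fun s => \int[mu]_(x in `[a, b]) f s x)
    (\int[mu]_(x in `[a, b]) ft t x).
Proof.
move=> tuv cf cft dft.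
have [M [M0 HM]] := cont2_bounded u v a b cft.
have d1E s x : u < s < v -> partial1of2 f s x = ft s x.
  by move=> suv; rewrite partial1of2E; case: (dft s x suv).
have tuv' : `]u, v[%classic t by rewrite /= in_itv.
have intf s : `]u, v[%classic s -> mu.-integrable `[a, b] (EFin \o f s).
  by rewrite /= in_itv/= => suv; apply: continuous_itv_integrable; exact: cf.
have derf s x : `]u, v[%classic s -> `[a, b]%classic x -> derivable (f ^~ x) s 1.
  by rewrite /= in_itv/= => suv _; case: (dft s x suv).
have intM : mu.-integrable `[a, b] (EFin \o (fun=> M)).
  by apply: (@continuous_itv_integrable _ (cst M)) => x; exact: cvg_cst.
have bndf s x : `]u, v[%classic s -> `[a, b]%classic x -> `|partial1of2 f s x| <= M.
  rewrite /= !in_itv/= => suv abx; rewrite d1E//.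
  by apply: HM => //; case/andP: suv => /ltW -> /ltW ->.
have := @cvg_differentiation_under_integral R _ _ mu f _ (measurable_itv `[a, b])
  t u v tuv' intf derf (fun=> M) (fun=> M0) intM bndf.
have -> : \int[mu]_(x in `[a, b]) partial1of2 f t x = \int[mu]_(x in `[a, b]) ft t x.
  by apply: eq_Rintegral => x _; exact: d1E.
set L := \int[mu]_(x in `[a, b]) ft t x => HL.
have HL' : h^-1 *: (\int[mu]_(x in `[a, b]) f (h *: 1 + t) x -
    \int[mu]_(x in `[a, b]) f t x) @[h --> 0^'] --> L.
  have E (h : R) : h *: (1 : R) = h by rewrite /GRing.scale/= mulr1.
  by under eq_fun do rewrite E; exact: HL.
apply: DeriveDef; first by apply/cvg_ex; exists L.
by apply/cvg_lim.
Qed.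

(** An iterated integral, so that the one-dimensional fundamental theorem of calculus applies to the
    inner variable; [rint_swap] gives access to the other one. *)
Definition rint a b c d (f : R -> R -> R) : R :=
  \int[mu]_(y in `[c, d]) \int[mu]_(x in `[a, b]) f x y.

Section Rint.
Variables (a b c d : R).
Hypotheses (ab : a < b) (cd : c < d).
Local Notation I2 := (rint a b c d).

Let cinner f : cont2 f -> continuous (fun y => \int[mu]_(x in `[a, b]) f x y).
Proof. by move=> cf; exact: continuous_Rintegral_param. Qed.

Let iinner f y : cont2 f -> mu.-integrable `[a, b] (EFin \o f ^~ y).
Proof. by move=> cf; apply: continuous_itv_integrable; exact: cont2_x1. Qed.

Let iouter f : cont2 f ->
  mu.-integrable `[c, d] (EFin \o (fun y => \int[mu]_(x in `[a, b]) f x y)).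
Proof. by move=> cf; apply: continuous_itv_integrable; exact: cinner. Qed.

Lemma rint_eq f g :
  (forall x y, a <= x <= b -> c <= y <= d -> f x y = g x y) -> I2 f = I2 g.
Proof.
move=> fg; apply: eq_Rintegral => y; rewrite inE/= in_itv/= => yd.
by apply: eq_Rintegral => x; rewrite inE/= in_itv/= => xd; exact: fg.
Qed.

Lemma rint_swap f : cont2 f ->
  I2 f = \int[mu]_(x in `[a, b]) \int[mu]_(y in `[c, d]) f x y.
Proof.
move=> cf; rewrite /rint.
by rewrite -(Rintegral_prod21 (a := a) (b := b) (c := c) (d := d))// (Rintegral_prod12 (a := a) (b := b) (c := c) (d := d)).
Qed.

Lemma rintD f g : cont2 f -> cont2 g ->
  I2 (fun x y => f x y + g x y) = I2 f + I2 g.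
Proof.
move=> cf cg; rewrite /rint -RintegralD//; [|exact: iouter..].
by apply: eq_Rintegral => y _; rewrite RintegralD//; exact: iinner.
Qed.

Lemma rintZ k f : cont2 f -> I2 (fun x y => k * f x y) = k * I2 f.
Proof.
move=> cf; rewrite /rint -RintegralZl//; last exact: iouter.
by apply: eq_Rintegral => y _; rewrite RintegralZl//; exact: iinner.
Qed.

Lemma rint_cst k : I2 (fun _ _ => k) = k * ((b - a) * (d - c)).
Proof.
rewrite /rint; under eq_Rintegral do rewrite (Rintegral_cst_itv _ (ltW ab)).
by rewrite (Rintegral_cst_itv _ (ltW cd)); ring.
Qed.

Lemma le_rint f g : cont2 f -> cont2 g ->
  (forall x y, a <= x <= b -> c <= y <= d -> f x y <= g x y) -> I2 f <= I2 g.
Proof.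
move=> cf cg fg; apply: le_Rintegral => //; [exact: iouter..|].
move=> y /=; rewrite in_itv/= => yd; apply: le_Rintegral => //; [exact: iinner..|].
by move=> x /=; rewrite in_itv/= => xd; exact: fg.
Qed.

Lemma rint_ge0 f : cont2 f ->
  (forall x y, a <= x <= b -> c <= y <= d -> 0 <= f x y) -> 0 <= I2 f.
Proof.
move=> cf f0; apply: Rintegral_ge0 => y /=; rewrite in_itv/= => yd.
by apply: Rintegral_ge0 => x /=; rewrite in_itv/= => xd; exact: f0.
Qed.

Lemma rint_eq0 f x y : cont2 f ->
  (forall x y, a <= x <= b -> c <= y <= d -> 0 <= f x y) -> I2 f = 0 ->
  a <= x <= b -> c <= y <= d -> f x y = 0.
Proof.
move=> cf f0 if0 xd yd.
apply: (@Rintegral_itv_eq0 (f ^~ y) a b) => //; first exact: cont2_x1.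
  by move=> z zd; exact: f0.
apply: (@Rintegral_itv_eq0 (fun y => \int[mu]_(x in `[a, b]) f x y) c d) => //.
  exact: cinner.
move=> z zd; apply: Rintegral_ge0 => w /=; rewrite in_itv/= => wd; exact: f0.
Qed.

(** The divergence theorem on a rectangle whose opposite sides carry equal fluxes. In the
    applications they agree by periodicity or because the flux vanishes on both sides. *)
Lemma rint_div F1 F2 G1 G2 : cont2 G1 -> cont2 G2 ->
  (forall x y : R, is_derive x 1 (F1 ^~ y) (G1 x y)) ->
  (forall x y : R, is_derive y 1 (F2 x) (G2 x y)) ->
  (forall y, F1 a y = F1 b y) -> (forall x, F2 x c = F2 x d) ->
  I2 (fun x y => G1 x y + G2 x y) = 0.
Proof.
move=> cG1 cG2 dF1 dF2 F1ab F2cd.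
rewrite rintD// (rint_swap cG2) /rint.
under eq_Rintegral => y _ do rewrite (FTC_Rintegral (ltW ab) (cont2_x1 (y := y) cG1) (dF1 ^~ y)) F1ab subrr.
rewrite (Rintegral_cst_itv _ (ltW cd)) mul0r add0r.
under eq_Rintegral => x _ do rewrite (FTC_Rintegral (ltW cd) (cont2_x2 (x := x) cG2) (dF2 x)) F2cd subrr.
by rewrite (Rintegral_cst_itv _ (ltW ab)) mul0r.
Qed.

Lemma cont3_at g t : cont3 g -> cont2 (g t).
Proof.
move=> cg; apply: (cont3_comp cg); first by move=> z; exact: cvg_cst.
  by move=> z; exact: cvg_fst.
by move=> z; exact: cvg_snd.
Qed.

Lemma cont3_inner g : cont3 g -> cont2 (fun t y => \int[mu]_(x in `[a, b]) g t x y).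
Proof.
move=> cg; apply: (@continuous_Rintegral_param _ _ (fun x (s : R * R) => g s.1 x s.2)).
apply: (cont3_comp cg).
- by apply: cont_fst => z; exact: cvg_snd.
- by move=> z; exact: cvg_fst.
- by apply: cont_snd => z; exact: cvg_snd.
Qed.

Lemma cont_rint_param g : cont3 g -> continuous (fun t => I2 (g t)).
Proof.
move=> /cont3_inner cg.
by apply: (@continuous_Rintegral_param _ _ (fun y t => \int[mu]_(x in `[a, b]) g t x y)); exact: (cont2_swap cg).
Qed.

Lemma is_derive_rint_param g gt (t : R) : 0 < t -> cont3 g -> cont3 gt ->
  (forall s x y : R, 0 < s -> is_derive s 1 (fun s => g s x y) (gt s x y)) ->
  is_derive t 1 (fun s => I2 (g s)) (I2 (gt t)).
Proof.
move=> t0 cg cgt dg.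
have t0t : 0 < t < t + 1 by rewrite t0/=; lra.
apply: (is_derive_Rintegral_param (f := fun s y => \int[mu]_(x in `[a, b]) g s x y)
  (ft := fun s y => \int[mu]_(x in `[a, b]) gt s x y) c d t0t).
- by move=> s _; exact: (cont2_x2 (cont3_inner cg)).
- exact: cont3_inner.
- move=> s y st; apply: (is_derive_Rintegral_param (f := fun s x => g s x y)
    (ft := fun s x => gt s x y) a b st).
  + by move=> r _; exact: (cont2_x1 (y := y) (cont3_at (t := r) cg)).
  + apply: (cont3_comp cgt); first by move=> z; exact: cvg_fst.
      by move=> z; exact: cvg_snd.
    by move=> z; exact: cvg_cst.
  + by move=> r x /andP[r0 _]; exact: dg.
Qed.

End Rint.

End IteratedIntegrals.

(** * Regularity of the Biot-Savart law *)

Section BoxSeries.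
Context {R : realType}.
Implicit Types (F : int * int -> R) (k : int * int).

Definition boxsum F (N : nat) : R :=
  \sum_(i < N.*2.+1) \sum_(j < N.*2.+1) F (box_index N i j).

Definition boxlim F : R := limn (boxsum F).

Definition jbracket (n : int) : R := (1 + n%:~R ^+ 2)^-1.
(** A product weight: its sum over a box factorises into one-dimensional sums, and a single power of
    it absorbs a factor [k.1] or [k.2], that is, one derivative in either variable. *)
Definition wt k : R := jbracket k.1 * jbracket k.2.

Lemma jbracket_gt0 n : 0 < jbracket n.
Proof. by rewrite /jbracket invr_gt0 ltr_pwDl// sqr_ge0. Qed.

Lemma jbracket_le1 n : jbracket n <= 1.
Proof. by rewrite /jbracket invf_le1 ?lerDl ?sqr_ge0// ltr_pwDl// sqr_ge0. Qed.

Lemma wt_gt0 k : 0 < wt k.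
Proof. by rewrite mulr_gt0// jbracket_gt0. Qed.

Lemma wt_le1 k : wt k <= 1.
Proof. by rewrite mulr_ile1 ?jbracket_le1// ltW// jbracket_gt0. Qed.

Lemma norm_jbracket n : `|n%:~R| * jbracket n <= 1 :> R.
Proof.
rewrite /jbracket ler_pdivrMr; last by rewrite ltr_pwDl// sqr_ge0.
rewrite mul1r -(real_normK (num_real _)); set x := `|_|; nra.
Qed.

Lemma norm_wt1 k : `|k.1%:~R| * wt k <= 1 :> R.
Proof.
rewrite /wt mulrA mulr_ile1 ?norm_jbracket ?jbracket_le1//; last by rewrite ltW// jbracket_gt0.
by rewrite mulr_ge0// ltW// jbracket_gt0.
Qed.

Lemma norm_wt2 k : `|k.2%:~R| * wt k <= 1 :> R.
Proof.
rewrite /wt mulrCA mulr_ile1 ?norm_jbracket ?jbracket_le1//; first by rewrite ltW// jbracket_gt0.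
by rewrite mulr_ge0// ltW// jbracket_gt0.
Qed.

Lemma boxsumD F G N : boxsum (fun k => F k + G k) N = boxsum F N + boxsum G N.
Proof.
by rewrite /boxsum -big_split; apply: eq_bigr => i _; rewrite big_split.
Qed.

Lemma boxsumZ c F N : boxsum (fun k => c * F k) N = c * boxsum F N.
Proof.
by rewrite /boxsum mulr_sumr; apply: eq_bigr => i _; rewrite mulr_sumr.
Qed.

Lemma ler_boxsum F G N : (forall k, F k <= G k) -> boxsum F N <= boxsum G N.
Proof. by move=> FG; apply: ler_sum => i _; apply: ler_sum => j _. Qed.

Lemma ler_norm_boxsum F N : `|boxsum F N| <= boxsum (fun k => `|F k|) N.
Proof.
apply: le_trans (ler_norm_sum _ _ _) _; apply: ler_sum => i _.
exact: ler_norm_sum.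
Qed.

Let jbracketsum (N : nat) : R := \sum_(i < N.*2.+1) jbracket (i%:Z - N%:Z).

Let shift_sum (G : int -> R) N :
  \sum_(i < N.+1.*2.+1) G (i%:Z - N.+1%:Z) =
  G (- N.+1%:Z) + \sum_(i < N.*2.+1) G (i%:Z - N%:Z) + G N.+1%:Z.
Proof.
rewrite doubleS big_ord_recl big_ord_recr /= sub0r addrA; congr (_ + _ + G _).
- by apply: eq_bigr => i _; congr G; rewrite /bump /=; lia.
- by rewrite /bump /=; lia.
Qed.

(** Telescoping: [1 / (1 + n^2) <= 2 / n - 2 / (n + 1)], applied at [n = N + 1] and doubled for the
    two signs. The negative term makes the induction close; the base case is [1 <= 5 - 4]. *)
Let jbracketsum_le N : jbracketsum N <= 5 - 4 / N.+1%:R.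
Proof.
elim: N => [|N IH].
  by rewrite /jbracketsum big_ord1 /= subrr /jbracket /= expr0n /= addr0 invr1; lra.
rewrite /jbracketsum shift_sum -/(jbracketsum N).
have -> : jbracket (- N.+1%:Z) = jbracket N.+1%:Z by rewrite /jbracket mulrNz sqrrN.
have : jbracket N.+1%:Z <= 2 / N.+1%:R - 2 / N.+2%:R.
  rewrite /jbracket -pmulrn -[N.+2]addn1 natrD.
  have : (1 : R) <= N.+1%:R by rewrite ler1n.
  move: (N.+1%:R : R) => x x1.
  have -> : 2 / x - 2 / (x + 1) = 2 / (x * (x + 1)).
    by field; rewrite !gt_eqF//; lra.
  rewrite ler_pdivlMr; last by nra.
  rewrite mulrC ler_pdivrMr; nra.
move: IH; move: (N.+1%:R^-1 : R) (N.+2%:R^-1 : R) => u v; lra.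
Qed.

Lemma boxsum_wt_le N : boxsum wt N <= 25.
Proof.
have -> : boxsum wt N = jbracketsum N * jbracketsum N.
  by rewrite /boxsum /jbracketsum big_distrlr.
have h0 : 0 <= jbracketsum N by apply: sumr_ge0 => i _; rewrite ltW// jbracket_gt0.
have h5 : jbracketsum N <= 5.
  by apply: le_trans (jbracketsum_le N) _; rewrite lerBlDr lerDl divr_ge0.
nra.
Qed.

Let boxsum_nondecreasing F : (forall k, 0 <= F k) ->
  {homo boxsum F : n m / (n <= m)%N >-> n <= m}.
Proof.
move=> F0; apply/nondecreasing_seqP => N.
rewrite /boxsum /box_index.
rewrite (shift_sum (fun a => \sum_(j < N.+1.*2.+1) F (a, (j%:Z - N.+1%:Z)))).
have h a : 0 <= \sum_(j < N.+1.*2.+1) F (a, (j%:Z - N.+1%:Z)).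
  by apply: sumr_ge0.
apply: (@le_trans _ _ (\sum_(i < N.*2.+1)
   \sum_(j < N.+1.*2.+1) F (i%:Z - N%:Z, (j%:Z - N.+1%:Z)))).
  apply: ler_sum => i _.
  rewrite (shift_sum (fun b => F (i%:Z - N%:Z, b))).
  by rewrite [leRHS]addrAC lerDr addr_ge0.
by rewrite [leRHS]addrAC lerDr addr_ge0.
Qed.

(** A graded form of rapid decay: a derivative in either variable lowers [p] by one, and [p = 1]
    suffices for absolute summability. Coefficients of smooth functions satisfy it for every [p]. *)
Definition decay (p : nat) F := exists D, 0 <= D /\ forall k, `|F k| <= D * wt k ^+ p.

Lemma decay_abs F p : decay p.+1 F -> exists D, 0 <= D /\ forall k, `|F k| <= D * wt k.
Proof.
move=> [D [D0 HD]]; exists D; split => // k; apply: le_trans (HD k) _.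
rewrite ler_wpM2l// exprS; apply: ler_piMr; first by rewrite ltW// wt_gt0.
by rewrite exprn_ile1// ?wt_le1// ltW// wt_gt0.
Qed.

(** [F] is the difference of [F + D wt] and [D wt]. Both have nonnegative terms bounded by [2 D wt],
    so their box sums are nondecreasing and bounded. *)
Lemma boxsum_cvg F D : (forall k, `|F k| <= D * wt k) -> cvgn (boxsum F).
Proof.
move=> FD; have D0 : 0 <= D.
  have := le_trans (normr_ge0 _) (FD (0, 0)).
  by rewrite pmulr_lge0// wt_gt0.
have cG G : (forall k, 0 <= G k <= 2 * D * wt k) -> cvgn (boxsum G).
  move=> G0; apply: nondecreasing_is_cvgn.
    by apply: boxsum_nondecreasing => k; case/andP: (G0 k).
  exists (2 * D * 25) => _ [N _ <-].
  apply: (@le_trans _ _ (boxsum (fun k => 2 * D * wt k) N)).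
    by apply: ler_boxsum => k; case/andP: (G0 k).
  by rewrite boxsumZ ler_wpM2l ?boxsum_wt_le// mulr_ge0.
have c1 : cvgn (boxsum (fun k => F k + D * wt k)).
  apply: cG => k; have := FD k; rewrite ler_norml => /andP[h1 h2].
  by apply/andP; split; lra.
have c2 : cvgn (boxsum (fun k => D * wt k)).
  apply: cG => k; have h : 0 <= D * wt k by rewrite mulr_ge0// ltW// wt_gt0.
  by apply/andP; split; lra.
have -> : boxsum F = (fun N => boxsum (fun k => F k + D * wt k) N - boxsum (fun k => D * wt k) N).
  by apply/funext => N; rewrite boxsumD addrK.
exact: is_cvgB.
Qed.

Lemma norm_boxlim F D : 0 <= D -> (forall k, `|F k| <= D * wt k) -> `|boxlim F| <= 25 * D.
Proof.
move=> D0 FD; have cF := boxsum_cvg FD.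
have : (fun N => `|boxsum F N|) @ \oo --> `|boxlim F| by apply: cvg_norm; exact: cF.
move=> cn; rewrite -(cvg_lim (@Rhausdorff R) cn).
apply: limr_le; first by apply/cvg_ex; exists `|boxlim F|.
apply: nearW => N; apply: le_trans (ler_norm_boxsum _ _) _.
apply: (@le_trans _ _ (boxsum (fun k => D * wt k) N)); first exact: ler_boxsum.
by rewrite boxsumZ mulrC ler_wpM2r ?boxsum_wt_le.
Qed.

Lemma boxlimD F G D E : (forall k, `|F k| <= D * wt k) -> (forall k, `|G k| <= E * wt k) ->
  boxlim (fun k => F k + G k) = boxlim F + boxlim G.
Proof.
move=> /boxsum_cvg cF /boxsum_cvg cG; rewrite /boxlim -limD//.
by congr (limn _); apply/funext => N; rewrite boxsumD.
Qed.

Lemma boxlimZ c F D : (forall k, `|F k| <= D * wt k) ->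
  boxlim (fun k => c * F k) = c * boxlim F.
Proof.
move=> /boxsum_cvg cF; rewrite /boxlim.
have -> : boxsum (fun k => c * F k) = (fun N => c *: boxsum F N).
  by apply/funext => N; rewrite boxsumZ.
exact: limZr.
Qed.

End BoxSeries.

Section TrigSeries.
Context {R : realType}.
Implicit Types (a b : int * int -> R) (k : int * int).

Lemma drvB (x : R) (f g : R -> R) df dg : is_derive x 1 f df -> is_derive x 1 g dg ->
  is_derive x 1 (fun y => f y - g y) (df - dg).
Proof. by move=> hf hg; exact: drvD hf (drvN hg). Qed.

Lemma lipschitz_MVT (F dF : R -> R) M x y :
  (forall z : R, is_derive z 1 F (dF z)) ->
  (forall z, Num.min x y <= z <= Num.max x y -> `|dF z| <= M) ->
  `|F x - F y| <= M * `|x - y|.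
Proof.
move=> dFF HM; wlog xy : x y HM / y <= x => [W|].
  have [|/ltW xy] := leP y x; first exact: W.
  by rewrite distrC [X in _ * X]distrC; apply: W => // z; rewrite minC maxC; exact: HM.
have [|c] := @MVT_segment R F dF _ _ xy (fun z _ => dFF z).
  by apply: continuous_subspaceT; exact: drv_continuous dFF.
rewrite in_itv/= => cxy ->; rewrite normrM ler_wpM2r// HM//.
by rewrite minC maxC min_l// max_r.
Qed.

(** The mean value theorem is used twice: on [F z - z * dF y], and on [dF] to bound the derivative
    of that function by [M |h|]. This gives [M] in place of the usual [M / 2]. *)
Lemma taylor_MVT (F dF ddF : R -> R) M y h :
  (forall z : R, is_derive z 1 F (dF z)) -> (forall z : R, is_derive z 1 dF (ddF z)) ->
  (forall z, `|ddF z| <= M) -> `|F (y + h) - F y - h * dF y| <= M * h ^+ 2.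
Proof.
move=> d1 d2 HM.
have M0 : 0 <= M by apply: le_trans (HM 0).
have H : `|F (y + h) - (y + h) * dF y - (F y - y * dF y)| <= M * `|h| * `|y + h - y|.
  apply: (@lipschitz_MVT (fun z => F z - z * dF y) (fun z => dF z - dF y)).
- move=> z; apply: (drv_eq (drvB (d1 z) (drvM (drv_id z) (drv_cst z (dF y))))).
  by rewrite mul1r mulr0 addr0.
- move=> z zy; apply: le_trans (lipschitz_MVT d2 (fun w _ => HM w)) _.
  rewrite ler_wpM2l//; move: zy; rewrite ge_min le_max.
  move=> /andP[/orP h1 /orP h2]; rewrite ler_norml.
  have [h0|/ltW h0] := lerP 0 h; [rewrite (ger0_norm h0)|rewrite (ler0_norm h0)];
    by apply/andP; case: h1 h2 => h1 [] h2; split; lra.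
rewrite (_ : _ - _ = F (y + h) - (y + h) * dF y - (F y - y * dF y)); last by ring.
apply: le_trans H _; rewrite (addrC y) addrK -mulrA -expr2 real_normK ?num_real//.
Qed.

Lemma is_derive_quadratic (F : R -> R) (y G M : R) :
  (forall h, `|F (y + h) - F y - h * G| <= M * h ^+ 2) -> is_derive y 1 F G.
Proof.
move=> H; have M0 : 0 <= M.
  by have := le_trans (normr_ge0 _) (H 1); rewrite expr1n mulr1.
have L : h^-1 *: (F (h *: (1 : R) + y) - F y) @[h --> 0^'] --> G.
  apply/cvgrPdist_le => /= e e0; near=> h.
  have h0 : h != 0 by near: h; exact: nbhs_dnbhs_neq.
  have hE : `|h| <= e / (M + 1).
    near: h; apply: dnbhs0_le; rewrite divr_gt0//; lra.
  have -> : h *: (1 : R) = h by rewrite /GRing.scale/= mulr1.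
  rewrite /GRing.scale/= distrC.
  have -> : h^-1 * (F (h + y) - F y) - G = h^-1 * (F (y + h) - F y - h * G).
    by rewrite [RHS]mulrBr mulrA mulVf// mul1r (addrC h).
  rewrite normrM normfV ler_pdivrMl ?normr_gt0//.
  apply: le_trans (H h) _.
  rewrite -(real_normK (num_real h)) expr2 mulrA mulrAC (mulrC _ e) ler_wpM2r//.
  apply: le_trans (_ : M * (e / (M + 1)) <= e); first by rewrite ler_wpM2l.
  by rewrite mulrA ler_pdivrMr; nra.
apply: DeriveDef; first by apply/cvg_ex; exists G.
exact/cvg_lim.
Unshelve. all: by end_near. Qed.

Definition trig a b (x1 x2 : R) k : R :=
  a k * cos (dot k x1 x2) + b k * sin (dot k x1 x2).

Definition trig_series a b (x1 x2 : R) : R := boxlim (trig a b x1 x2).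

Definition d1 a k : R := k.1%:~R * a k.
Definition d2 a k : R := k.2%:~R * a k.

Lemma decayN p a : decay p a -> decay p (fun k => - a k).
Proof. by move=> [D [D0 HD]]; exists D; split => // k; rewrite normrN. Qed.

Lemma decay_d1 p a : decay p.+1 a -> decay p (d1 a).
Proof.
move=> [D [D0 HD]]; exists D; split => // k; rewrite /d1 normrM.
apply: (@le_trans _ _ (`|k.1%:~R| * (D * wt k ^+ p.+1))); first by rewrite ler_wpM2l.
rewrite exprS mulrCA [_ * (wt k * _)]mulrA ler_wpM2l//.
by rewrite ler_piMl ?norm_wt1// exprn_ge0// ltW// wt_gt0.
Qed.

Lemma decay_d2 p a : decay p.+1 a -> decay p (d2 a).
Proof.
move=> [D [D0 HD]]; exists D; split => // k; rewrite /d2 normrM.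
apply: (@le_trans _ _ (`|k.2%:~R| * (D * wt k ^+ p.+1))); first by rewrite ler_wpM2l.
rewrite exprS mulrCA [_ * (wt k * _)]mulrA ler_wpM2l//.
by rewrite ler_piMl ?norm_wt2// exprn_ge0// ltW// wt_gt0.
Qed.

Lemma norm_cos_sin (u v x : R) : `|u * cos x + v * sin x| <= `|u| + `|v|.
Proof.
apply: le_trans (ler_normD _ _) _; rewrite !normrM.
by apply: lerD; rewrite ler_piMr// ?cos_max ?sin_max.
Qed.

Lemma decay_trig p a b : decay p.+1 a -> decay p.+1 b ->
  exists D, 0 <= D /\ forall x1 x2 k, `|trig a b x1 x2 k| <= D * wt k.
Proof.
move=> /decay_abs[D [D0 HD]] /decay_abs[E [E0 HE]].
exists (D + E); split => [|x1 x2 k]; first exact: addr_ge0.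
by rewrite mulrDl; apply: le_trans (norm_cos_sin _ _ _) (lerD (HD k) (HE k)).
Qed.

Lemma drv_cos_sin (u v c e : R) (y : R) :
  is_derive y 1 (fun y => u * cos (c * y + e) + v * sin (c * y + e))
    (c * v * cos (c * y + e) + - (c * u) * sin (c * y + e)).
Proof.
have dl : is_derive y 1 (fun y => c * y + e) c.
  apply: (drv_eq (drvD (drvM (drv_cst y c) (drv_id y)) (drv_cst y e))).
  by rewrite mul0r mulr1 add0r addr0.
apply: (drv_eq (drvD (drvM (drv_cst y u) (drv_cos dl)) (drvM (drv_cst y v) (drv_sin dl)))).
by rewrite !mul0r; ring.
Qed.

Lemma dot2E k (x1 x2 : R) : dot k x1 x2 = k.2%:~R * x2 + k.1%:~R * x1.
Proof. by rewrite /dot addrC. Qed.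

Lemma drv_trig1 a b x1 x2 k : is_derive (x1 : R) 1 (fun y => trig a b y x2 k)
  (trig (d1 b) (fun k => - d1 a k) x1 x2 k).
Proof. exact: (drv_cos_sin (a k) (b k) k.1%:~R (k.2%:~R * x2) x1). Qed.

Lemma drv_trig2 a b x1 x2 k : is_derive (x2 : R) 1 (fun y => trig a b x1 y k)
  (trig (d2 b) (fun k => - d2 a k) x1 x2 k).
Proof.
have := drv_cos_sin (a k) (b k) k.2%:~R (k.1%:~R * x1) x2.
rewrite /trig dot2E; congr is_derive; apply/funext => y; by rewrite dot2E.
Qed.

(** The mechanism of termwise differentiation: the quadratic Taylor remainder of each term carries
    the summable weight, so the remainders add up to a quadratic remainder of the series, and
    [is_derive_quadratic] applies. *)
Lemma boxlim_taylor (F : R -> int * int -> R) (G : int * int -> R) y h D E M :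
  (forall y k, `|F y k| <= D * wt k) -> (forall k, `|G k| <= E * wt k) -> 0 <= M ->
  (forall k, `|F (y + h) k - F y k - h * G k| <= M * h ^+ 2 * wt k) ->
  `|boxlim (F (y + h)) - boxlim (F y) - h * boxlim G| <= 25 * M * h ^+ 2.
Proof.
move=> FD GE M0 H.
have -> : boxlim (F (y + h)) - boxlim (F y) - h * boxlim G =
    boxlim (fun k => F (y + h) k - F y k - h * G k).
  have FD' k : `|(-1) * F y k| <= D * wt k by rewrite mulN1r normrN.
  have GE' k : `|(- h) * G k| <= (`|h| * E) * wt k.
    by rewrite normrM normrN -mulrA ler_wpM2l.
  have FF k : `|F (y + h) k + (-1) * F y k| <= (D + D) * wt k.
    by rewrite mulrDl; apply: le_trans (ler_normD _ _) (lerD (FD _ k) (FD' k)).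
  rewrite -mulNr -(boxlimZ _ GE) -[- boxlim (F y)]mulN1r -(boxlimZ _ (FD y)).
  rewrite -(boxlimD (FD _) FD') -(boxlimD FF GE').
  by congr boxlim; apply/funext => k; rewrite mulN1r mulNr.
by rewrite -mulrA; apply: norm_boxlim => //; rewrite mulr_ge0// sqr_ge0.
Qed.

(** Of the three orders of decay, two pay for the second derivative in the Taylor remainder and one
    for summability. *)
Lemma is_derive_trig_series1 a b x1 x2 : decay 3 a -> decay 3 b ->
  is_derive (x1 : R) 1 (fun y => trig_series a b y x2)
    (trig_series (d1 b) (fun k => - d1 a k) x1 x2).
Proof.
move=> da db.
have [D [D0 HD]] := decay_trig da db.
have [E [E0 HE]] := decay_trig (decay_d1 db) (decayN (decay_d1 da)).
have [M [M0 HM]] := decay_trig (decayN (decay_d1 (decay_d1 da))) (decayN (decay_d1 (decay_d1 db))).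
apply: (is_derive_quadratic (M := 25 * M)) => h.
apply: (boxlim_taylor (F := fun y k => trig a b y x2 k) (D := D) (E := E)) => // k.
rewrite [leRHS]mulrAC; apply: (taylor_MVT (F := fun y => trig a b y x2 k)
  (dF := fun y => trig (d1 b) (fun k => - d1 a k) y x2 k) (ddF := fun y =>
  trig (d1 (fun k => - d1 a k)) (fun k => - d1 (d1 b) k) y x2 k)).
- by move=> z; exact: drv_trig1.
- by move=> z; exact: drv_trig1.
- by move=> z; have := HM z x2 k; rewrite /trig /d1 mulrN.
Qed.

Lemma is_derive_trig_series2 a b x1 x2 : decay 3 a -> decay 3 b ->
  is_derive (x2 : R) 1 (fun y => trig_series a b x1 y)
    (trig_series (d2 b) (fun k => - d2 a k) x1 x2).
Proof.
move=> da db.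
have [D [D0 HD]] := decay_trig da db.
have [E [E0 HE]] := decay_trig (decay_d2 db) (decayN (decay_d2 da)).
have [M [M0 HM]] := decay_trig (decayN (decay_d2 (decay_d2 da))) (decayN (decay_d2 (decay_d2 db))).
apply: (is_derive_quadratic (M := 25 * M)) => h.
apply: (boxlim_taylor (F := fun y k => trig a b x1 y k) (D := D) (E := E)) => // k.
rewrite [leRHS]mulrAC; apply: (taylor_MVT (F := fun y => trig a b x1 y k)
  (dF := fun y => trig (d2 b) (fun k => - d2 a k) x1 y k) (ddF := fun y =>
  trig (d2 (fun k => - d2 a k)) (fun k => - d2 (d2 b) k) x1 y k)).
- by move=> z; exact: drv_trig2.
- by move=> z; exact: drv_trig2.
- by move=> z; have := HM x1 z k; rewrite /trig /d2 mulrN.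
Qed.

Lemma lipschitz_cont2 (f : R -> R -> R) L :
  (forall x1 x2 y1 y2, `|f x1 x2 - f y1 y2| <= L * (`|x1 - y1| + `|x2 - y2|)) ->
  cont2 f.
Proof.
move=> H [x1 x2]; have L0 : 0 <= L.
  have := le_trans (normr_ge0 _) (H 1 0 0 0).
  by rewrite !subr0 normr1 normr0 addr0 mulr1.
apply/cvgrPdist_le => /= e e0; have de : 0 < e / (L + 1) / 2 by rewrite !divr_gt0//; lra.
exists (ball x1 (e / (L + 1) / 2), ball x2 (e / (L + 1) / 2)) => /=.
  by split; exact: nbhsx_ballx.
move=> [y1 y2] [/= h1 h2]; rewrite /ball/= in h1 h2.
apply: le_trans (H _ _ _ _) _.
apply: (@le_trans _ _ (L * (e / (L + 1)))); first by rewrite ler_wpM2l//; lra.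
by rewrite mulrA ler_pdivrMr; nra.
Qed.

Lemma trig_series_cont2 a b : decay 2 a -> decay 2 b -> cont2 (trig_series a b).
Proof.
move=> da db.
have [D [D0 HD]] := decay_trig da db.
have [E [E0 HE]] := decay_trig (decay_d1 db) (decayN (decay_d1 da)).
have [M [M0 HM]] := decay_trig (decay_d2 db) (decayN (decay_d2 da)).
apply: (lipschitz_cont2 (L := 25 * (E + M))) => x1 x2 y1 y2.
have HD' k : `|(-1) * trig a b y1 y2 k| <= D * wt k by rewrite mulN1r normrN.
rewrite /trig_series -[- boxlim _]mulN1r -(boxlimZ _ (HD y1 y2)).
rewrite -(boxlimD (HD x1 x2) HD') -mulrA.
apply: norm_boxlim => [|k]; first by rewrite mulr_ge0// addr_ge0.
rewrite mulN1r (_ : _ - _ = (trig a b x1 x2 k - trig a b y1 x2 k) +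
  (trig a b y1 x2 k - trig a b y1 y2 k)); last by ring.
apply: le_trans (ler_normD _ _) _.
have h1 : `|trig a b x1 x2 k - trig a b y1 x2 k| <= E * wt k * `|x1 - y1|.
  apply: (lipschitz_MVT (F := fun y => trig a b y x2 k)
    (dF := fun y => trig (d1 b) (fun k => - d1 a k) y x2 k)) => z; first exact: drv_trig1.
  by move=> _; exact: HE.
have h2 : `|trig a b y1 x2 k - trig a b y1 y2 k| <= M * wt k * `|x2 - y2|.
  apply: (lipschitz_MVT (F := fun y => trig a b y1 y k)
    (dF := fun y => trig (d2 b) (fun k => - d2 a k) y1 y k)) => z; first exact: drv_trig2.
  by move=> _; exact: HM.
apply: le_trans (lerD h1 h2) _.
have w0 := @wt_gt0 R k; have n1 := normr_ge0 (x1 - y1); have n2 := normr_ge0 (x2 - y2).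
rewrite -subr_ge0 (_ : _ - _ = E * wt k * `|x2 - y2| + M * wt k * `|x1 - y1|); last by ring.
by apply: addr_ge0; apply: mulr_ge0 => //; apply: mulr_ge0 => //; exact: ltW.
Qed.

Lemma cosD2piz (x : R) (n : int) : cos (x + n%:~R * (2 * pi)) = cos x /\
  sin (x + n%:~R * (2 * pi)) = sin x.
Proof.
have N (m : nat) (y : R) : cos (y + m%:R * (2 * pi)) = cos y /\ sin (y + m%:R * (2 * pi)) = sin y.
  have -> : m%:R * (2 * pi) = (pi *+ 2 : R) *+ m by rewrite -[RHS]mulr_natl; congr (_ * _); rewrite mulr_natl.
  by rewrite (periodicn (@cosD2pi R)) (periodicn (@sinD2pi R)).
case: n => m; first exact: N.
have [h1 h2] := N m.+1 (x + (Negz m)%:~R * (2 * pi)).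
rewrite -h1 -h2 -addrA -mulrDl.
by rewrite NegzE mulrNz -pmulrn addNr mul0r addr0.
Qed.

Lemma trig_series_periodic a b : periodic2 (trig_series a b).
Proof.
move=> x1 x2; split; congr boxlim; apply/funext => k; rewrite /trig.
  have -> : dot k (x1 + 2 * pi) x2 = dot k x1 x2 + k.1%:~R * (2 * pi) by rewrite /dot; ring.
  by have [-> ->] := cosD2piz (dot k x1 x2) k.1.
have -> : dot k x1 (x2 + 2 * pi) = dot k x1 x2 + k.2%:~R * (2 * pi) by rewrite /dot; ring.
by have [-> ->] := cosD2piz (dot k x1 x2) k.2.
Qed.

End TrigSeries.

Section Cont2.
Context {R : realType}.
Implicit Types f g : R -> R -> R.

Lemma cont2_cst (c : R) : cont2 (fun _ _ => c).
Proof. by move=> z; exact: cvg_cst. Qed.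

Lemma cont2D f g : cont2 f -> cont2 g -> cont2 (fun x y => f x y + g x y).
Proof. by move=> cf cg z; apply: cvgD; [exact: cf|exact: cg]. Qed.

Lemma cont2N f : cont2 f -> cont2 (fun x y => - f x y).
Proof. by move=> cf z; apply: cvgN; exact: cf. Qed.

Lemma cont2M f g : cont2 f -> cont2 g -> cont2 (fun x y => f x y * g x y).
Proof. by move=> cf cg z; apply: cvgM; [exact: cf|exact: cg]. Qed.

Lemma cont2_fun (h : R -> R) f : continuous h -> cont2 f -> cont2 (fun x y => h (f x y)).
Proof. by move=> ch cf; exact: (cont_comp cf ch). Qed.

Lemma cont2_sin f : cont2 f -> cont2 (fun x y => sin (f x y)).
Proof. by move=> cf; exact: (cont_comp cf (@continuous_sin R)). Qed.

Lemma cont2_cos f : cont2 f -> cont2 (fun x y => cos (f x y)).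
Proof. by move=> cf; exact: (cont_comp cf (@continuous_cos R)). Qed.

Lemma cont2_X f n : cont2 f -> cont2 (fun x y => f x y ^+ n).
Proof. by move=> cf; exact: (cont_comp cf (@exprn_continuous R n)). Qed.

Lemma cont2_proj1 : cont2 (fun x _ : R => x).
Proof. by move=> z; exact: cvg_fst. Qed.

Lemma cont2_proj2 : cont2 (fun _ x : R => x).
Proof. by move=> z; exact: cvg_snd. Qed.

Lemma cont2_fun1 (h : R -> R) : continuous h -> cont2 (fun x _ : R => h x).
Proof. by move=> ch; exact: (cont_comp cont2_proj1 ch). Qed.

End Cont2.

(** Joint continuity by recursion on the shape of the expression. Leaves are closed from the
    context, which is why continuity facts are collected there before each integration by parts. *)
Ltac c2 := lazymatch goal with
  | |- cont2 (fun x y => @?f x y + @?g x y) => apply: (@cont2D _ f g); c2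
  | |- cont2 (fun x y => - @?f x y) => apply: (@cont2N _ f); c2
  | |- cont2 (fun x y => @?f x y * @?g x y) => apply: (@cont2M _ f g); c2
  | |- cont2 (fun x y => sin (@?f x y)) => apply: (@cont2_sin _ f); c2
  | |- cont2 (fun x y => cos (@?f x y)) => apply: (@cont2_cos _ f); c2
  | |- cont2 (fun x y => @?f x y ^+ ?n) => apply: (@cont2_X _ f n); c2
  | |- cont2 (fun x y => x) => exact: cont2_proj1
  | |- cont2 (fun x y => y) => exact: cont2_proj2
  | |- cont2 (fun x y => ?c) => first [assumption | exact: cont2_cst | idtac]
  | |- cont2 _ => first [assumption | idtac]
  | |- _ => idtac
  end.

Section RintDiv.
Context {R : realType}.
Variables (a b c d : R).
Hypotheses (ab : a < b) (cd : c < d).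
Local Notation I2 := (rint a b c d).

(** Comparison of integrals modulo a divergence: once the flux [(F1, F2)] is exhibited, an energy
    estimate becomes a pointwise inequality to be settled by algebra. *)
Lemma le_rint_div f g F1 F2 G1 G2 : cont2 f -> cont2 g -> cont2 G1 -> cont2 G2 ->
  (forall x y : R, is_derive x 1 (F1 ^~ y) (G1 x y)) ->
  (forall x y : R, is_derive y 1 (F2 x) (G2 x y)) ->
  (forall y, F1 a y = F1 b y) -> (forall x, F2 x c = F2 x d) ->
  (forall x y, a <= x <= b -> c <= y <= d -> f x y <= g x y + (G1 x y + G2 x y)) ->
  I2 f <= I2 g.
Proof.
move=> cf cg cG1 cG2 dF1 dF2 F1ab F2cd H.
have E := rint_div ab cd cG1 cG2 dF1 dF2 F1ab F2cd.
have cG : cont2 (fun x y => G1 x y + G2 x y) by c2.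
have EE := rintD a b c d cg cG; rewrite E addr0 in EE; rewrite -EE.
by apply: le_rint => //; c2.
Qed.

Lemma rint_eq_div f g F1 F2 G1 G2 : cont2 f -> cont2 g -> cont2 G1 -> cont2 G2 ->
  (forall x y : R, is_derive x 1 (F1 ^~ y) (G1 x y)) ->
  (forall x y : R, is_derive y 1 (F2 x) (G2 x y)) ->
  (forall y, F1 a y = F1 b y) -> (forall x, F2 x c = F2 x d) ->
  (forall x y, a <= x <= b -> c <= y <= d -> f x y = g x y + (G1 x y + G2 x y)) ->
  I2 f = I2 g.
Proof.
move=> cf cg cG1 cG2 dF1 dF2 F1ab F2cd H.
have E := rint_div ab cd cG1 cG2 dF1 dF2 F1ab F2cd.
have cG : cont2 (fun x y => G1 x y + G2 x y) by c2.
have EE := rintD a b c d cg cG; rewrite E addr0 in EE; rewrite -EE.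
exact: rint_eq.
Qed.

Lemma norm_rint f M : cont2 f ->
  (forall x y, a <= x <= b -> c <= y <= d -> `|f x y| <= M) ->
  `|I2 f| <= M * ((b - a) * (d - c)).
Proof.
move=> cf HM; rewrite ler_norml -mulNr -!(rint_cst ab cd); apply/andP; split;
  apply: le_rint => //; try exact: cont2_cst; move=> x y hx hy.
  by have := HM x y hx hy; rewrite ler_norml => /andP[].
by have := HM x y hx hy; rewrite ler_norml => /andP[].
Qed.

End RintDiv.

(** * Fourier coefficients of smooth functions *)

Section Fourier.
Context {R : realType}.
Implicit Types f g : R -> R -> R.
Local Notation mu := (@lebesgue_measure R).
Local Notation J := (rint (- pi) pi (- pi) (pi : R)).

Lemma pi_lt : - pi < pi :> R.
Proof. by have := @pi_gt0 R; lra. Qed.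

Lemma Ck2_cont n f : Ck2 n f -> cont2 f.
Proof. by case: n => [|n] []. Qed.

Lemma smooth_cont2 f : smooth_torus f -> cont2 f.
Proof. by case=> _ /(_ 0%N) /Ck2_cont. Qed.

Lemma smooth_drv1 f (x1 x2 : R) : smooth_torus f -> is_derive x1 1 (f ^~ x2) (dx1 f x1 x2).
Proof.
move=> [_ /(_ 1%N) [_ [d1f _ _ _]]]; rewrite /dx1 derive1E.
exact/derivableP/d1f.
Qed.

Lemma smooth_drv2 f (x1 x2 : R) : smooth_torus f -> is_derive x2 1 (f x1) (dx2 f x1 x2).
Proof.
move=> [_ /(_ 1%N) [_ [_ d2f _ _]]]; rewrite /dx2 derive1E.
exact/derivableP/d2f.
Qed.

Lemma drv_dx1 f (x1 x2 l : R) : is_derive x1 1 (f ^~ x2) l -> dx1 f x1 x2 = l.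
Proof. by move=> h; rewrite /dx1 derive1E; case: h. Qed.

Lemma drv_dx2 f (x1 x2 l : R) : is_derive x2 1 (f x1) l -> dx2 f x1 x2 = l.
Proof. by move=> h; rewrite /dx2 derive1E; case: h. Qed.

Lemma derive1_shift (g : R -> R) c x :
  (forall y, g (y + c) = g y) -> derive1 g (x + c) = derive1 g x.
Proof. by move=> gc; rewrite /derive1; under eq_fun do rewrite addrA !gc. Qed.

Lemma periodic2_dx1 f : periodic2 f -> periodic2 (dx1 f).
Proof.
move=> pf x1 x2; split; rewrite /dx1.
  by apply: derive1_shift => y; have [] := pf y x2.
by congr (derive1 _ x1); apply/funext => y; have [] := pf y x2.
Qed.

Lemma periodic2_dx2 f : periodic2 f -> periodic2 (dx2 f).
Proof.
move=> pf x1 x2; split; rewrite /dx2.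
  by congr (derive1 _ x2); apply/funext => y; have [] := pf x1 y.
by apply: derive1_shift => y; have [] := pf x1 y.
Qed.

Lemma smooth_dx1 f : smooth_torus f -> smooth_torus (dx1 f).
Proof.
move=> [pf cf]; split; first exact: periodic2_dx1.
by move=> n; have [_ []] := cf n.+1.
Qed.

Lemma smooth_dx2 f : smooth_torus f -> smooth_torus (dx2 f).
Proof.
move=> [pf cf]; split; first exact: periodic2_dx2.
by move=> n; have [_ []] := cf n.+1.
Qed.

Lemma smoothB f g : smooth_torus f -> smooth_torus g ->
  smooth_torus (fun x y => f x y - g x y).
Proof.
move=> sf sg; split.
  move=> x1 x2; have [[f1 f2] [g1 g2]] := (sf.1 x1 x2, sg.1 x1 x2).
  by rewrite f1 f2 g1 g2.
move=> n; elim: n f g sf sg => [|n IH] f g sf sg.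
  by have cf := smooth_cont2 sf; have cg := smooth_cont2 sg; split => //; exact: (cont2D cf (cont2N cg)).
have D1 (x1 x2 : R) := drvB (smooth_drv1 x1 x2 sf) (smooth_drv1 x1 x2 sg).
have D2 (x1 x2 : R) := drvB (smooth_drv2 x1 x2 sf) (smooth_drv2 x1 x2 sg).
split; first by have cf := smooth_cont2 sf; have cg := smooth_cont2 sg; exact: (cont2D cf (cont2N cg)).
split.
- by move=> x1 x2; case: (D1 x1 x2).
- by move=> x1 x2; case: (D2 x1 x2).
- rewrite (_ : dx1 _ = (fun x y => dx1 f x y - dx1 g x y)); first by apply: IH; exact: smooth_dx1.
  by apply/funext => x1; apply/funext => x2; exact: drv_dx1 (D1 _ _).
- rewrite (_ : dx2 _ = (fun x y => dx2 f x y - dx2 g x y)); first by apply: IH; exact: smooth_dx2.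
  by apply/funext => x1; apply/funext => x2; exact: drv_dx2 (D2 _ _).
Qed.

Lemma periodic2_pi1 f x2 : periodic2 f -> f (- pi) x2 = f pi x2.
Proof. by move=> pf; have [<- _] := pf (- pi) x2; congr f; ring. Qed.

Lemma periodic2_pi2 f x1 : periodic2 f -> f x1 (- pi) = f x1 pi.
Proof. by move=> pf; have [_ <-] := pf x1 (- pi); congr f; ring. Qed.

(** The shift [phi] treats cosine and sine coefficients at once: [phi = 0] gives the cosine,
    [phi = - (pi / 2)] the sine. *)
Definition phase (k : int * int) (phi x1 x2 : R) : R := dot k x1 x2 + phi.

Lemma phase_pi1 k phi x2 : cos (phase k phi (- pi) x2) = cos (phase k phi pi x2) /\
  sin (phase k phi (- pi) x2) = sin (phase k phi pi x2).
Proof.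
rewrite (_ : phase k phi pi x2 = phase k phi (- pi) x2 + k.1%:~R * (2 * pi)); last first.
  by rewrite /phase /dot; ring.
by have [-> ->] := cosD2piz (phase k phi (- pi) x2) k.1.
Qed.

Lemma phase_pi2 k phi x1 : cos (phase k phi x1 (- pi)) = cos (phase k phi x1 pi) /\
  sin (phase k phi x1 (- pi)) = sin (phase k phi x1 pi).
Proof.
rewrite (_ : phase k phi x1 pi = phase k phi x1 (- pi) + k.2%:~R * (2 * pi)); last first.
  by rewrite /phase /dot; ring.
by have [-> ->] := cosD2piz (phase k phi x1 (- pi)) k.2.
Qed.

Lemma cont2_phase k phi : cont2 (phase k phi).
Proof.
by have h : cont2 (fun x y : R => k.1%:~R * x + k.2%:~R * y + phi); [c2|exact: h].
Qed.

Lemma drv_phase1 k phi (x1 x2 : R) : is_derive x1 1 (phase k phi ^~ x2) k.1%:~R.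
Proof.
rewrite /phase /dot.
apply: (drv_eq (drvD (drvD (drvM (drv_cst x1 k.1%:~R) (drv_id x1)) (drv_cst x1 (k.2%:~R * x2))) (drv_cst x1 phi))).
by ring.
Qed.

Lemma drv_phase2 k phi (x1 x2 : R) : is_derive x2 1 (phase k phi x1) k.2%:~R.
Proof.
rewrite /phase /dot.
apply: (drv_eq (drvD (drvD (drv_cst x2 (k.1%:~R * x1)) (drvM (drv_cst x2 k.2%:~R) (drv_id x2))) (drv_cst x2 phi))).
by ring.
Qed.

Definition phase_coef f phi k : R := J (fun x1 x2 => cos (phase k phi x1 x2) * f x1 x2).

(** The operator [1 - d_1^2] has the symbol [1 + k_1^2], which never vanishes and is the inverse of
    the first factor of [wt]. Together with its analogue in [x2] it therefore gains exactly one
    order in [decay]. *)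
Lemma phase_coef_L1 f phi k : smooth_torus f ->
  phase_coef (fun x y => f x y - dx1 (dx1 f) x y) phi k = (1 + k.1%:~R ^+ 2) * phase_coef f phi k.
Proof.
move=> sf; have sf1 := smooth_dx1 sf; have sf11 := smooth_dx1 sf1.
have cf := smooth_cont2 sf; have cf1 := smooth_cont2 sf1; have cf11 := smooth_cont2 sf11.
have cp := @cont2_phase k phi.
have cpf : cont2 (fun x y => cos (phase k phi x y) * f x y) by c2.
rewrite /phase_coef -(rintZ _ _ _ _ _ cpf).
apply: (rint_eq_div pi_lt pi_lt
  (F1 := fun x1 x2 => - (dx1 f x1 x2 * cos (phase k phi x1 x2)) +
                      - (k.1%:~R * (f x1 x2 * sin (phase k phi x1 x2))))
  (G1 := fun x1 x2 => - (dx1 (dx1 f) x1 x2 * cos (phase k phi x1 x2)) +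
                      - (k.1%:~R * (k.1%:~R * (f x1 x2 * cos (phase k phi x1 x2)))))
  (F2 := fun _ _ => 0) (G2 := fun _ _ => 0)); try by c2.
- move=> x y; have p1 := drv_phase1 k phi x y.
  have fx := smooth_drv1 x y sf; have f1x := smooth_drv1 x y sf1.
  apply: (drv_eq (drvD (drvN (drvM f1x (drv_cos p1)))
    (drvN (drvM (drv_cst x k.1%:~R) (drvM fx (drv_sin p1)))))).
  by ring.
- move=> y; have [-> ->] := phase_pi1 k phi y.
  by rewrite (periodic2_pi1 _ sf.1) (periodic2_pi1 _ sf1.1).
- by move=> x y _ _; ring.
Qed.

Lemma phase_coef_L2 f phi k : smooth_torus f ->
  phase_coef (fun x y => f x y - dx2 (dx2 f) x y) phi k = (1 + k.2%:~R ^+ 2) * phase_coef f phi k.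
Proof.
move=> sf; have sf1 := smooth_dx2 sf; have sf11 := smooth_dx2 sf1.
have cf := smooth_cont2 sf; have cf1 := smooth_cont2 sf1; have cf11 := smooth_cont2 sf11.
have cp := @cont2_phase k phi.
have cpf : cont2 (fun x y => cos (phase k phi x y) * f x y) by c2.
rewrite /phase_coef -(rintZ _ _ _ _ _ cpf).
apply: (rint_eq_div pi_lt pi_lt
  (F2 := fun x1 x2 => - (dx2 f x1 x2 * cos (phase k phi x1 x2)) +
                      - (k.2%:~R * (f x1 x2 * sin (phase k phi x1 x2))))
  (G2 := fun x1 x2 => - (dx2 (dx2 f) x1 x2 * cos (phase k phi x1 x2)) +
                      - (k.2%:~R * (k.2%:~R * (f x1 x2 * cos (phase k phi x1 x2)))))
  (F1 := fun _ _ => 0) (G1 := fun _ _ => 0)); try by c2.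
- by move=> x y; exact: drv_cst.
- move=> x y; have p2 := drv_phase2 k phi x y.
  have fx := smooth_drv2 x y sf; have f1x := smooth_drv2 x y sf1.
  apply: (drv_eq (drvD (drvN (drvM f1x (drv_cos p2)))
    (drvN (drvM (drv_cst y k.2%:~R) (drvM fx (drv_sin p2)))))).
  by ring.
- move=> x; have [-> ->] := phase_pi2 k phi x.
  by rewrite (periodic2_pi2 _ sf.1) (periodic2_pi2 _ sf1.1).
- by move=> x y _ _; ring.
Qed.

Lemma decay_phase_coef p f phi : smooth_torus f -> decay p (phase_coef f phi).
Proof.
elim: p f => [|p IH] f sf.
  have cf := smooth_cont2 sf.
  have [M [M0 HM]] := cont2_bounded (- pi) pi (- pi) pi cf.
  exists (M * ((pi - - pi) * (pi - - pi))); split.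
    by rewrite mulr_ge0// mulr_ge0// subr_ge0 ltW// pi_lt.
  move=> k; rewrite expr0 mulr1; apply: norm_rint; [exact: pi_lt|exact: pi_lt| |].
    by have cp := @cont2_phase k phi; c2.
  move=> x y hx hy; rewrite normrM -[leRHS]mul1r.
  by apply: ler_pM => //; [exact: cos_max|exact: HM].
pose f1 := fun x y => f x y - dx1 (dx1 f) x y.
have sf1 : smooth_torus f1 := smoothB sf (smooth_dx1 (smooth_dx1 sf)).
pose f2 := fun x y => f1 x y - dx2 (dx2 f1) x y.
have sf2 : smooth_torus f2 := smoothB sf1 (smooth_dx2 (smooth_dx2 sf1)).
have [D [D0 HD]] := IH _ sf2; exists D; split => // k.
have -> : phase_coef f phi k = wt k * phase_coef f2 phi k.
  rewrite (phase_coef_L2 _ _ sf1) (phase_coef_L1 _ _ sf) /wt /jbracket.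
  have h (n : int) : 1 + n%:~R ^+ 2 != 0 :> R by rewrite gt_eqF// ltr_pwDl// sqr_ge0.
  by field; rewrite !h.
rewrite normrM gtr0_norm ?wt_gt0// exprS mulrCA ler_wpM2l//.
by rewrite ltW// wt_gt0.
Qed.

Lemma Rintegral_torus f : cont2 f ->
  \int[(mu \x mu)%E]_(z in torus (R := R)) f z.1 z.2 = J f.
Proof.
move=> cf; rewrite /torus.
have sub : `[- pi, pi[ `<=` `[- pi, pi : R].
  by move=> x /=; rewrite !in_itv/= => /andP[-> /ltW].
have bndc (g : R -> R) : continuous g ->
    \int[mu]_(x in `[- pi, pi[) g x = \int[mu]_(x in `[- pi, pi]) g x.
  move=> cg; rewrite Rintegral_itv_bndo_bndc//.
  apply: (@integrableS _ _ _ mu `[- pi, pi]) => //.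
  exact: continuous_itv_integrable.
have E := Rintegral_prod21 cf (measurable_itv `[- pi, pi[) (measurable_itv `[- pi, pi[) sub sub.
apply: etrans E _.
apply: etrans _ (bndc _ (@continuous_Rintegral_param R R f (- pi) pi cf)).
by apply: eq_Rintegral => y _; exact: (bndc _ (cont2_x1 cf)).
Qed.

Lemma fourierE f k : cont2 f -> fourier f k =
  (((2 * pi) ^+ 2)^-1 * phase_coef f 0 k +i*
   (- (((2 * pi) ^+ 2)^-1 * phase_coef f (- (pi / 2)) k)))%C.
Proof.
move=> cf; rewrite /fourier /torus_integral.
have c0 := @cont2_phase k 0; have cp := @cont2_phase k (- (pi / 2)).
have -> : phase_coef f 0 k = \int[(mu \x mu)%E]_(z in torus (R := R))
    complex.Re (cexp (- dot k z.1 z.2) * (f z.1 z.2)%:C%C).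
  rewrite /phase_coef -Rintegral_torus; last by c2.
  by apply: eq_Rintegral => z _; rewrite /= mulr0 subr0 cosN /phase addr0.
have -> : phase_coef f (- (pi / 2)) k = - \int[(mu \x mu)%E]_(z in torus (R := R))
    complex.Im (cexp (- dot k z.1 z.2) * (f z.1 z.2)%:C%C).
  have -> : \int[(mu \x mu)%E]_(z in torus (R := R))
      complex.Im (cexp (- dot k z.1 z.2) * (f z.1 z.2)%:C%C) =
      \int[(mu \x mu)%E]_(z in torus (R := R))
       ((-1) * (cos (phase k (- (pi / 2)) z.1 z.2) * f z.1 z.2)).
    apply: eq_Rintegral => z _.
    by rewrite /= mulr0 add0r sinN /phase -[dot _ _ _ + _]/(dot k z.1 z.2 - pi / 2) cosBpihalf; ring.
  rewrite (Rintegral_torus (f := fun x y => (-1) * (cos (phase k (- (pi / 2)) x y) * f x y))); last by c2.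
  by rewrite rintZ; [rewrite mulN1r opprK|c2].
apply/eqP; rewrite eq_complex /= !mul0r !subr0 addr0.
by rewrite mulrN opprK !eqxx.
Qed.

End Fourier.

Section InvLaplacian.
Context {R : realType}.
Implicit Types (f : R -> R -> R) (k : int * int).

Lemma kabs_sqr k : kabs R k ^+ 2 = k.1%:~R ^+ 2 + k.2%:~R ^+ 2.
Proof. by rewrite /kabs sqr_sqrtr// addr_ge0 ?sqr_ge0. Qed.

Lemma int_sqr_ge1 (n : int) : n != 0 -> 1 <= n%:~R ^+ 2 :> R.
Proof.
move=> n0; rewrite -rmorphXn /= -[1]/(1%:~R) ler_int.
by nia.
Qed.

Lemma kabs_sqr_ge1 k : k != (0, 0) -> 1 <= kabs R k ^+ 2.
Proof.
case: k => m n; rewrite kabs_sqr /= => h.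
have [m0|m0] := eqVneq m 0; last first.
  by apply: le_trans (int_sqr_ge1 m0) _; rewrite lerDl sqr_ge0.
have n0 : n != 0 by apply: contra h => /eqP ->; rewrite m0.
by apply: le_trans (int_sqr_ge1 n0) _; rewrite lerDr sqr_ge0.
Qed.

(** As [0^-1 = 0], the multiplier vanishes at [k = 0]. This accounts for the mode left out in
    [inv_laplacian], so the full box sums can be used. *)
Definition lap_inv k : R := (kabs R k ^+ 2)^-1.

Lemma lap_inv_le1 k : 0 <= lap_inv k <= 1.
Proof.
rewrite invr_ge0 sqr_ge0/=; have [->|k0] := eqVneq k (0, 0).
  by rewrite /lap_inv kabs_sqr /= expr0n /= addr0 invr0.
by rewrite invf_le1 ?kabs_sqr_ge1// (lt_le_trans ltr01) ?kabs_sqr_ge1.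
Qed.

Lemma lap_inv0 : lap_inv (0, 0) = 0.
Proof. by rewrite /lap_inv kabs_sqr /= expr0n /= addr0 invr0. Qed.

Definition lap_coef f phi k : R :=
  lap_inv k * (((2 * pi) ^+ 2)^-1 * phase_coef f phi k).

Lemma decay_lap_coef p f phi : smooth_torus f -> decay p (lap_coef f phi).
Proof.
move=> /(decay_phase_coef p phi)[D [D0 HD]].
exists (((2 * pi) ^+ 2)^-1 * D); split => [|k].
  by rewrite mulr_ge0// invr_ge0 sqr_ge0.
rewrite /lap_coef normrM ger0_norm; last by case/andP: (lap_inv_le1 k).
rewrite normrM ger0_norm; last by rewrite invr_ge0 sqr_ge0.
rewrite -mulrA; apply: le_trans (_ : 1 * (((2 * pi) ^+ 2)^-1 * `|phase_coef f phi k|) <= _).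
  rewrite ler_wpM2r//; last by case/andP: (lap_inv_le1 k).
  by rewrite mulr_ge0// invr_ge0 sqr_ge0.
by rewrite mul1r ler_wpM2l// invr_ge0 sqr_ge0.
Qed.

Lemma inv_laplacianE f : cont2 f ->
  inv_laplacian f = trig_series (lap_coef f 0) (lap_coef f (- (pi / 2))).
Proof.
move=> cf; apply/funext => x1; apply/funext => x2.
rewrite /inv_laplacian /trig_series /boxlim; congr (limn _); apply/funext => N.
rewrite raddf_sum; apply: eq_bigr => i _.
rewrite big_mkcond raddf_sum; apply: eq_bigr => j _ /=.
set k := box_index N i j.
have E : complex.Re (inv_laplacian_term f x1 x2 k) =
    trig (lap_coef f 0) (lap_coef f (- (pi / 2))) x1 x2 k.
  rewrite /inv_laplacian_term (fourierE _ cf) /trig /lap_coef /lap_inv /=.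
  move: (_^-1) ((_^+2)^-1) (phase_coef _ _ _) (phase_coef _ _ _) => u v p q.
  by move: (cos _) (sin _) => c s; ring.
case: ifPn => [_|]; first exact: E.
by rewrite negbK => /eqP ->; rewrite /trig /lap_coef lap_inv0 !mul0r addr0.
Qed.

(** With [f = d_1 rho] the first derivatives are, up to sign, the two velocity components, and the
    mixed derivative is [- d_1 u_1]. Incompressibility then supplies [d_2 u_2]. *)
Lemma inv_laplacian_regular f : smooth_torus f ->
  [/\ cont2 (dx1 (inv_laplacian f)), cont2 (dx2 (inv_laplacian f)),
      periodic2 (dx1 (inv_laplacian f)), periodic2 (dx2 (inv_laplacian f)) &
      cont2 (dx1 (dx2 (inv_laplacian f)))].
Proof.
move=> sf; rewrite (inv_laplacianE (smooth_cont2 sf)).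
have da p := decay_lap_coef p 0 sf; have db p := decay_lap_coef p (- (pi / 2)) sf.
move: (lap_coef f 0) da => a da; move: (lap_coef f (- (pi / 2))) db => b db.
have E1 : dx1 (trig_series a b) = trig_series (d1 b) (fun k => - d1 a k).
  apply/funext => x; apply/funext => y; apply: drv_dx1.
  refine (is_derive_trig_series1 _ _ (da 3%N) (db 3%N)).
have E2 : dx2 (trig_series a b) = trig_series (d2 b) (fun k => - d2 a k).
  apply/funext => x; apply/funext => y; apply: drv_dx2.
  refine (is_derive_trig_series2 _ _ (da 3%N) (db 3%N)).
have d2b p : decay p (d2 b) := decay_d2 (db p.+1).
have d2a p : decay p (fun k => - d2 a k) := decayN (decay_d2 (da p.+1)).
have E3 : dx1 (dx2 (trig_series a b)) =
    trig_series (d1 (fun k => - d2 a k)) (fun k => - d1 (d2 b) k).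
  rewrite E2; apply/funext => x; apply/funext => y; apply: drv_dx1.
  refine (is_derive_trig_series1 _ _ (d2b 3%N) (d2a 3%N)).
split; rewrite ?E3 ?E1 ?E2; try exact: trig_series_periodic.
- exact: (trig_series_cont2 (decay_d1 (db 3%N)) (decayN (decay_d1 (da 3%N)))).
- exact: (trig_series_cont2 (d2b 2%N) (d2a 2%N)).
- exact: (trig_series_cont2 (decay_d1 (d2a 3%N)) (decayN (decay_d1 (d2b 3%N)))).
Qed.

End InvLaplacian.

(** * Flows: uniqueness and reflection symmetries *)

Section Periodic.
Context {R : realType}.
Implicit Types f : R -> R -> R.

Lemma periodic2_int f (n m : int) x y : periodic2 f ->
  f (x + n%:~R * (2 * pi)) (y + m%:~R * (2 * pi)) = f x y.
Proof.
move=> pf.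
have per (g : R -> R) : (forall z, g (z + 2 * pi) = g z) ->
    forall (l : int) z, g (z + l%:~R * (2 * pi)) = g z.
  move=> pg; have pn (l : nat) z : g (z + l%:R * (2 * pi)) = g z.
    elim: l z => [|l IH] z; first by rewrite mul0r addr0.
    by rewrite -natr1 mulrDl mul1r addrA pg IH.
  case=> l z; first exact: pn.
  by rewrite -(pn l.+1) -addrA -mulrDl NegzE mulrNz -pmulrn addNr mul0r addr0.
rewrite (per (fun z => f z _)); last by move=> z; have [] := pf z (y + m%:~R * (2 * pi)).
by rewrite (per (f x))// => z; have [] := pf x z.
Qed.

Lemma reduce_2pi (a x : R) : exists n : int, a <= x + n%:~R * (2 * pi) <= a + 2 * pi.
Proof.
have p0 := @pi_gt0 R; exists (- Num.floor ((x - a) / (2 * pi))).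
have /andP[] := floor_itv ((x - a) / (2 * pi)).
have p20 : 0 < 2 * pi :> R by lra.
rewrite ler_pdivlMr// ltr_pdivrMr// intrD mulrNz -[1%:~R]/(1 : R).
by move: (_%:~R) => z h1 h2; apply/andP; split; nra.
Qed.

Lemma periodic2_ind f (P : R -> Prop) : periodic2 f ->
  (forall x y, - pi <= x <= pi -> - pi <= y <= pi -> P (f x y)) ->
  forall x y, P (f x y).
Proof.
move=> pf H x y.
have [n hn] := reduce_2pi (- pi) x; have [m hm] := reduce_2pi (- pi) y.
rewrite -(periodic2_int n m x y pf).
have E : - pi + 2 * pi = pi :> R by ring.
by rewrite E in hn hm; exact: H.
Qed.

End Periodic.

Section Gronwall.
Context {R : realType}.

Lemma gronwall0 (W dW : R -> R) (C T : R) : 0 < T -> continuous W -> W 0 = 0 ->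
  (forall t, 0 <= W t) -> (forall t : R, 0 < t -> is_derive t 1 W (dW t)) ->
  (forall t, 0 < t < T -> dW t <= C * W t) -> W T = 0.
Proof.
move=> T0 cW W00 W0 dWW H.
pose h t := W t * expR (- C * t).
have dE (t : R) : is_derive t 1 (fun t => expR (- C * t)) (- C * expR (- C * t)).
  have dl : is_derive t 1 (fun t => - C * t) (- C).
    by apply: (drv_eq (drvM (drv_cst t (- C)) (drv_id t))); ring.
  by have := is_derive1_comp (is_derive_expR (- C * t)) dl; rewrite mulrC.
have ch : continuous h.
  move=> t; apply: cvgM; first exact: cW.
  exact: (drv_continuous dE).
have [||c] := @MVT R h (fun t => dW t * expR (- C * t) + W t * (- C * expR (- C * t))) _ _ T0.
- by move=> t; rewrite in_itv/= => /andP[t0 _]; exact: drvM (dWW t t0) (dE t).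
- exact: continuous_subspaceT.
rewrite in_itv/= => cT; rewrite {2}/h W00 mul0r subr0 => hT.
have : h T <= 0.
  rewrite hT subr0 -[leRHS](mul0r T); apply: ler_wpM2r; first exact: ltW.
  have Hc : 0 <= C * W c - dW c by rewrite subr_ge0 H.
  by have := mulr_ge0 Hc (ltW (expR_gt0 (- C * c))); lra.
rewrite /h pmulr_lle0 ?expR_gt0// => WT.
by apply/eqP; rewrite eq_le WT W0.
Qed.

End Gronwall.

Section Flow.
Context {R : realType}.
Local Notation I2 c := (rint (- pi) pi c (pi : R)).

(* [dent], [den1], [den2] are the partial derivatives of the density, [dvel] is
   d_1 vel1 = - d_2 vel2, and the velocity is given by Darcy's law only. All
   fields are defined for every real time, but [dent] is the time derivative of
   [den] for t > 0 only. *)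
Record flow := Flow {
  den : R -> R -> R -> R; dent : R -> R -> R -> R;
  den1 : R -> R -> R -> R; den2 : R -> R -> R -> R;
  vel1 : R -> R -> R -> R; vel2 : R -> R -> R -> R;
  dvel : R -> R -> R -> R; pres : R -> R -> R -> R;
  den_cont : cont3 den; dent_cont : cont3 dent;
  den1_cont : cont3 den1; den2_cont : cont3 den2;
  den_dt : forall t x y : R, 0 < t -> is_derive t 1 (fun s => den s x y) (dent t x y);
  den_d1 : forall t x y : R, is_derive x 1 (den t ^~ y) (den1 t x y);
  den_d2 : forall t x y : R, is_derive y 1 (den t x) (den2 t x y);
  den_per : forall t, periodic2 (den t);
  vel1_cont : forall t, cont2 (vel1 t); vel2_cont : forall t, cont2 (vel2 t);
  dvel_cont : forall t, cont2 (dvel t);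
  vel1_d1 : forall t x y : R, is_derive x 1 (vel1 t ^~ y) (dvel t x y);
  vel2_d2 : forall t x y : R, is_derive y 1 (vel2 t x) (- dvel t x y);
  vel1_per : forall t, periodic2 (vel1 t); vel2_per : forall t, periodic2 (vel2 t);
  pres_cont : forall t, cont2 (pres t); pres_per : forall t, periodic2 (pres t);
  pres_d1 : forall t x y : R, is_derive x 1 (pres t ^~ y) (- vel1 t x y);
  pres_d2 : forall t x y : R, is_derive y 1 (pres t x) (- den t x y - vel2 t x y);
  transport : forall t x y, dent t x y = - (vel1 t x y * den1 t x y + vel2 t x y * den2 t x y)
}.

Lemma cont3B (f g : R -> R -> R -> R) : cont3 f -> cont3 g ->
  cont3 (fun t x y => f t x y - g t x y).
Proof. by move=> cf cg z; apply: cvgB; [exact: cf|exact: cg]. Qed.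

Lemma cont3M (f g : R -> R -> R -> R) : cont3 f -> cont3 g ->
  cont3 (fun t x y => f t x y * g t x y).
Proof. by move=> cf cg z; apply: cvgM; [exact: cf|exact: cg]. Qed.

Lemma cont3_cst (c : R) : cont3 (fun _ _ _ => c).
Proof. by move=> z; exact: cvg_cst. Qed.

Lemma cont3_bounded (f : R -> R -> R -> R) a b : cont3 f ->
  exists M, 0 <= M /\ forall t x y, 0 <= t <= b -> - a <= x <= a -> - a <= y <= a ->
    `|f t x y| <= M.
Proof.
move=> cf.
have [ab|] := pselect (0 <= a /\ 0 <= b); last first.
  by move=> nab; exists 0; split => // t x y /andP[? ?] /andP[? ?]; case: nab; split; lra.
pose K : set (R * R * R) := (`[0, b]%classic `*` `[- a, a]%classic `*` `[- a, a]%classic).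
have cK : compact K by apply: compact_setX; [apply: compact_setX|]; exact: segment_compact.
have [||z _ Hz] := compact_EVT_max (f := fun z : R * R * R => `|f z.1.1 z.1.2 z.2|) _ cK.
  by exists (0, 0, 0); split; [split|]; rewrite /= in_itv/=; apply/andP; split; lra.
- by apply: continuous_subspaceT => z; apply: cvg_norm; exact: cf.
exists `|f z.1.1 z.1.2 z.2|; split => // t x y ht hx hy; apply: (Hz (t, x, y)).
by rewrite inE; split; [split|]; rewrite /= in_itv.
Qed.

Section Unique.
Variables F G : flow.
Let w t x y := den F t x y - den G t x y.
Let v1 t x y := vel1 F t x y - vel1 G t x y.
Let v2 t x y := vel2 F t x y - vel2 G t x y.
Let dv t x y := dvel F t x y - dvel G t x y.
Let q t x y := pres F t x y - pres G t x y.

Let cw t : cont2 (w t).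
Proof. exact: (cont2D (cont3_at (t := t) (@den_cont F)) (cont2N (cont3_at (t := t) (@den_cont G)))). Qed.
Let cv1 t : cont2 (v1 t).
Proof. exact: (cont2D (@vel1_cont F t) (cont2N (@vel1_cont G t))). Qed.
Let cv2 t : cont2 (v2 t).
Proof. exact: (cont2D (@vel2_cont F t) (cont2N (@vel2_cont G t))). Qed.
Let cdv t : cont2 (dv t).
Proof. exact: (cont2D (@dvel_cont F t) (cont2N (@dvel_cont G t))). Qed.
Let cq t : cont2 (q t).
Proof. exact: (cont2D (@pres_cont F t) (cont2N (@pres_cont G t))). Qed.

Let v1_d1 (t x y : R) : is_derive x 1 (v1 t ^~ y) (dv t x y).
Proof. by apply: drvB; exact: vel1_d1. Qed.
Let v2_d2 (t x y : R) : is_derive y 1 (v2 t x) (- dv t x y).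
Proof. by apply: (drv_eq (drvB (vel2_d2 F t x y) (vel2_d2 G t x y))); rewrite /dv; ring. Qed.
Let q_d1 (t x y : R) : is_derive x 1 (q t ^~ y) (- v1 t x y).
Proof. by apply: (drv_eq (drvB (pres_d1 F t x y) (pres_d1 G t x y))); rewrite /v1; ring. Qed.
Let q_d2 (t x y : R) : is_derive y 1 (q t x) (- w t x y - v2 t x y).
Proof. by apply: (drv_eq (drvB (pres_d2 F t x y) (pres_d2 G t x y))); rewrite /v2 /w; ring. Qed.
Let perB (f g : R -> R -> R) : periodic2 f -> periodic2 g -> periodic2 (fun x y => f x y - g x y).
Proof. by move=> pf pg x y; have [[-> ->] [-> ->]] := (pf x y, pg x y). Qed.
Let v1_per t : periodic2 (v1 t). Proof. by apply: perB; exact: vel1_per. Qed.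
Let v2_per t : periodic2 (v2 t). Proof. by apply: perB; exact: vel2_per. Qed.
Let q_per t : periodic2 (q t). Proof. by apply: perB; exact: pres_per. Qed.
Let w_per t : periodic2 (w t). Proof. by apply: perB; exact: den_per. Qed.

(* For the difference (v, q) of two velocities and pressures with the same
   density, |v|^2 = - div(q v). *)
Lemma velocity_unique t : den F t = den G t ->
  vel1 F t = vel1 G t /\ vel2 F t = vel2 G t.
Proof.
move=> FG; have w0 x y : w t x y = 0 by rewrite /w FG subrr.
have c1 := @cw t; have cb := @cv1 t; have c3 := @cv2 t; have c4 := @cdv t; have c5 := @cq t.
have I0 : I2 (- pi) (fun x y => v1 t x y * v1 t x y + v2 t x y * v2 t x y) =
    I2 (- pi) (fun _ _ => 0).
  apply: (rint_eq_div pi_lt pi_lt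
    (F1 := fun x y => - (v1 t x y * q t x y))
    (G1 := fun x y => - (dv t x y * q t x y + v1 t x y * - v1 t x y))
    (F2 := fun x y => - (v2 t x y * q t x y))
    (G2 := fun x y => - (- dv t x y * q t x y + v2 t x y * (- w t x y + - v2 t x y)))); try by c2.
  - by move=> x y; exact: drvN (drvM (v1_d1 t x y) (q_d1 t x y)).
  - by move=> x y; exact: drvN (drvM (v2_d2 t x y) (q_d2 t x y)).
  - by move=> y; rewrite (periodic2_pi1 _ (@v1_per t)) (periodic2_pi1 _ (@q_per t)).
  - by move=> x; rewrite (periodic2_pi2 _ (@v2_per t)) (periodic2_pi2 _ (@q_per t)).
  - by move=> x y _ _; rewrite w0; ring.
rewrite (rint_cst pi_lt pi_lt) mul0r in I0.
have Z x y : - pi <= x <= pi -> - pi <= y <= pi ->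
    v1 t x y * v1 t x y + v2 t x y * v2 t x y = 0.
  move=> hx hy.
  apply: (rint_eq0 pi_lt pi_lt (f := fun x y => v1 t x y * v1 t x y + v2 t x y * v2 t x y)) => //.
    by c2.
  by move=> x' y' _ _; rewrite addr_ge0// -expr2 sqr_ge0.
have Z1 x y : v1 t x y = 0.
  apply: (periodic2_ind (P := fun z => z = 0) (@v1_per t)) => {}x {}y hx hy.
  by have := Z x y hx hy; nra.
have Z2 x y : v2 t x y = 0.
  apply: (periodic2_ind (P := fun z => z = 0) (@v2_per t)) => {}x {}y hx hy.
  by have := Z x y hx hy; nra.
by split; apply/funext => x; apply/funext => y; apply/eqP; rewrite -subr_eq0; apply/eqP;
  [exact: Z1|exact: Z2].
Qed.

(* Gronwall for the integral of w^2, w being the difference of the densities;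
   Darcy's law tested with v bounds the integral of |v|^2 by that of w^2. *)
Lemma flow_unique : den F 0 = den G 0 -> forall t, 0 <= t -> den F t = den G t.
Proof.
move=> FG0 T; rewrite le_eqVlt => /predU1P[<-//|T0].
have [K1 [K10 HK1]] := cont3_bounded pi T (@den1_cont G).
have [K2 [K20 HK2]] := cont3_bounded pi T (@den2_cont G).
pose K := K1 + K2.
pose wt' t x y := dent F t x y - dent G t x y.
have cwt t : cont2 (wt' t) := cont2D (cont3_at (t := t) (@dent_cont F)) (cont2N (cont3_at (t := t) (@dent_cont G))).
have c3w : cont3 w := cont3B (@den_cont F) (@den_cont G).
have c3wt : cont3 wt' := cont3B (@dent_cont F) (@dent_cont G).
pose W t := I2 (- pi) (fun x y => w t x y * w t x y).
pose dW t := I2 (- pi) (fun x y => 2 * (w t x y * wt' t x y)).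
have WT : W T = 0.
  apply: (gronwall0 (dW := dW) (C := 3 * K) T0).
  - by apply: (cont_rint_param (g := fun t x y => w t x y * w t x y)); exact: (cont3M c3w c3w).
  - transitivity (I2 (- pi) (fun _ _ => 0)); last by rewrite (rint_cst pi_lt pi_lt) mul0r.
    by apply: rint_eq => x y _ _; rewrite /w FG0 subrr mulr0.
  - move=> t; apply: rint_ge0 => [|x y _ _]; last by rewrite -expr2 sqr_ge0.
    by have c1 := @cw t; c2.
  - move=> t t0; apply: (is_derive_rint_param _ _ _ _
      (g := fun t x y => w t x y * w t x y) (gt := fun t x y => 2 * (w t x y * wt' t x y))) => //.
    + exact: (cont3M c3w c3w).
    + exact: (cont3M (cont3_cst (c := 2)) (cont3M c3w c3wt)).
    + move=> s x y s0; have dw := drvB (den_dt F x y s0) (den_dt G x y s0).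
      by apply: (drv_eq (drvM dw dw)); rewrite /w /wt'; ring.
  - move=> t /andP[t0 tT].
    have c1 := @cw t; have cb := @cv1 t; have c3 := @cv2 t; have c4 := @cdv t.
    have c5 := @cq t; have c6 := @cwt t.
    have c7 := @vel1_cont F t; have c8 := @vel2_cont F t; have c9 := @dvel_cont F t.
    have ca := cont3_at (t := t) (@den1_cont F); have cc := cont3_at (t := t) (@den2_cont F).
    have cd := cont3_at (t := t) (@den1_cont G); have ce := cont3_at (t := t) (@den2_cont G).
    have cww : cont2 (fun x y => w t x y * w t x y) by c2.
    rewrite /dW /W -(rintZ _ _ _ _ _ cww).
    (* The flux has two parts: [w^2] carried by the velocity of [F], and [2 K q v], both with a
       minus sign. By Darcy's law the second one contributes [2 K (|v|^2 + v2 w) = K |v|^2 + K (v1^2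
       + (v2 + w)^2) - K w^2]. Its [K |v|^2] absorbs the [|v|^2] that Young's inequality produces
       from the term [- 2 w v . grad (den G)], and the constant [3 K] covers all multiples of
       [w^2]. *)
    apply: (le_rint_div pi_lt pi_lt
      (F1 := fun x y => - (vel1 F t x y * (w t x y * w t x y)) + - (2 * K * (v1 t x y * q t x y)))
      (G1 := fun x y => - (dvel F t x y * (w t x y * w t x y) + vel1 F t x y *
              (2 * (w t x y * (den1 F t x y + - den1 G t x y)))) +
            - (2 * K * (dv t x y * q t x y + v1 t x y * - v1 t x y)))
      (F2 := fun x y => - (vel2 F t x y * (w t x y * w t x y)) + - (2 * K * (v2 t x y * q t x y)))
      (G2 := fun x y => - (- dvel F t x y * (w t x y * w t x y) + vel2 F t x y *
              (2 * (w t x y * (den2 F t x y + - den2 G t x y)))) +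
            - (2 * K * (- dv t x y * q t x y + v2 t x y * (- w t x y + - v2 t x y))))); try by c2.
    + move=> x y; have dw := drvB (den_d1 F t x y) (den_d1 G t x y).
      apply: (drv_eq (drvD (drvN (drvM (vel1_d1 F t x y) (drvM dw dw)))
        (drvN (drvM (drv_cst x (2 * K)) (drvM (v1_d1 t x y) (q_d1 t x y)))))).
      by rewrite /w; ring.
    + move=> x y; have dw := drvB (den_d2 F t x y) (den_d2 G t x y).
      apply: (drv_eq (drvD (drvN (drvM (vel2_d2 F t x y) (drvM dw dw)))
        (drvN (drvM (drv_cst y (2 * K)) (drvM (v2_d2 t x y) (q_d2 t x y)))))).
      by rewrite /w; ring.
    + move=> y; rewrite (periodic2_pi1 _ (@v1_per t)) (periodic2_pi1 _ (@q_per t)).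
      by rewrite (periodic2_pi1 _ (@w_per t)) (periodic2_pi1 _ (@vel1_per F t)).
    + move=> x; rewrite (periodic2_pi2 _ (@v2_per t)) (periodic2_pi2 _ (@q_per t)).
      by rewrite (periodic2_pi2 _ (@w_per t)) (periodic2_pi2 _ (@vel2_per F t)).
    + move=> x y hx hy.
      have h0T : 0 <= t <= T by rewrite !ltW.
      have := HK1 t x y h0T hx hy; have := HK2 t x y h0T hx hy.
      rewrite !ler_norml => /andP[k1 k2] /andP[k3 k4].
      have -> : wt' t x y = - (vel1 F t x y * (den1 F t x y + - den1 G t x y)) -
           vel2 F t x y * (den2 F t x y + - den2 G t x y)
           - v1 t x y * den1 G t x y - v2 t x y * den2 G t x y.
        by rewrite /wt' (transport F) (transport G) /v1 /v2; ring.
      move: (w t x y) (v1 t x y) (v2 t x y) (q t x y) (dv t x y) (den1 G t x y) (den2 G t x y) k1 k2 k3 k4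
        => W0 V1 V2 Q DV D1 D2 k1 k2 k3 k4.
      have h1 : - (2 * (W0 * V1 * D1)) <= K1 * (W0 ^+ 2 + V1 ^+ 2).
        have := sqr_ge0 (W0 + V1); have := sqr_ge0 (W0 - V1); nra.
      have h2 : - (2 * (W0 * V2 * D2)) <= K2 * (W0 ^+ 2 + V2 ^+ 2).
        have := sqr_ge0 (W0 + V2); have := sqr_ge0 (W0 - V2); nra.
      have h3 : 0 <= K * (V1 ^+ 2 + (V2 + W0) ^+ 2).
        by rewrite mulr_ge0 ?addr_ge0 ?sqr_ge0.
      have h4 : 0 <= K1 * V2 ^+ 2 by rewrite mulr_ge0 ?sqr_ge0.
      have h5 : 0 <= K2 * V1 ^+ 2 by rewrite mulr_ge0 ?sqr_ge0.
      have h6 : 0 <= K1 * W0 ^+ 2 by rewrite mulr_ge0 ?sqr_ge0.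
      have h7 : 0 <= K2 * W0 ^+ 2 by rewrite mulr_ge0 ?sqr_ge0.
      rewrite /K in h3 *; lra.
have Z x y : - pi <= x <= pi -> - pi <= y <= pi -> w T x y * w T x y = 0.
  move=> hx hy; have c1 := @cw T.
  apply: (rint_eq0 pi_lt pi_lt (f := fun x y => w T x y * w T x y)) => //.
    by c2.
  by move=> x' y' _ _; rewrite -expr2 sqr_ge0.
apply/funext => x; apply/funext => y; apply/eqP; rewrite -subr_eq0; apply/eqP.
apply: (periodic2_ind (P := fun z => z = 0) (@w_per T)) => {}x {}y hx hy.
by have /eqP := Z x y hx hy; rewrite mulf_eq0 orbb => /eqP.
Qed.

End Unique.

End Flow.

Section FlowOfSolution.
Context {R : realType}.
Implicit Types rho : R -> R -> R -> R.

(** Needed for the pressure, of which only the partial derivatives are known to be continuous: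
    locally bounded partial derivatives make it locally Lipschitz. *)
Lemma cont2_of_partials (f f1 f2 : R -> R -> R) : cont2 f1 -> cont2 f2 ->
  (forall x y : R, is_derive x 1 (f ^~ y) (f1 x y)) ->
  (forall x y : R, is_derive y 1 (f x) (f2 x y)) -> cont2 f.
Proof.
move=> cf1 cf2 d1f d2f z0; case: z0 => x0 y0.
have [M1 [M10 HM1]] := cont2_bounded (x0 - 1) (x0 + 1) (y0 - 1) (y0 + 1) cf1.
have [M2 [M20 HM2]] := cont2_bounded (x0 - 1) (x0 + 1) (y0 - 1) (y0 + 1) cf2.
apply/cvgrPdist_le => /= e e0; pose d := Num.min 1 (e / (M1 + M2 + 1)).
have d0 : 0 < d by rewrite lt_min ltr01 divr_gt0//; lra.
exists (ball x0 d, ball y0 d) => /=; first by split; exact: nbhsx_ballx.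
move=> [x y] [/= hx hy]; rewrite /ball/= !lt_min in hx hy.
move: hx hy => /andP[hx1 hx2] /andP[hy1 hy2].
have -> : f x0 y0 - f x y = (f x0 y0 - f x y0) + (f x y0 - f x y) by ring.
apply: le_trans (ler_normD _ _) _.
have b0 (a b z : R) : `|a - b| < 1 -> Num.min a b <= z <= Num.max a b -> a - 1 <= z <= a + 1.
  rewrite ltr_norml ge_min le_max => /andP[h1 h2] /andP[/orP h3 /orP h4].
  by apply/andP; split; [case: h3|case: h4]; lra.
have h1 : `|f x0 y0 - f x y0| <= M1 * `|x0 - x|.
  apply: (lipschitz_MVT (F := f ^~ y0) (dF := f1 ^~ y0)) => z.
  by move=> /(b0 _ _ _ hx1) hz; apply: HM1 => //; apply/andP; split; lra.
have h2 : `|f x y0 - f x y| <= M2 * `|y0 - y|.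
  apply: (lipschitz_MVT (F := f x) (dF := f2 x)) => z.
  move=> /(b0 _ _ _ hy1) hz; apply: HM2 => //.
  by move: hx1; rewrite ltr_norml => /andP[h3 h4]; apply/andP; split; lra.
apply: le_trans (lerD h1 h2) _.
apply: (@le_trans _ _ ((M1 + M2) * (e / (M1 + M2 + 1)))).
  by rewrite mulrDl; apply: lerD; apply: ler_wpM2l => //; exact: ltW.
by rewrite mulrA ler_pdivrMr; nra.
Qed.

Lemma within_continuous_comp (S T U : topologicalType) (A : set T) (f : T -> U) (g : S -> T) :
  {within A, continuous f} -> continuous g -> (forall z, A (g z)) ->
  continuous (fun z => f (g z)).
Proof.
move=> /subspace_continuousP cf cg Ag z.
apply: (@cvg_comp _ _ _ g f (nbhs z) (within A (nbhs (g z)))); last exact: cf.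
move=> P /= wP.
have H : nbhs z [set y | A (g y) -> P (g y)] := cg z _ wP.
have : nbhs z [set y | P (g y)] by apply: filterS H => y /(_ (Ag y)).
by [].
Qed.

Lemma max_continuous : continuous (fun t : R => Num.max t 0).
Proof.
have -> : (fun t : R => Num.max t 0) = (fun t => (t + `|t|) / 2).
  apply/funext => t; case: (lerP 0 t) => t0.
    by rewrite ger0_norm//; lra.
  by rewrite ltr0_norm//; lra.
move=> t; apply: cvgMl; apply: cvgD; first exact: cvg_id.
exact: cvg_norm.
Qed.

Lemma maxr0 (s : R) : 0 <= s -> Num.max s 0 = s.
Proof. by case: (lerP 0 s). Qed.

Lemma cont3_extend (g : R -> R -> R -> R) :
  {within [set z : R * R * R | 0 <= z.1.1], continuous (fun z => g z.1.1 z.1.2 z.2)} ->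
  cont3 (fun t => g (Num.max t 0)).
Proof.
move=> cg.
apply: (within_continuous_comp (g := fun z : R * R * R => (Num.max z.1.1 0, z.1.2, z.2)) cg).
  apply: cont_pair; [apply: cont_pair|].
  - apply: (cont_comp (f := fun z : R * R * R => z.1.1) _ max_continuous).
    by apply: cont_fst => z; exact: cvg_fst.
  - by apply: cont_snd => z; exact: cvg_fst.
  - by move=> z; exact: cvg_snd.
by move=> z /=; rewrite le_max lexx orbT.
Qed.

Lemma Ck_evol_Ck2 n rho t : 0 <= t -> Ck_evol n rho -> Ck2 n (rho t).
Proof.
move=> t0; have C0 (g : R -> R -> R -> R) : {within [set z : R * R * R | 0 <= z.1.1], continuous (fun z => g z.1.1 z.1.2 z.2)} ->
    continuous (fun z : R * R => g t z.1 z.2).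
  move=> cg; apply: (within_continuous_comp (g := fun z : R * R => (t, z.1, z.2)) cg) => //.
  apply: cont_pair; [apply: cont_pair|].
  - by move=> z; exact: cvg_cst.
  - by move=> z; exact: cvg_fst.
  - by move=> z; exact: cvg_snd.
elim: n rho => [|n IH] rho [cr]; first by split => //; exact: C0.
move=> [_ hd _ h1 h2]; have [e1 e2] := hd t t0.
split; first exact: C0.
by split => //; [exact: (IH _ h1)|exact: (IH _ h2)].
Qed.

Lemma smooth_evol_torus rho t : smooth_evol rho -> 0 <= t -> smooth_torus (rho t).
Proof. by move=> [pr cr] t0; split; [exact: pr|move=> n; exact: Ck_evol_Ck2]. Qed.

(** For [t > 0] the constraint [0 <= t + h] holds for all small [h], so the restricted limit is the
    two-sided one, and [Num.max s 0] equals [s] near [t]. *)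
Lemma derivable_t_drv (g : R -> R -> R -> R) (t x y : R) : derivable_t g -> 0 < t ->
  is_derive t 1 (fun s => g (Num.max s 0) x y) (dt g t x y).
Proof.
move=> dg t0; have dq : dt_quot g t x y @ dt_filter t --> dt g t x y by exact: dg (ltW t0).
have pos : \forall h \near 0^', 0 <= t + h.
  near=> h; have : `|h| <= t by near: h; exact: dnbhs0_le.
  by rewrite ler_norml => /andP[]; lra.
have dq0 : dt_quot g t x y @ 0^' --> dt g t x y.
  move=> P nP; have /= H : (0^' : set_system R) [set h | 0 <= t + h -> P (dt_quot g t x y h)] := dq P nP.
  have : (0^' : set_system R) [set h | P (dt_quot g t x y h)].
    by apply: filterS2 pos H => h h0 /(_ h0).
  by [].
have L : h^-1 *: (g (Num.max (h *: (1 : R) + t) 0) x y - g (Num.max t 0) x y) @[h --> 0^'] --> dt g t x y.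
  apply: cvg_trans dq0; apply: near_eq_cvg; near=> h.
  have h0 : 0 <= t + h by near: h; exact: pos.
  have -> : h *: (1 : R) = h by rewrite /GRing.scale/= mulr1.
  have -> : h + t = t + h by rewrite addrC.
  by rewrite /dt_quot /GRing.scale/= (maxr0 (ltW t0)) (maxr0 h0).
apply: DeriveDef; first by apply/cvg_ex; exists (dt g t x y).
exact/cvg_lim.
Unshelve. all: by end_near. Qed.

(* The flow is t |-> rho (max t 0), so that continuity in t holds on all of R;
   the regularity of the velocity comes from [inv_laplacian_regular]. *)
Lemma flow_of_solution rho : smooth_evol rho -> ipm_solution rho ->
  exists F : flow, forall t, 0 <= t -> den F t = rho t.
Proof.
move=> se [u1 [u2 [p [hd heq]]]].
have st t := smooth_evol_torus (t := t) se.
pose m (t : R) := Num.max t 0.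
have m0 t : 0 <= m t by rewrite /m le_max lexx orbT.
have [per] := se => /(_ 1%N) [cr [dr _ [cdt _] [cd1 _] [cd2 _]]].
have reg t := inv_laplacian_regular (smooth_dx1 (st _ (m0 t))).
have E1 t : u1 (m t) = fun x y => - dx2 (inv_laplacian (dx1 (rho (m t)))) x y.
  by apply/funext => x; apply/funext => y; case: (heq _ x y (m0 t)) => _ _ _ _ [].
have E2 t : u2 (m t) = dx1 (inv_laplacian (dx1 (rho (m t)))).
  by apply/funext => x; apply/funext => y; case: (heq _ x y (m0 t)) => _ _ _ _ [].
have u1d t (x y : R) : is_derive x 1 (u1 (m t) ^~ y) (dx1 (u1 (m t)) x y).
  by rewrite /dx1 derive1E; apply/derivableP; case: (hd _ (m0 t)).
have u2d t (x y : R) : is_derive y 1 (u2 (m t) x) (- dx1 (u1 (m t)) x y).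
  have -> : - dx1 (u1 (m t)) x y = dx2 (u2 (m t)) x y.
    by case: (heq _ x y (m0 t)) => _ h _ _ _; apply/eqP; rewrite eqr_oppLR -addr_eq0; apply/eqP.
  by rewrite /dx2 derive1E; apply/derivableP; case: (hd _ (m0 t)).
have pd1 t (x y : R) : is_derive x 1 (p (m t) ^~ y) (- u1 (m t) x y).
  have -> : - u1 (m t) x y = dx1 (p (m t)) x y.
    by case: (heq _ x y (m0 t)) => _ _ h _ _; move: h; lra.
  by rewrite /dx1 derive1E; apply/derivableP; case: (hd _ (m0 t)).
have pd2 t (x y : R) : is_derive y 1 (p (m t) x) (- rho (m t) x y - u2 (m t) x y).
  have -> : - rho (m t) x y - u2 (m t) x y = dx2 (p (m t)) x y.
    by case: (heq _ x y (m0 t)) => _ _ _ h _; move: h; lra.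
  by rewrite /dx2 derive1E; apply/derivableP; case: (hd _ (m0 t)).
have cu1 t : cont2 (u1 (m t)) by rewrite E1; case: (reg t) => _ h _ _ _; exact: (cont2N h).
have cu2 t : cont2 (u2 (m t)) by rewrite E2; case: (reg t).
have cdu t : cont2 (dx1 (u1 (m t))).
  have -> : dx1 (u1 (m t)) = fun x y => - dx1 (dx2 (inv_laplacian (dx1 (rho (m t))))) x y.
    apply/funext => x; apply/funext => y.
    have := drvN (u1d t x y); rewrite E1.
    under eq_fun do rewrite opprK.
    by move=> /drv_dx1 ->; rewrite opprK.
  by case: (reg t) => _ _ _ _ h; exact: (cont2N h).
have pu1 t : periodic2 (u1 (m t)).
  by rewrite E1; case: (reg t) => _ _ _ h _ x y; have [-> ->] := h x y.
have pu2 t : periodic2 (u2 (m t)) by rewrite E2; case: (reg t).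
have cr0 t : cont2 (rho (m t)) by exact: smooth_cont2 (st _ (m0 t)).
have cp t : cont2 (p (m t)).
  exact: (cont2_of_partials (cont2N (@cu1 t)) (cont2D (cont2N (@cr0 t)) (cont2N (@cu2 t))) (pd1 t) (pd2 t)).
have pp t : periodic2 (p (m t)) by case: (hd _ (m0 t)).
have rd1 t (x y : R) := smooth_drv1 x y (st _ (m0 t)).
have rd2 t (x y : R) := smooth_drv2 x y (st _ (m0 t)).
have rper t : periodic2 (rho (m t)) by exact: per.
have rdt (t x y : R) : 0 < t -> is_derive t 1 (fun s => rho (m s) x y) (dt rho (m t) x y).
  by move=> t0; rewrite {2}/m (maxr0 (ltW t0)); exact: derivable_t_drv.
have tr t x y : dt rho (m t) x y =
    - (u1 (m t) x y * dx1 (rho (m t)) x y + u2 (m t) x y * dx2 (rho (m t)) x y).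
  by case: (heq _ x y (m0 t)) => h _ _ _ _; move: h; lra.
have k0 : cont3 (fun t => rho (m t)) by exact: cont3_extend cr.
have k1 : cont3 (fun t => dt rho (m t)) by exact: (cont3_extend (g := dt rho)).
have k2 : cont3 (fun t => dx1 (rho (m t))) by exact: (cont3_extend (g := fun t => dx1 (rho t))).
have k3 : cont3 (fun t => dx2 (rho (m t))) by exact: (cont3_extend (g := fun t => dx2 (rho t))).
exists (Flow (den := fun t => rho (m t)) k0 k1 k2 k3 rdt rd1 rd2 rper cu1 cu2 cdu u1d u2d pu1 pu2 cp pp pd1 pd2 tr).
by move=> t t0 /=; rewrite /m maxr0.
Qed.

End FlowOfSolution.

Section Reflection.
Context {R : realType}.
Implicit Types F : @flow R.

Lemma drv_opp (f : R -> R) (y l : R) : is_derive (- y) 1 f l ->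
  is_derive y 1 (fun z => f (- z)) (- l).
Proof.
move=> hf; have hN : is_derive y 1 (fun z : R => - z) (- 1) := drvN (drv_id y).
by have := is_derive1_comp (g := fun z : R => - z) hf hN; rewrite mulrN1.
Qed.

Lemma cont_oppR (S : topologicalType) (f : S -> R) : continuous f -> continuous (fun z => - f z).
Proof. by move=> cf z; apply: cvgN; exact: cf. Qed.

Lemma cont2_opp2 (f : R -> R -> R) : cont2 f -> cont2 (fun x y => f x (- y)).
Proof.
move=> cf; apply: (cont2_comp (h := fun z : R * R => z.1) (k := fun z : R * R => - z.2) cf).
  by move=> z; exact: cvg_fst.
by apply: cont_oppR => z; exact: cvg_snd.
Qed.

Lemma cont2_opp1 (f : R -> R -> R) : cont2 f -> cont2 (fun x y => f (- x) y).
Proof.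
move=> cf; apply: (cont2_comp (h := fun z : R * R => - z.1) (k := fun z : R * R => z.2) cf).
  by apply: cont_oppR => z; exact: cvg_fst.
by move=> z; exact: cvg_snd.
Qed.

Lemma cont3_opp2 (g : R -> R -> R -> R) : cont3 g -> cont3 (fun t x y => g t x (- y)).
Proof.
move=> cg; apply: (cont3_comp (h := fun z : R * R * R => z.1.1) (k := fun z : R * R * R => z.1.2)
  (l := fun z : R * R * R => - z.2) cg).
- by apply: cont_fst => z; exact: cvg_fst.
- by apply: cont_snd => z; exact: cvg_fst.
- by apply: cont_oppR => z; exact: cvg_snd.
Qed.

Lemma cont3_opp1 (g : R -> R -> R -> R) : cont3 g -> cont3 (fun t x y => g t (- x) y).
Proof.
move=> cg; apply: (cont3_comp (h := fun z : R * R * R => z.1.1) (k := fun z : R * R * R => - z.1.2)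
  (l := fun z : R * R * R => z.2) cg).
- by apply: cont_fst => z; exact: cvg_fst.
- by apply: cont_oppR; apply: cont_snd => z; exact: cvg_fst.
- by move=> z; exact: cvg_snd.
Qed.

Lemma cont3N (g : R -> R -> R -> R) : cont3 g -> cont3 (fun t x y => - g t x y).
Proof. by move=> cg; exact: (cont_oppR cg). Qed.

Lemma periodic2_opp2 (f : R -> R -> R) : periodic2 f -> periodic2 (fun x y => f x (- y)).
Proof.
move=> pf x y; split; first by have [-> _] := pf x (- y).
by have [_ <-] := pf x (- (y + 2 * pi)); congr f; ring.
Qed.

Lemma periodic2_opp1 (f : R -> R -> R) : periodic2 f -> periodic2 (fun x y => f (- x) y).
Proof.
move=> pf x y; split; last by have [_ ->] := pf (- x) y.
by have [<- _] := pf (- (x + 2 * pi)) y; congr f; ring.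
Qed.

Lemma periodic2N (f : R -> R -> R) : periodic2 f -> periodic2 (fun x y => - f x y).
Proof. by move=> pf x y; have [-> ->] := pf x y. Qed.

(** The sign of the density changes together with that of [y]. The vertical component of Darcy's law
    changes sign as a whole, so the pressure is reflected without a sign, and an odd density yields
    a fixed point of this symmetry. *)
Lemma flow_opp2 F : exists G : @flow R,
  [/\ forall t x y, den G t x y = - den F t x (- y),
      forall t x y, vel1 G t x y = vel1 F t x (- y) &
      forall t x y, vel2 G t x y = - vel2 F t x (- y)].
Proof.
unshelve eexists (@Flow R (fun t x y => - den F t x (- y)) (fun t x y => - dent F t x (- y))
  (fun t x y => - den1 F t x (- y)) (fun t x y => den2 F t x (- y))
  (fun t x y => vel1 F t x (- y)) (fun t x y => - vel2 F t x (- y))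
  (fun t x y => dvel F t x (- y)) (fun t x y => pres F t x (- y))
  (cont3N (cont3_opp2 (@den_cont _ F))) (cont3N (cont3_opp2 (@dent_cont _ F)))
  (cont3N (cont3_opp2 (@den1_cont _ F))) (cont3_opp2 (@den2_cont _ F)) _ _ _
  (fun t => periodic2N (periodic2_opp2 (@den_per _ F t)))
  (fun t => cont2_opp2 (@vel1_cont _ F t)) (fun t => cont2N (cont2_opp2 (@vel2_cont _ F t)))
  (fun t => cont2_opp2 (@dvel_cont _ F t)) _ _
  (fun t => periodic2_opp2 (@vel1_per _ F t)) (fun t => periodic2N (periodic2_opp2 (@vel2_per _ F t)))
  (fun t => cont2_opp2 (@pres_cont _ F t)) (fun t => periodic2_opp2 (@pres_per _ F t)) _ _ _).
- by move=> t x y t0; exact: drvN (den_dt F x (- y) t0).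
- by move=> t x y; exact: drvN (den_d1 F t x (- y)).
- by move=> t x y; apply: (drv_eq (drvN (drv_opp (den_d2 F t x (- y))))); rewrite opprK.
- by move=> t x y; exact: vel1_d1.
- by move=> t x y; apply: (drv_eq (drvN (drv_opp (vel2_d2 F t x (- y))))); rewrite opprK.
- by move=> t x y; exact: pres_d1.
- by move=> t x y; apply: (drv_eq (drv_opp (pres_d2 F t x (- y)))); ring.
- by move=> t x y /=; rewrite (transport F); ring.
- by split.
Qed.

Lemma flow_opp1 F : exists G : @flow R,
  [/\ forall t x y, den G t x y = den F t (- x) y,
      forall t x y, vel1 G t x y = - vel1 F t (- x) y &
      forall t x y, vel2 G t x y = vel2 F t (- x) y].
Proof.
unshelve eexists (@Flow R (fun t x y => den F t (- x) y) (fun t x y => dent F t (- x) y)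
  (fun t x y => - den1 F t (- x) y) (fun t x y => den2 F t (- x) y)
  (fun t x y => - vel1 F t (- x) y) (fun t x y => vel2 F t (- x) y)
  (fun t x y => dvel F t (- x) y) (fun t x y => pres F t (- x) y)
  (cont3_opp1 (@den_cont _ F)) (cont3_opp1 (@dent_cont _ F))
  (cont3N (cont3_opp1 (@den1_cont _ F))) (cont3_opp1 (@den2_cont _ F)) _ _ _
  (fun t => periodic2_opp1 (@den_per _ F t))
  (fun t => cont2N (cont2_opp1 (@vel1_cont _ F t))) (fun t => cont2_opp1 (@vel2_cont _ F t))
  (fun t => cont2_opp1 (@dvel_cont _ F t)) _ _
  (fun t => periodic2N (periodic2_opp1 (@vel1_per _ F t))) (fun t => periodic2_opp1 (@vel2_per _ F t))
  (fun t => cont2_opp1 (@pres_cont _ F t)) (fun t => periodic2_opp1 (@pres_per _ F t)) _ _ _).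
- by move=> t x y t0; exact: den_dt.
- by move=> t x y; exact: (drv_opp (den_d1 F t (- x) y)).
- by move=> t x y; exact: den_d2.
- by move=> t x y; apply: (drv_eq (drvN (drv_opp (vel1_d1 F t (- x) y)))); rewrite opprK.
- by move=> t x y; exact: vel2_d2.
- by move=> t x y; exact: (drv_opp (pres_d1 F t (- x) y)).
- by move=> t x y; exact: pres_d2.
- by move=> t x y /=; rewrite (transport F); ring.
- by split.
Qed.

Lemma flow_odd2 F : (forall x y, den F 0 x (- y) = - den F 0 x y) ->
  forall t x y, 0 <= t ->
  [/\ den F t x (- y) = - den F t x y, vel1 F t x (- y) = vel1 F t x y &
      vel2 F t x (- y) = - vel2 F t x y].
Proof.
move=> h0 t x y t0; have [G [hd h1 h2]] := flow_opp2 F.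
have E0 : den G 0 = den F 0.
  by apply/funext => x'; apply/funext => y'; rewrite hd h0 opprK.
have Et := flow_unique E0 t0; have [V1 V2] := velocity_unique Et.
by split; [rewrite -{1}Et hd opprK|rewrite -{1}V1 h1 opprK|rewrite -{1}V2 h2 opprK].
Qed.

Lemma flow_even1 F : (forall x y, den F 0 (- x) y = den F 0 x y) ->
  forall t x y, 0 <= t ->
  [/\ den F t (- x) y = den F t x y, vel1 F t (- x) y = - vel1 F t x y &
      vel2 F t (- x) y = vel2 F t x y].
Proof.
move=> h0 t x y t0; have [G [hd h1 h2]] := flow_opp1 F.
have E0 : den G 0 = den F 0.
  by apply/funext => x'; apply/funext => y'; rewrite hd h0.
have Et := flow_unique E0 t0; have [V1 V2] := velocity_unique Et.
by split; [rewrite -{1}Et hd opprK|rewrite -{1}V1 h1 opprK|rewrite -{1}V2 h2 opprK].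
Qed.

End Reflection.

(** * A priori bounds for symmetric flows *)

Section MaxPrinciple.
Context {R : realType}.

(** Only difference quotients from the left enter, so [t] may be the final time of the interval on
    which the maximum is taken. *)
Lemma drv_left_max (f : R -> R) (t l : R) : is_derive t 1 f l -> 0 < t ->
  (forall s, 0 <= s <= t -> f s <= f t) -> 0 <= l.
Proof.
move=> [df dl] t0 H; rewrite leNgt; apply/negP => l0.
have : (fun h => h^-1 *: (f (h *: (1 : R) + t) - f t)) @ 0^' --> l by rewrite -dl; exact: df.
move=> /cvgrPdist_lt/(_ (- l / 2)) => Hl.
have l2 : 0 < - l / 2 by lra.
have {Hl l2} [e /= e0 He] := Hl l2.
pose r := Num.min (e / 2) t.
have r1 : 0 < r by rewrite /r lt_min t0 andbT divr_gt0.
have r2 : r <= e / 2 by rewrite ge_min lexx.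
have r3 : r <= t by rewrite ge_min lexx orbT.
have re : `|0 - (- r)| < e by rewrite sub0r opprK gtr0_norm//; lra.
have rn : - r != 0 by rewrite lt_eqF// oppr_lt0.
have /= := He (- r) re rn.
have -> : - r *: (1 : R) = - r by rewrite /GRing.scale/= mulr1.
rewrite /GRing.scale/= ltr_norml => /andP[+ _].
have q : 0 <= (- r)^-1 * (f (- r + t) - f t).
  rewrite mulr_le0// ?invr_le0 ?oppr_le0 ?(ltW r1)//.
  by rewrite subr_le0; apply: H; apply/andP; split; lra.
lra.
Qed.

(** Maximise [g - e1 t] over [[0, T] * K]. At a maximum at positive time the time derivative of [g]
    is at least [e1 > 0], which rules out [gt <= 0]; so [g <= M] holds there. The alternative
    [g t x y <= M] in the hypothesis serves points on the boundary of [K]. Below, [K] is a full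
    cell, a segment of the axis, or a half cell. *)
Lemma max_principle (K : set (R * R)) (g gt : R -> R -> R -> R) (M : R) :
  compact K -> cont3 g -> (forall t x y : R, 0 < t -> is_derive t 1 (fun s => g s x y) (gt t x y)) ->
  (forall x y, K (x, y) -> g 0 x y <= M) ->
  (forall t x y, 0 < t -> K (x, y) -> (forall x' y', K (x', y') -> g t x' y' <= g t x y) ->
     g t x y <= M \/ gt t x y <= 0) ->
  forall t x y, 0 <= t -> K (x, y) -> g t x y <= M.
Proof.
move=> cK cg dg g0 H T x y T0 Kxy; apply/ler_addgt0Pr => e e0.
pose e1 := e / (T + 1); have e10 : 0 < e1 by rewrite divr_gt0//; lra.
pose f (z : R * (R * R)) := g z.1 z.2.1 z.2.2 - e1 * z.1.
have cf : continuous f.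
  move=> z; apply: cvgB.
    apply: (cont3_comp (h := fun z : R * (R * R) => z.1) (k := fun z : R * (R * R) => z.2.1)
      (l := fun z : R * (R * R) => z.2.2) cg).
    - by move=> w; exact: cvg_fst.
    - by apply: cont_fst => w; exact: cvg_snd.
    - by apply: cont_snd => w; exact: cvg_snd.
  by apply: cvgM; [exact: cvg_cst|exact: cvg_fst].
have cTK : compact (`[0, T]%classic `*` K : set (R * (R * R))).
  by apply: compact_setX => //; exact: segment_compact.
have [||[t0 [x0 y0]] + Hmax] := compact_EVT_max (f := f) _ cTK.
- by exists (T, (x, y)); split => //=; rewrite in_itv/= lexx T0.
- exact: continuous_subspaceT.
rewrite inE => -[/=]; rewrite in_itv/= => /andP[t00 t0T] Kxy0.
have HM t' x' y' : 0 <= t' <= T -> K (x', y') -> g t' x' y' - e1 * t' <= g t0 x0 y0 - e1 * t0.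
  by move=> ht' Kx'; apply: (Hmax (t', (x', y'))); rewrite inE; split => //=; rewrite in_itv.
have gM : g t0 x0 y0 <= M.
  move: t00; rewrite le_eqVlt => /predU1P[t00|t00]; first by rewrite -t00; exact: g0.
  have [|//|gt0] := H t0 x0 y0 t00 Kxy0.
    move=> x' y' K'; have := HM t0 x' y' _ K'; rewrite t0T ltW// => /(_ isT); lra.
  have d : is_derive t0 1 (fun s => g s x0 y0 - e1 * s) (gt t0 x0 y0 - e1).
    apply: (drv_eq (drvB (dg _ x0 y0 t00) (drvM (drv_cst t0 e1) (drv_id t0)))).
    by rewrite mul0r add0r mulr1.
  have dge0 : 0 <= gt t0 x0 y0 - e1.
    apply: (drv_left_max d t00) => s /andP[s0 st].
    by apply: HM => //; rewrite s0/= (le_trans st).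
  by exfalso; lra.
have := HM T x y; rewrite T0 lexx => /(_ isT Kxy) h.
have h1 : 0 <= e1 * t0 by rewrite mulr_ge0// ltW.
have h2 : e1 * T <= e by rewrite /e1 mulrAC ler_pdivrMr; nra.
lra.
Qed.

Lemma drv_interior_max (f : R -> R) (x a b : R) (df : R -> R) :
  (forall y : R, is_derive y 1 f (df y)) -> a < x -> x < b ->
  (forall y, a < y < b -> f y <= f x) -> df x = 0.
Proof.
move=> dff ax xb H.
have [] := @derive1_at_max R f a b x _ _ _ _.
- by rewrite ltW// (lt_trans ax).
- by move=> t _; case: (dff t).
- by rewrite in_itv/= ax.
- by move=> t; rewrite in_itv/= => /H.
by move=> _ h5; case: (dff x) => _ <-; exact: h5.
Qed.

Lemma drv_global_max (f : R -> R) (x : R) (df : R -> R) :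
  (forall y : R, is_derive y 1 f (df y)) -> (forall y, `|y - x| < 1 -> f y <= f x) -> df x = 0.
Proof.
move=> dff H; apply: (drv_interior_max (a := x - 1) (b := x + 1) dff); [lra|lra|].
by move=> y /andP[h1 h2]; apply: H; rewrite ltr_norml; apply/andP; split; lra.
Qed.

End MaxPrinciple.

Section SymmetricFlow.
Context {R : realType}.
Local Notation I2 c := (rint (- pi) pi c (pi : R)).
Variable F : @flow R.
Hypothesis odd0 : forall x y, den F 0 x (- y) = - den F 0 x y.
Hypothesis even0 : forall x y, den F 0 (- x) y = den F 0 x y.
Hypothesis axis0 : forall y, den F 0 0 y = 0.
Hypothesis nonneg0 : forall x y, 0 <= x <= pi -> 0 <= y <= pi -> 0 <= den F 0 x y.

Lemma vel2_0 t x : 0 <= t -> vel2 F t x 0 = 0.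
Proof. by move=> t0; have [_ _] := flow_odd2 odd0 x 0 t0; rewrite oppr0; lra. Qed.

Lemma vel2_pi t x : 0 <= t -> vel2 F t x pi = 0.
Proof.
move=> t0; have [_ _] := flow_odd2 odd0 x pi t0.
by rewrite (periodic2_pi2 _ (@vel2_per _ F t)); lra.
Qed.

Lemma vel1_0 t y : 0 <= t -> vel1 F t 0 y = 0.
Proof. by move=> t0; have [_] := flow_even1 even0 0 y t0; rewrite oppr0; lra. Qed.

Lemma den_0 t x : 0 <= t -> den F t x 0 = 0.
Proof. by move=> t0; have [] := flow_odd2 odd0 x 0 t0; rewrite oppr0; lra. Qed.

Lemma den_pi t x : 0 <= t -> den F t x pi = 0.
Proof.
move=> t0; have [] := flow_odd2 odd0 x pi t0.
by rewrite (periodic2_pi2 _ (@den_per _ F t)); lra.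
Qed.

Let dentN (t x y : R) : 0 < t ->
  is_derive t 1 (fun s => - den F s x y) (- dent F t x y).
Proof. by move=> t0; exact: drvN (den_dt F x y t0). Qed.

Lemma den_critical t x y : den1 F t x y = 0 -> den2 F t x y = 0 -> dent F t x y = 0.
Proof. by move=> h1 h2; rewrite (transport F) h1 h2 !mulr0 addr0 oppr0. Qed.

Lemma den_bounded M : (forall x y, `|den F 0 x y| <= M) ->
  forall t x y, 0 <= t -> `|den F t x y| <= M.
Proof.
move=> HM t x y t0.
pose K : set (R * R) := (`[- pi, pi]%classic `*` `[- pi, pi]%classic).
have cK : compact K by apply: compact_setX; exact: segment_compact.
have KE x' y' : K (x', y') <-> (- pi <= x' <= pi /\ - pi <= y' <= pi).
  by rewrite /K /=; split => -[]; rewrite /= !in_itv/=.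
apply: (periodic2_ind (P := fun z => `|z| <= M) (@den_per _ F t)) => {}x {}y hx hy.
(* [sg = 1] and [sg = -1] treat maxima and minima together. By periodicity an extremum over the cell
   is one over the plane, hence a critical point, where the transport equation makes the time
   derivative vanish. *)
have crit (sg : R) s x' y' : (forall a b, K (a, b) -> sg * den F s a b <= sg * den F s x' y') ->
    sg * sg = 1 -> dent F s x' y' = 0.
  move=> Hmax sg1.
  have Hm a b : sg * den F s a b <= sg * den F s x' y'.
    apply: (periodic2_ind (P := fun z => sg * z <= sg * den F s x' y') (@den_per _ F s)).
    by move=> a' b' ha hb; apply: Hmax; apply/KE.
  have sgK z : sg * z = 0 -> z = 0 by move=> h; rewrite -[z]mul1r -sg1 -mulrA h mulr0.
  apply: den_critical; apply: sgK.
    apply: (drv_global_max (f := fun z => sg * den F s z y') (df := fun z => sg * den1 F s z y')).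
      move=> z; apply: (drv_eq (drvM (drv_cst z sg) (den_d1 F s z y'))).
      by rewrite mul0r add0r.
    by move=> z _; exact: Hm.
  apply: (drv_global_max (f := fun z => sg * den F s x' z) (df := fun z => sg * den2 F s x' z)).
    move=> z; apply: (drv_eq (drvM (drv_cst z sg) (den_d2 F s x' z))).
    by rewrite mul0r add0r.
  by move=> z _; exact: Hm.
have Kxy : K (x, y) by apply/KE.
rewrite ler_norml lerNl; apply/andP; split.
  apply: (max_principle cK (cont3N (@den_cont _ F)) dentN _ _ t0 Kxy).
    by move=> x' y' _; apply: le_trans (HM x' y'); rewrite -normrN ler_norm.
  move=> s x' y' s0 K' Hmax; right.
  rewrite (crit (-1)) ?oppr0// ?mulrNN ?mulr1// => a b Kab.
  by rewrite !mulN1r; exact: Hmax.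
apply: (max_principle cK (@den_cont _ F) (fun t x y => @den_dt _ F t x y) _ _ t0 Kxy).
  by move=> x' y' _; apply: le_trans (HM x' y'); rewrite ler_norm.
move=> s x' y' s0 K' Hmax; right.
rewrite (crit 1) ?mulr1// => a b Kab.
by rewrite !mul1r; exact: Hmax.
Qed.

(** As [vel1] vanishes on [x1 = 0], the density restricted to this line satisfies a transport
    equation in [x2] alone, with zero initial data. *)
Lemma den_axis t y : 0 <= t -> den F t 0 y = 0.
Proof.
move=> t0.
pose K : set (R * R) := ([set 0] `*` `[- pi, pi]%classic).
have cK : compact K by apply: compact_setX; [exact: compact_set1|exact: segment_compact].
have KE y' : - pi <= y' <= pi -> K (0, y') by move=> h; split => //=; rewrite in_itv.
pose p0 (x y : R) := den F t 0 y.
have pp : periodic2 p0 by move=> x' y'; split => //; have [_] := @den_per _ F t 0 y'.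
apply: (periodic2_ind (P := fun z => z = 0) pp _ 0 y) => x0 {}y _ hy; rewrite /p0.
have crit (sg : R) s y' : 0 < s -> sg * sg = 1 ->
    (forall b, K (0, b) -> sg * den F s 0 b <= sg * den F s 0 y') -> dent F s 0 y' = 0.
  move=> s0 sg1 Hmax; rewrite (transport F) vel1_0 ?(ltW s0)// mul0r add0r.
  suff : den2 F s 0 y' = 0 by move=> ->; rewrite mulr0 oppr0.
  have sgK z : sg * z = 0 -> z = 0 by move=> h; rewrite -[z]mul1r -sg1 -mulrA h mulr0.
  apply: sgK; pose p1 (x y : R) := den F s 0 y.
  have pp1 : periodic2 p1 by move=> x1 y1; split => //; have [_] := @den_per _ F s 0 y1.
  apply: (drv_global_max (f := fun z => sg * den F s 0 z) (df := fun z => sg * den2 F s 0 z)).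
    move=> z; apply: (drv_eq (drvM (drv_cst z sg) (den_d2 F s 0 z))).
    by rewrite mul0r add0r.
  move=> z _; apply: (periodic2_ind (P := fun z => sg * z <= sg * den F s 0 y') pp1 _ 0 z).
  by move=> a b ha hb; apply: Hmax; exact: KE.
apply/eqP; rewrite eq_le -[X in _ && X]oppr_le0; apply/andP; split.
  apply: (max_principle cK (@den_cont _ F) (fun t x y => @den_dt _ F t x y) _ _ t0 (KE y hy)).
    by move=> x' y' [/= -> _]; rewrite axis0.
  move=> s x' y' s0 [/= -> _] Hmax; right.
  rewrite (crit 1) ?mulr1// => b Kb.
  by rewrite !mul1r; exact: Hmax.
apply: (max_principle cK (cont3N (@den_cont _ F)) dentN _ _ t0 (KE y hy)).
  by move=> x' y' [/= -> _]; rewrite axis0 oppr0.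
move=> s x' y' s0 [/= -> _] Hmax; right.
rewrite (crit (-1)) ?oppr0// ?mulrNN ?mulr1// => b Kb.
by rewrite !mulN1r; exact: Hmax.
Qed.

(** The cell [[0, 2 pi] * [0, pi]] is bounded by lines on which the density vanishes at all times,
    by the symmetries and [den_axis]. A minimum is thus either on these lines or critical. Initially
    the part [x > pi] is handled by evenness and periodicity. *)
Lemma den_ge0 t x y : 0 <= t -> 0 <= y <= pi -> 0 <= den F t x y.
Proof.
move=> t0 hy.
pose K : set (R * R) := (`[0, 2 * pi]%classic `*` `[0, pi]%classic).
have cK : compact K by apply: compact_setX; exact: segment_compact.
have KE x' y' : K (x', y') <-> (0 <= x' <= 2 * pi /\ 0 <= y' <= pi).
  by rewrite /K /=; split => -[]; rewrite /= !in_itv/=.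
have [n hn] := reduce_2pi 0 x; rewrite add0r in hn.
have -> : den F t x y = den F t (x + n%:~R * (2 * pi)) y.
  by have := periodic2_int n 0 x y (@den_per _ F t); rewrite mul0r addr0.
move: (x + _) hn => {}x hx.
rewrite -oppr_le0.
have Kxy : K (x, y) by apply/KE.
apply: (max_principle cK (cont3N (@den_cont _ F)) dentN _ _ t0 Kxy).
  move=> x' y' /KE[/andP[hx1 hx2] hy']; rewrite oppr_le0.
  have [xp|xp] := lerP x' pi; first by apply: nonneg0 => //; rewrite hx1.
  have -> : den F 0 x' y' = den F 0 (2 * pi - x') y'.
    have [E _] := @den_per _ F 0 (- x') y'.
    by rewrite (addrC (2 * pi)) E even0.
  by apply: nonneg0 => //; apply/andP; split; lra.
move=> s x' y' s0 /KE[/andP[hx1 hx2] /andP[hy1 hy2]] Hmax.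
have s00 := ltW s0.
have [xe|x0] := eqVneq x' 0; first by left; rewrite xe den_axis// oppr0.
have [xe|x2] := eqVneq x' (2 * pi).
  left; rewrite xe; have [E _] := @den_per _ F s 0 y'; rewrite add0r in E.
  by rewrite E den_axis// oppr0.
have [ye|y0] := eqVneq y' 0; first by left; rewrite ye den_0// oppr0.
have [ye|yp] := eqVneq y' pi; first by left; rewrite ye den_pi// oppr0.
have x01 : 0 < x' by rewrite lt_neqAle eq_sym x0.
have x21 : x' < 2 * pi by rewrite lt_neqAle x2.
have y01 : 0 < y' by rewrite lt_neqAle eq_sym y0.
have yp1 : y' < pi by rewrite lt_neqAle yp.
right; rewrite den_critical ?oppr0//.
  apply/eqP; rewrite -oppr_eq0; apply/eqP.
  apply: (drv_interior_max (f := fun z => - den F s z y') (df := fun z => - den1 F s z y')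
    (a := 0) (b := 2 * pi)) => //.
    by move=> z; exact: drvN (den_d1 F s z y').
  by move=> z /andP[z1 z2]; apply: Hmax; apply/KE; split; apply/andP; split; lra.
apply/eqP; rewrite -oppr_eq0; apply/eqP.
apply: (drv_interior_max (f := fun z => - den F s x' z) (df := fun z => - den2 F s x' z)
  (a := 0) (b := pi)) => //.
  by move=> z; exact: drvN (den_d2 F s x' z).
by move=> z /andP[z1 z2]; apply: Hmax; apply/KE; split; apply/andP; split; lra.
Qed.

Lemma I2_0pi : 0 < pi :> R. Proof. exact: pi_gt0. Qed.

Lemma mass_conserved t : 0 <= t -> I2 0 (den F t) = I2 0 (den F 0).
Proof.
rewrite le_eqVlt => /predU1P[<-//|t0].
have dV (s : R) : 0 < s -> is_derive s 1 (fun s => I2 0 (den F s)) (I2 0 (dent F s)).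
  by move=> s0; apply: (is_derive_rint_param _ _ _ _ s0 (@den_cont _ F) (@dent_cont _ F)) => r x y r0;
    exact: den_dt.
have V0 s : 0 < s -> I2 0 (dent F s) = 0.
  move=> s0; have s00 := ltW s0.
  have c1 := cont3_at (t := s) (@den_cont _ F); have c2' := cont3_at (t := s) (@dent_cont _ F).
  have c3 := cont3_at (t := s) (@den1_cont _ F); have c4 := cont3_at (t := s) (@den2_cont _ F).
  have c5 := @vel1_cont _ F s; have c6 := @vel2_cont _ F s; have c7 := @dvel_cont _ F s.
  transitivity (I2 0 (fun _ _ => 0)); last by rewrite (rint_cst pi_lt I2_0pi) mul0r.
  apply: (rint_eq_div pi_lt I2_0pi
    (F1 := fun x y => - (vel1 F s x y * den F s x y))
    (G1 := fun x y => - (dvel F s x y * den F s x y + vel1 F s x y * den1 F s x y))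
    (F2 := fun x y => - (vel2 F s x y * den F s x y))
    (G2 := fun x y => - (- dvel F s x y * den F s x y + vel2 F s x y * den2 F s x y))); try by c2.
  - by move=> x y; exact: drvN (drvM (vel1_d1 F s x y) (den_d1 F s x y)).
  - by move=> x y; exact: drvN (drvM (vel2_d2 F s x y) (den_d2 F s x y)).
  - by move=> y; rewrite (periodic2_pi1 _ (@vel1_per _ F s)) (periodic2_pi1 _ (@den_per _ F s)).
  - by move=> x; rewrite vel2_0// vel2_pi// !mul0r.
  - by move=> x y _ _; rewrite (transport F); ring.
have cV : continuous (fun s => I2 0 (den F s)) := cont_rint_param (@den_cont _ F).
have [||c] := @MVT R (fun s => I2 0 (den F s)) (fun s => I2 0 (dent F s)) _ _ t0.
- by move=> s; rewrite in_itv/= => /andP[s0 _]; exact: dV.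
- exact: continuous_subspaceT.
rewrite in_itv/= => /andP[c0 _] E; apply/eqP; rewrite -subr_eq0; apply/eqP.
by rewrite E (V0 c c0) mul0r.
Qed.

Definition energy t := I2 0 (fun x y => y * den F t x y).
(** Expressed through [dent], which is jointly continuous, so that continuity in time is immediate;
    the velocity is continuous in space for each fixed time. [dissipationE] gives the link with the
    velocity. *)
Definition dissipation t := - I2 0 (fun x y => y * dent F t x y).

Let cy3 (g : R -> R -> R -> R) : cont3 g -> cont3 (fun t x y => y * g t x y).
Proof. by apply: cont3M => z; exact: cvg_snd. Qed.

Lemma energy_cont : continuous energy.
Proof. exact: (cont_rint_param (cy3 (@den_cont _ F))). Qed.

Lemma dissipation_cont : continuous dissipation.
Proof. exact: (cont_oppR (cont_rint_param (cy3 (@dent_cont _ F)))). Qed.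

Lemma energy_drv (t : R) : 0 < t -> is_derive t 1 energy (- dissipation t).
Proof.
move=> t0; rewrite /dissipation opprK.
apply: (is_derive_rint_param _ _ _ _ t0 (cy3 (@den_cont _ F)) (cy3 (@dent_cont _ F))) => s x y s0.
by apply: (drv_eq (drvM (drv_cst s y) (den_dt F x y s0))); rewrite mul0r add0r.
Qed.

(** The flux is [u (y rho + p)]: Darcy's law gives [grad (y rho + p) = y grad rho - u], hence its
    divergence is [y u . grad rho - |u|^2 = - y d_t rho - |u|^2]. It is tangent to the horizontal
    sides since [vel2] vanishes there. *)
Lemma dissipationE t : 0 <= t ->
  dissipation t = I2 0 (fun x y => vel1 F t x y ^+ 2 + vel2 F t x y ^+ 2).
Proof.
move=> s00.
have c1 := cont3_at (t := t) (@den_cont _ F); have c2' := cont3_at (t := t) (@dent_cont _ F).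
have c3 := cont3_at (t := t) (@den1_cont _ F); have c4 := cont3_at (t := t) (@den2_cont _ F).
have c5 := @vel1_cont _ F t; have c6 := @vel2_cont _ F t; have c7 := @dvel_cont _ F t.
have c8 := @pres_cont _ F t.
have cyd : cont2 (fun x y => y * dent F t x y) by c2.
rewrite /dissipation -mulN1r -(rintZ _ _ _ _ _ cyd).
apply: (rint_eq_div pi_lt I2_0pi
  (F1 := fun x y => vel1 F t x y * (y * den F t x y + pres F t x y))
  (G1 := fun x y => dvel F t x y * (y * den F t x y + pres F t x y) +
                    vel1 F t x y * (y * den1 F t x y + - vel1 F t x y))
  (F2 := fun x y => vel2 F t x y * (y * den F t x y + pres F t x y))
  (G2 := fun x y => - dvel F t x y * (y * den F t x y + pres F t x y) +
                    vel2 F t x y * (den F t x y + y * den2 F t x y +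
                                    (- den F t x y + - vel2 F t x y)))); try by c2.
- move=> x y; apply: (drv_eq (drvM (vel1_d1 F t x y)
    (drvD (drvM (drv_cst x y) (den_d1 F t x y)) (pres_d1 F t x y)))).
  by ring.
- move=> x y; apply: (drv_eq (drvM (vel2_d2 F t x y)
    (drvD (drvM (drv_id y) (den_d2 F t x y)) (pres_d2 F t x y)))).
  by ring.
- move=> y; rewrite (periodic2_pi1 _ (@vel1_per _ F t)) (periodic2_pi1 _ (@den_per _ F t)).
  by rewrite (periodic2_pi1 _ (@pres_per _ F t)).
- by move=> x; rewrite vel2_0// vel2_pi// !mul0r.
- by move=> x y _ _; rewrite (transport F); ring.
Qed.

End SymmetricFlow.

(** * Fourier modes and the dissipation *)

Section TrigIntegrals.
Context {R : realType}.
Local Notation mu := (@lebesgue_measure R).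
Local Notation It f := (\int[mu]_(x in `[- pi, pi]) (f x : R)).

Lemma eq_It (f g : R -> R) : (forall x, f x = g x) -> It (fun x => f x) = It (fun x => g x).
Proof. by move=> fg; apply: eq_Rintegral => x _. Qed.

Lemma sin_natpi (n : nat) : sin (n%:R * pi) = 0 :> R.
Proof.
elim: n => [|n IH]; first by rewrite mul0r sin0.
by rewrite -natr1 mulrDl mul1r sinDpi IH oppr0.
Qed.

Lemma cos_continuous_lin (k : R) : continuous (fun x : R => cos (k * x)).
Proof.
move=> x; apply: (continuous_comp (f := fun x => k * x)); last exact: continuous_cos.
exact: mulrl_continuous.
Qed.

Lemma sin_continuous_lin (k : R) : continuous (fun x : R => sin (k * x)).
Proof.
move=> x; apply: (continuous_comp (f := fun x => k * x)); last exact: continuous_sin.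
exact: mulrl_continuous.
Qed.

Lemma drv_lin (k x : R) : is_derive x 1 (fun y => k * y) k.
Proof. by apply: (drv_eq (drvM (drv_cst x k) (drv_id x))); rewrite mul0r mulr1 add0r. Qed.

Lemma int_cos (k : R) : k != 0 -> sin (k * pi) = 0 -> It (fun x => cos (k * x)) = 0.
Proof.
move=> k0 sk.
have d (x : R) : is_derive x 1 (fun x => k^-1 * sin (k * x)) (cos (k * x)).
  apply: (drv_eq (drvM (drv_cst x k^-1) (drv_sin (drv_lin k x)))).
  by rewrite mul0r add0r mulrA mulVf// mul1r.
rewrite (FTC_Rintegral (ltW pi_lt) (@cos_continuous_lin k) d).
by rewrite mulrN sinN sk oppr0 subrr.
Qed.

Lemma contM (f g : R -> R) : continuous f -> continuous g -> continuous (fun x => f x * g x).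
Proof. by move=> cf cg x; apply: cvgM; [exact: cf|exact: cg]. Qed.

Lemma contD (f g : R -> R) : continuous f -> continuous g -> continuous (fun x => f x + g x).
Proof. by move=> cf cg x; apply: cvgD; [exact: cf|exact: cg]. Qed.

Lemma contC (c : R) : continuous (fun _ : R => c).
Proof. by move=> x; exact: cvg_cst. Qed.

Lemma ItD (f g : R -> R) : continuous f -> continuous g ->
  It (fun x => f x + g x) = It f + It g.
Proof. by move=> cf cg; rewrite RintegralD//; exact: continuous_itv_integrable. Qed.

Lemma ItZ (c : R) (f : R -> R) : continuous f -> It (fun x => c * f x) = c * It f.
Proof. by move=> cf; rewrite RintegralZl//; exact: continuous_itv_integrable. Qed.

(** The index is shifted: [n] stands for the frequency [n + 1]. The frequency zero is kept apart,
    see [mean0]. *)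
Definition cosS (n : nat) (x : R) := cos (n.+1%:R * x).
Definition sinS (n : nat) (x : R) := sin (n.+1%:R * x).

Lemma cosS_cont n : continuous (cosS n). Proof. exact: cos_continuous_lin. Qed.
Lemma sinS_cont n : continuous (sinS n). Proof. exact: sin_continuous_lin. Qed.

Lemma int_cos_diff (n m : nat) :
  It (fun x => cos ((n.+1%:R - m.+1%:R) * x)) = if n == m then 2 * pi else 0.
Proof.
have [->|nm] := eqVneq n m.
  rewrite (eq_It (g := cst 1)); last by move=> x; rewrite subrr mul0r cos0.
  by rewrite (Rintegral_cst_itv _ (ltW pi_lt)); ring.
apply: int_cos; first by rewrite subr_eq0 eqr_nat.
by rewrite mulrBl sinB !sin_natpi mul0r mulr0 subrr.
Qed.

Lemma int_cos_sum (n m : nat) : It (fun x => cos ((n.+1%:R + m.+1%:R) * x)) = 0.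
Proof.
apply: int_cos; first by rewrite -natrD pnatr_eq0 addnS.
by rewrite mulrDl sinD !sin_natpi mul0r mulr0 addr0.
Qed.

Lemma cosS_ortho n m : It (fun x => cosS n x * cosS m x) = if n == m then pi else 0.
Proof.
rewrite (eq_It (g := fun x => 2^-1 * (cos ((n.+1%:R - m.+1%:R) * x) +
  cos ((n.+1%:R + m.+1%:R) * x)))); last first.
  by move=> x; rewrite /cosS mulrBl mulrDl cosB cosD; field.
rewrite ItZ; last by apply: contD; exact: cos_continuous_lin.
rewrite ItD; [|exact: cos_continuous_lin..].
by rewrite int_cos_diff int_cos_sum addr0; case: ifP => _; rewrite ?mulr0//; field.
Qed.

Lemma sinS_ortho n m : It (fun x => sinS n x * sinS m x) = if n == m then pi else 0.
Proof.
rewrite (eq_It (g := fun x => 2^-1 * (cos ((n.+1%:R - m.+1%:R) * x) +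
  (-1) * cos ((n.+1%:R + m.+1%:R) * x)))); last first.
  by move=> x; rewrite /sinS mulrBl mulrDl cosB cosD; field.
have c1 : continuous (fun x : R => (-1) * cos ((n.+1%:R + m.+1%:R) * x)).
  by apply: contM; [exact: contC|exact: cos_continuous_lin].
rewrite ItZ; last by apply: contD => //; exact: cos_continuous_lin.
rewrite ItD//; last exact: cos_continuous_lin.
rewrite ItZ; last exact: cos_continuous_lin.
by rewrite int_cos_diff int_cos_sum mulr0 addr0; case: ifP => _; rewrite ?mulr0//; field.
Qed.

Section Parseval.
Variable e : nat -> R -> R.
Hypothesis ce : forall n, continuous (e n).
Hypothesis oe : forall n m, It (fun x => e n x * e m x) = if n == m then pi else 0.

Definition lincomb (al : nat -> R) (N : nat) (x : R) := \sum_(n < N) al n * e n x.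

Lemma lincomb_cont al N : continuous (lincomb al N).
Proof.
elim: N => [|N IH].
  rewrite (_ : lincomb al 0 = fun=> 0); first exact: contC.
  by apply/funext => x; rewrite /lincomb big_ord0.
rewrite (_ : lincomb al N.+1 = fun x => lincomb al N x + al N * e N x).
  by apply: contD => //; apply: contM; [exact: contC|exact: ce].
by apply/funext => x; rewrite /lincomb big_ord_recr.
Qed.

Lemma lincomb_ortho al N m : (N <= m)%N -> It (fun x => lincomb al N x * e m x) = 0.
Proof.
elim: N => [_|N IH Nm].
  rewrite (eq_It (g := cst 0)); last by move=> x; rewrite /lincomb big_ord0 mul0r.
  by rewrite (Rintegral_cst_itv _ (ltW pi_lt)) mul0r.
rewrite (eq_It (g := fun x => lincomb al N x * e m x + al N * (e N x * e m x))); last first.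
  by move=> x; rewrite /lincomb big_ord_recr /= mulrDl mulrA.
have cee : continuous (fun x => e N x * e m x) by apply: contM; exact: ce.
rewrite ItD; first last.
- by apply: contM; [exact: contC|exact: cee].
- by apply: contM; [exact: lincomb_cont|exact: ce].
rewrite ItZ// oe IH ?(ltnW Nm)//.
by rewrite ltn_eqF// mulr0 addr0.
Qed.

Lemma parseval al N : It (fun x => lincomb al N x ^+ 2) = pi * \sum_(n < N) al n ^+ 2.
Proof.
elim: N => [|N IH].
  rewrite (eq_It (g := cst 0)); last by move=> x; rewrite /lincomb big_ord0 expr0n.
  by rewrite (Rintegral_cst_itv _ (ltW pi_lt)) mul0r big_ord0 mulr0.
have cl := @lincomb_cont al N; have cN := @ce N.
rewrite (eq_It (g := fun x => lincomb al N x ^+ 2 +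
  (2 * al N * (lincomb al N x * e N x) + al N ^+ 2 * (e N x * e N x)))); last first.
  by move=> x; rewrite /lincomb big_ord_recr /=; ring.
have c1 : continuous (fun x => lincomb al N x ^+ 2) by exact: (contM cl cl).
have c2' : continuous (fun x => lincomb al N x * e N x) by exact: contM.
have c3 : continuous (fun x => e N x * e N x) by exact: contM.
have c4 : continuous (fun x => 2 * al N * (lincomb al N x * e N x)) by apply: contM => //; exact: contC.
have c5 : continuous (fun x => al N ^+ 2 * (e N x * e N x)) by apply: contM => //; exact: contC.
rewrite ItD//; last exact: contD.
rewrite ItD// !ItZ// IH lincomb_ortho// oe eqxx big_ord_recr /=; ring.
Qed.

End Parseval.

Lemma rint_prod (a b c d : R) (f g : R -> R) : continuous f -> continuous g ->
  rint a b c d (fun x y => f x * g y) =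
  (\int[mu]_(x in `[a, b]) f x) * (\int[mu]_(y in `[c, d]) g y).
Proof.
move=> cf cg; rewrite /rint -RintegralZl//; last exact: continuous_itv_integrable.
apply: eq_Rintegral => y _; rewrite RintegralZr//; exact: continuous_itv_integrable.
Qed.

Lemma int_cos2 : \int[mu]_(y in `[0, pi]) (cos y ^+ 2 : R) = pi / 2.
Proof.
have d (y : R) : is_derive y 1 (fun y => 2^-1 * (y + sin y * cos y)) (cos y ^+ 2).
  have ds := drv_sin (drv_id y); have dc := drv_cos (drv_id y).
  apply: (drv_eq (drvM (drv_cst y 2^-1) (drvD (drv_id y) (drvM ds dc)))).
  have := cos2Dsin2 y; rewrite !mul1r mul0r add0r => h.
  by rewrite mulrN -!expr2 (_ : sin y ^+ 2 = 1 - cos y ^+ 2); [field|lra].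
have c : continuous (fun y : R => cos y ^+ 2) by apply: contM; exact: continuous_cos.
rewrite (FTC_Rintegral (pi_ge0 R) c d).
by rewrite sin0 sinpi; field.
Qed.

Lemma int_sin2 : \int[mu]_(y in `[0, pi]) (sin y ^+ 2 : R) = pi / 2.
Proof.
have d (y : R) : is_derive y 1 (fun y => 2^-1 * (y + - (sin y * cos y))) (sin y ^+ 2).
  have ds := drv_sin (drv_id y); have dc := drv_cos (drv_id y).
  apply: (drv_eq (drvM (drv_cst y 2^-1) (drvD (drv_id y) (drvN (drvM ds dc))))).
  have := cos2Dsin2 y; rewrite !mul1r mul0r add0r => h.
  by rewrite mulrN -!expr2 (_ : cos y ^+ 2 = 1 - sin y ^+ 2); [field|lra].
have c : continuous (fun y : R => sin y ^+ 2) by apply: contM; exact: continuous_sin.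
rewrite (FTC_Rintegral (pi_ge0 R) c d).
by rewrite sin0 sinpi; field.
Qed.

End TrigIntegrals.

Section Bessel.
Context {R : realType}.
Local Notation I2 c := (rint (- pi) pi c (pi : R)).
Variable F : @flow R.
Hypothesis odd0 : forall x y, den F 0 x (- y) = - den F 0 x y.

Definition modecoef t n := I2 0 (fun x y => den F t x y * (cosS n x * sin y)).

Lemma rint_lincomb_cos (f : R -> R -> R) al N : cont2 f ->
  I2 0 (fun x y => f x y * (lincomb cosS al N x * sin y)) =
  \sum_(n < N) al n * I2 0 (fun x y => f x y * (cosS n x * sin y)).
Proof.
move=> cf; elim: N => [|N IH].
  rewrite big_ord0 -[RHS](mul0r ((pi - - pi) * (pi - 0))) -(rint_cst pi_lt I2_0pi).
  by apply: rint_eq => x y _ _; rewrite /lincomb big_ord0 mul0r mulr0.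
rewrite big_ord_recr /= -IH.
have cl := cont2_fun1 (lincomb_cont (e := cosS) (al := al) (N := N) (@cosS_cont R)).
have cc := cont2_fun1 (@cosS_cont R N).
have c1 : cont2 (fun x y => f x y * (cosS N x * sin y)) by c2.
have cA : cont2 (fun x y => f x y * (lincomb cosS al N x * sin y)) by c2.
have cB : cont2 (fun x y => al N * (f x y * (cosS N x * sin y))) by c2.
rewrite -(rintZ _ _ _ _ _ c1) -(rintD _ _ _ _ cA cB).
apply: rint_eq => x y _ _; rewrite {1}/lincomb big_ord_recr /= -/(lincomb _ _ _ x); ring.
Qed.

(* Darcy's law is tested with the divergence-free field
   (phi(x1) cos x2, - phi'(x1) sin x2), which is tangent to the boundary of Q. *)
Lemma bessel t N : 0 <= t ->
  \sum_(n < N) modecoef t n ^+ 2 / pi ^+ 2 <= dissipation F t.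
Proof.
move=> t0; rewrite (dissipationE odd0 t0).
(* Once [al^2] is bounded by [be^2], mode [n] contributes [2 be b - pi^2 be^2] to the lower bound,
   with [b] the mode coefficient; this is maximal at [be = b / pi^2], with value [b^2 / pi^2]. The
   choice of [al] makes [dphi] the derivative of [phi]. *)
pose be n := modecoef t n / pi ^+ 2.
pose al n := be n / n.+1%:R.
pose phi := lincomb sinS al N; pose dphi := lincomb cosS be N.
have cphi : continuous phi by apply: lincomb_cont; exact: sinS_cont.
have cdphi : continuous dphi by apply: lincomb_cont; exact: cosS_cont.
have dphiE (x : R) : is_derive x 1 phi (dphi x).
  rewrite /phi /dphi; elim: (N) => [|n IH].
    have -> : lincomb sinS al 0 = fun=> 0 by apply/funext => z; rewrite /lincomb big_ord0.
    by rewrite /lincomb big_ord0; exact: drv_cst.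
  have -> : lincomb sinS al n.+1 = fun z => lincomb sinS al n z + al n * sinS n z.
    by apply/funext => z; rewrite /lincomb big_ord_recr.
  apply: (drv_eq (drvD IH (drvM (drv_cst x (al n)) (drv_sin (drv_lin n.+1%:R x))))).
  rewrite mul0r add0r [RHS]/lincomb big_ord_recr /=; congr (_ + _).
  by rewrite mulrA /al mulfVK// pnatr_eq0.
have phi_pi : phi (- pi) = phi pi.
  rewrite /phi /lincomb; apply: eq_bigr => i _.
  by rewrite /sinS mulrN sinN sin_natpi oppr0.
have dphi_pi : dphi (- pi) = dphi pi.
  rewrite /dphi /lincomb; apply: eq_bigr => i _.
  by rewrite /cosS mulrN cosN.
have c1 := cont3_at (t := t) (@den_cont _ F).
have c5 := @vel1_cont _ F t; have c6 := @vel2_cont _ F t.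
have c8 := @pres_cont _ F t.
have cf := cont2_fun1 cphi; have cd := cont2_fun1 cdphi.
(* Expand [|u - V|^2 >= 0] with the test field [V = (phi cos y, - dphi sin y)]. By Darcy's law
   [u . V] equals [rho dphi sin y] minus the divergence of [p V]. *)
have le1 : I2 0 (fun x y => 2 * (den F t x y * (dphi x * sin y)) +
      - (phi x ^+ 2 * cos y ^+ 2 + dphi x ^+ 2 * sin y ^+ 2)) <=
    I2 0 (fun x y => vel1 F t x y ^+ 2 + vel2 F t x y ^+ 2).
  apply: (le_rint_div pi_lt I2_0pi
    (F1 := fun x y => 2 * (pres F t x y * (phi x * cos y)))
    (G1 := fun x y => 2 * (- vel1 F t x y * (phi x * cos y) + pres F t x y * (dphi x * cos y)))
    (F2 := fun x y => - (2 * (pres F t x y * (dphi x * sin y))))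
    (G2 := fun x y => - (2 * ((- den F t x y + - vel2 F t x y) * (dphi x * sin y) +
        pres F t x y * (dphi x * cos y))))); try by c2.
  - move=> x y; apply: (drv_eq (drvM (drv_cst x 2) (drvM (pres_d1 F t x y)
      (drvM (dphiE x) (drv_cst x (cos y)))))).
    by ring.
  - move=> x y; apply: (drv_eq (drvN (drvM (drv_cst y 2) (drvM (pres_d2 F t x y)
      (drvM (drv_cst y (dphi x)) (drv_sin (drv_id y))))))).
    by ring.
  - by move=> y; rewrite (periodic2_pi1 _ (@pres_per _ F t)) phi_pi.
  - by move=> x; rewrite sin0 sinpi !mulr0.
  - move=> x y _ _; rewrite -subr_ge0.
    set u := vel1 _ _ _ _; set v := vel2 _ _ _ _.
    have -> : u ^+ 2 + v ^+ 2 + (2 * (- u * (phi x * cos y) + pres F t x y * (dphi x * cos y)) +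
       - (2 * ((- den F t x y + - v) * (dphi x * sin y) + pres F t x y * (dphi x * cos y)))) -
       (2 * (den F t x y * (dphi x * sin y)) + - (phi x ^+ 2 * cos y ^+ 2 + dphi x ^+ 2 * sin y ^+ 2)) =
       (u - phi x * cos y) ^+ 2 + (v + dphi x * sin y) ^+ 2 by ring.
    by rewrite addr_ge0 ?sqr_ge0.
apply: le_trans le1.
have cA : cont2 (fun x y => den F t x y * (dphi x * sin y)) by c2.
have cA2 : cont2 (fun x y => 2 * (den F t x y * (dphi x * sin y))) by c2.
have cB : cont2 (fun x y => phi x ^+ 2 * cos y ^+ 2) by c2.
have cC : cont2 (fun x y => dphi x ^+ 2 * sin y ^+ 2) by c2.
have cBC : cont2 (fun x y => phi x ^+ 2 * cos y ^+ 2 + dphi x ^+ 2 * sin y ^+ 2) by c2.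
have cBC1 : cont2 (fun x y => (-1) * (phi x ^+ 2 * cos y ^+ 2 + dphi x ^+ 2 * sin y ^+ 2)) by c2.
have -> : I2 0 (fun x y => 2 * (den F t x y * (dphi x * sin y)) +
      - (phi x ^+ 2 * cos y ^+ 2 + dphi x ^+ 2 * sin y ^+ 2)) =
    2 * (\sum_(n < N) be n * modecoef t n) -
     (pi * (\sum_(n < N) al n ^+ 2) * (pi / 2) + pi * (\sum_(n < N) be n ^+ 2) * (pi / 2)).
  rewrite -(rint_lincomb_cos be N c1) -/dphi -(rintZ _ _ _ _ _ cA).
  have E : I2 0 (fun x y => phi x ^+ 2 * cos y ^+ 2 + dphi x ^+ 2 * sin y ^+ 2) =
      pi * (\sum_(n < N) al n ^+ 2) * (pi / 2) + pi * (\sum_(n < N) be n ^+ 2) * (pi / 2).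
    rewrite (rintD _ _ _ _ cB cC).
    rewrite (rint_prod _ _ _ _ (f := fun x => phi x ^+ 2) (g := fun y => cos y ^+ 2)); first last.
    - by move=> z; apply: contM; exact: continuous_cos.
    - exact: (contM cphi cphi).
    rewrite (rint_prod _ _ _ _ (f := fun x => dphi x ^+ 2) (g := fun y => sin y ^+ 2)); first last.
    - by move=> z; apply: contM; exact: continuous_sin.
    - exact: (contM cdphi cdphi).
    rewrite int_cos2 int_sin2 (parseval (@sinS_cont R) (@sinS_ortho R)).
    by rewrite (parseval (@cosS_cont R) (@cosS_ortho R)).
  rewrite -E -[- I2 0 _]mulN1r -(rintZ _ _ _ _ _ cBC) -(rintD _ _ _ _ cA2 cBC1).
  by apply: rint_eq => x y _ _; rewrite mulN1r.
have al_le : \sum_(n < N) al n ^+ 2 <= \sum_(n < N) be n ^+ 2.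
  apply: ler_sum => n _; rewrite /al expr_div_n ler_pdivrMr ?exprn_gt0//.
  by rewrite ler_peMr ?sqr_ge0// exprn_ege1// ler1n.
have beE : \sum_(n < N) be n * modecoef t n = pi ^+ 2 * \sum_(n < N) be n ^+ 2.
  rewrite mulr_sumr; apply: eq_bigr => n _.
  have p0 : pi ^+ 2 != 0 :> R by rewrite expf_neq0// gt_eqF// pi_gt0.
  by rewrite [in RHS]expr2 mulrA [pi ^+ 2 * _]mulrC {2}/be divfK// mulrC.
have -> : \sum_(n < N) modecoef t n ^+ 2 / pi ^+ 2 = \sum_(n < N) be n * modecoef t n.
  by apply: eq_bigr => n _; rewrite /be mulrAC expr2.
rewrite beE; move: al_le; move: (\sum_(n < N) al n ^+ 2) (\sum_(n < N) be n ^+ 2) => A B AB.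
have p2 : 0 < pi ^+ 2 :> R by rewrite exprn_gt0// pi_gt0.
have := ler_wpM2l (ltW p2) AB; rewrite expr2; lra.
Qed.

End Bessel.

Section Fejer.
Context {R : realType}.
Local Notation I2 c := (rint (- pi) pi c (pi : R)).

Definition dirichlet (n : nat) (x : R) : R := 1 + 2 * lincomb cosS (fun=> 1) n x.
(** [N] times the usual Fejer kernel; without the normalisation, multiplication by [1 - cos x]
    yields [1 - cos (N x)], bounded independently of [N]. *)
Definition fejer (N : nat) (x : R) : R := \sum_(k < N) dirichlet k x.

Lemma dirichletE n x : (1 - cos x) * dirichlet n x = cos (n%:R * x) - cos (n.+1%:R * x).
Proof.
elim: n => [|n IH].
  by rewrite /dirichlet /lincomb big_ord0 mulr0 addr0 mulr1 mul0r cos0 mul1r.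
have -> : dirichlet n.+1 x = dirichlet n x + 2 * cosS n x.
  by rewrite /dirichlet /lincomb big_ord_recr /=; ring.
rewrite mulrDr IH /cosS.
have -> : n.+2%:R * x = n.+1%:R * x + x by rewrite -natr1; ring.
have -> : n%:R * x = n.+1%:R * x - x by rewrite -natr1; ring.
by rewrite cosB cosD; ring.
Qed.

Lemma fejerE N x : (1 - cos x) * fejer N x = 1 - cos (N%:R * x).
Proof.
elim: N => [|N IH]; first by rewrite /fejer big_ord0 mulr0 mul0r cos0 subrr.
rewrite /fejer big_ord_recr /= -/(fejer N x) mulrDr IH dirichletE; ring.
Qed.

Lemma dirichlet_cont n : continuous (dirichlet n).
Proof.
apply: contD; first exact: contC.
by apply: contM; [exact: contC|apply: lincomb_cont; exact: cosS_cont].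
Qed.

Lemma fejer_cont N : continuous (fejer N).
Proof.
elim: N => [|N IH].
  rewrite (_ : fejer 0 = fun=> 0); first exact: contC.
  by apply/funext => x; rewrite /fejer big_ord0.
rewrite (_ : fejer N.+1 = fun x => fejer N x + dirichlet N x).
  by apply: contD => //; exact: dirichlet_cont.
by apply/funext => x; rewrite /fejer big_ord_recr.
Qed.

Variable F : @flow R.
Definition mean0 t := I2 0 (fun x y => den F t x y * sin y).

Lemma rint_dirichlet t n : I2 0 (fun x y => den F t x y * (dirichlet n x * sin y)) =
  mean0 t + 2 * \sum_(i < n) modecoef F t i.
Proof.
have c1 := cont3_at (t := t) (@den_cont _ F).
have cl := cont2_fun1 (lincomb_cont (e := cosS) (al := fun=> 1) (N := n) (@cosS_cont R)).
have cA : cont2 (fun x y => den F t x y * sin y) by c2.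
have cB : cont2 (fun x y => den F t x y * (lincomb cosS (fun=> 1) n x * sin y)) by c2.
have cB2 : cont2 (fun x y => 2 * (den F t x y * (lincomb cosS (fun=> 1) n x * sin y))) by c2.
have -> : \sum_(i < n) modecoef F t i = \sum_(i < n) 1 * modecoef F t i.
  by apply: eq_bigr => i _; rewrite mul1r.
rewrite -(rint_lincomb_cos (fun=> 1) n c1) /mean0 -(rintZ _ _ _ _ _ cB) -(rintD _ _ _ _ cA cB2).
by apply: rint_eq => x y _ _; rewrite /dirichlet; ring.
Qed.

Lemma rint_fejer t N : I2 0 (fun x y => den F t x y * (fejer N x * sin y)) =
  \sum_(k < N) (mean0 t + 2 * \sum_(i < k) modecoef F t i).
Proof.
have c1 := cont3_at (t := t) (@den_cont _ F).
elim: N => [|N IH].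
  rewrite big_ord0 -[RHS](mul0r ((pi - - pi) * (pi - 0))) -(rint_cst pi_lt I2_0pi).
  by apply: rint_eq => x y _ _; rewrite /fejer big_ord0 mul0r mulr0.
have cf := cont2_fun1 (@fejer_cont N); have cd := cont2_fun1 (@dirichlet_cont N).
have cA : cont2 (fun x y => den F t x y * (fejer N x * sin y)) by c2.
have cB : cont2 (fun x y => den F t x y * (dirichlet N x * sin y)) by c2.
have E := rintD (- pi) pi 0 pi cA cB; rewrite IH (rint_dirichlet t N) in E.
rewrite big_ord_recr /=; apply: etrans _ E; apply: rint_eq => x y _ _.
by rewrite /fejer big_ord_recr /= -/(fejer N x); ring.
Qed.

(** Since [rho * fejer N <= C (1 - cos (N x)) <= 2 C], the integral against the kernel is at most
    [2 C] times the area [2 pi^2] of Q. The same integral is a sum of [N] partial Fourier sums, each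
    at least [mean0 - 2 S], where [S] is the sum of the [|b_n|]. Division by [N] concludes. *)
Lemma mean0_le t C N : (0 < N)%N ->
  (forall x y, - pi <= x <= pi -> 0 <= y <= pi -> 0 <= den F t x y <= C * (1 - cos x)) ->
  mean0 t <= 2 * (\sum_(n < N) `|modecoef F t n|) + 4 * C * pi ^+ 2 / N%:R.
Proof.
move=> N0 HC.
have c1 := cont3_at (t := t) (@den_cont _ F).
have p0 := @pi_gt0 R.
have C0 : 0 <= C.
  have hx : - pi <= (pi : R) <= pi by rewrite lexx ltW// pi_lt.
  have hy : 0 <= (0 : R) <= pi by rewrite lexx ltW.
  by have /andP[h1 h2] := HC _ _ hx hy; have := le_trans h1 h2; rewrite cospi; lra.
have cf := cont2_fun1 (@fejer_cont N).
have le1 : I2 0 (fun x y => den F t x y * (fejer N x * sin y)) <= I2 0 (fun _ _ => 2 * C).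
  apply: le_rint; [by c2|by c2|].
  move=> x y hx hy; have /andP[d0 dC] := HC x y hx hy.
  have cx := cos_le1 x; have s0 : 0 <= sin y by apply: sin_ge0_pi.
  have s1 := sin_le1 y.
  have fE := fejerE N x.
  (* Where [cos x = 1], [fejerE] carries no information on the kernel, but the density vanishes
     there. Elsewhere [fejerE] shows that the kernel is nonnegative. *)
  have [cx1|cx1] := eqVneq (1 - cos x) 0.
    have -> : den F t x y = 0 by apply/eqP; rewrite eq_le d0 andbT; move: dC; rewrite cx1 mulr0.
    by rewrite mul0r mulr_ge0.
  have cx2 : 0 < 1 - cos x by rewrite lt_neqAle eq_sym cx1/= subr_ge0.
  have f0 : 0 <= fejer N x.
    by rewrite -(pmulr_rge0 _ cx2) fE subr_ge0 cos_le1.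
  apply: (@le_trans _ _ (C * (1 - cos x) * (fejer N x * sin y))).
    by rewrite ler_wpM2r// mulr_ge0.
  have -> : C * (1 - cos x) * (fejer N x * sin y) = C * ((1 - cos x) * fejer N x) * sin y by ring.
  rewrite fE; have := cos_geN1 (N%:R * x); set z := cos _ => z1.
  apply: (@le_trans _ _ (C * (1 - z))); last by rewrite mulrC ler_wpM2r//; lra.
  by rewrite ler_piMr// mulr_ge0// subr_ge0 cos_le1.
rewrite (rint_cst pi_lt I2_0pi) rint_fejer in le1.
set S := \sum_(n < N) `|modecoef F t n|.
have le2 : N%:R * (mean0 t - 2 * S) <= \sum_(k < N) (mean0 t + 2 * \sum_(i < k) modecoef F t i).
  have E : \sum_(k < N) (mean0 t - 2 * S) = N%:R * (mean0 t - 2 * S).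
    by rewrite sumr_const card_ord [RHS]mulr_natl.
  rewrite -E.
  apply: ler_sum => k _; rewrite lerD2l -mulrN ler_wpM2l// lerNl -sumrN.
  apply: (@le_trans _ _ (\sum_(i < k) `|modecoef F t i|)).
    by apply: ler_sum => i _; rewrite -normrN ler_norm.
  have kN : (k <= N)%N by apply: ltnW.
  rewrite /S -(big_mkord xpredT (fun i => `|modecoef F t i|)) -(big_mkord xpredT (fun i => `|modecoef F t i|)).
  by rewrite [leRHS](big_cat_nat (leq0n k) kN)/= lerDl sumr_ge0.
have N1 : 0 < N%:R :> R by rewrite ltr0n.
rewrite -lerBlDl ler_pdivlMr// mulrC.
apply: le_trans le2 (le_trans le1 _).
by rewrite expr2; lra.
Qed.

End Fejer.

(** * Lower bounds for the mean, and interpolation *)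

Section QuadraticBounds.
Context {R : realType}.
Local Notation mu := (@lebesgue_measure R).
Local Notation I2 c := (rint (- pi) pi c (pi : R)).

(** On [[0, 1/2]] one has [sin z >= c z] with [c = cos (1/2)], and integration gives
    [1 - cos x >= (c / 2) x^2]. On [[1/2, pi]] monotonicity gives [1 - cos x >= c / 8]. The constant
    [c / (8 pi^2)] lies below both bounds because [x <= pi]. *)
Lemma quad_cos : exists k : R, 0 < k /\ forall x : R, - pi <= x <= pi -> k * x ^+ 2 <= 1 - cos x.
Proof.
have p0 := @pi_gt0 R; have p1 := @pihalf_ge1 R.
pose c := cos (2^-1 : R).
have c0 : 0 < c by apply: cos_gt0_pihalf; apply/andP; split; lra.
have small x : 0 <= x <= 2^-1 -> c / 2 * x ^+ 2 <= 1 - cos x.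
  move=> /andP[x0 x1].
  have s_ge z : 0 <= z <= 2^-1 -> c * z <= sin z.
    move=> /andP[z0 z1]; have [w] := @MVT_segment R sin cos 0 z z0 (fun w _ => is_derive_sin w)
      (continuous_subspaceT (@continuous_sin R)).
    rewrite in_itv/= sin0 !subr0 => /andP[w0 wz] ->; rewrite ler_wpM2r//.
    rewrite /c; have [->|wz2] := eqVneq w 2^-1; first exact: lexx.
    have wi : w \in `[0, pi] by rewrite in_itv/=; apply/andP; split; lra.
    have hi : 2^-1 \in `[0, pi : R] by rewrite in_itv/=; apply/andP; split; lra.
    by apply: ltW; rewrite (ltr_cos wi hi) lt_neqAle wz2 (le_trans wz).
  have dd (z : R) : is_derive z 1 (fun z => 1 - cos z - c / 2 * z ^+ 2) (sin z - c * z).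
    have d1' := drvB (drv_cst z 1) (drv_cos (drv_id z)).
    have d2' := drvM (drv_cst z (c / 2)) (drvM (drv_id z) (drv_id z)).
    by apply: (drv_eq (drvB d1' d2')); field.
  have [w] := @MVT_segment R _ _ 0 x x0 (fun w _ => dd w)
    (continuous_subspaceT (drv_continuous dd)).
  rewrite in_itv/= cos0 => /andP[w0 wx] h.
  have : 0 <= (sin w - c * w) * (x - 0).
    by rewrite mulr_ge0 ?subr_ge0// s_ge// w0/= (le_trans wx).
  rewrite -h expr0n/=; lra.
have pp : 0 < pi ^+ 2 :> R by rewrite exprn_gt0.
exists (c / (8 * pi ^+ 2)); split; first by rewrite divr_gt0// mulr_gt0.
have alg (a P X : R) : P != 0 -> a / (8 * P) * X = a / 8 * (X / P) by move=> P0; field.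
have kle x : 0 <= x <= pi -> c / (8 * pi ^+ 2) * x ^+ 2 <= c / 8 /\
    c / (8 * pi ^+ 2) * x ^+ 2 <= c / 2 * x ^+ 2.
  move=> /andP[x0 xp].
  have -> : c / (8 * pi ^+ 2) * x ^+ 2 = c / 8 * (x ^+ 2 / pi ^+ 2).
    exact/alg/lt0r_neq0.
  have xp2 : x ^+ 2 <= pi ^+ 2 by rewrite ler_sqr ?nnegrE// ltW.
  split; first by rewrite ler_piMr ?ler_pdivrMr ?mul1r//; lra.
  have : x ^+ 2 / pi ^+ 2 <= x ^+ 2.
    by rewrite ler_pdivrMr// ler_peMr ?sqr_ge0// exprn_ege1//; lra.
  by have := sqr_ge0 x; nra.
have pos x : 0 <= x <= pi -> c / (8 * pi ^+ 2) * x ^+ 2 <= 1 - cos x.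
  move=> hx; have [k1 k2] := kle x hx; move: hx => /andP[x0 xp].
  have [xs|xs] := lerP x 2^-1.
    by apply: le_trans k2 _; apply: small; rewrite x0.
  apply: le_trans k1 _; have h : c / 2 * (2^-1) ^+ 2 <= 1 - cos (2^-1 : R).
    by apply: small; apply/andP; split; lra.
  have h2 : cos x < cos (2^-1 : R).
    have xi : x \in `[0, pi] by rewrite in_itv/= x0.
    have hi : 2^-1 \in `[0, pi : R] by rewrite in_itv/=; apply/andP; split; lra.
    by rewrite (ltr_cos hi xi).
  rewrite expr2 in h; lra.
move=> x /andP[x1 x2]; have [x0|x0] := lerP 0 x; first by apply: pos; rewrite x0.
by have := pos (- x); rewrite (sqrrN x) cosN; apply; apply/andP; split; lra.
Qed.

(** [2 (sin y)^2 = 1 - cos (2 y) >= 4 k y^2] by [quad_cos], whence the constant [sqrt (2 k)]. *)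
Lemma jordan_sin : exists j : R, 0 < j /\ forall y : R, 0 <= y <= pi / 2 -> j * y <= sin y.
Proof.
have [k [k0 Hk]] := quad_cos; have p0 := @pi_gt0 R.
exists (Num.sqrt (2 * k)); split; first by rewrite sqrtr_gt0; lra.
move=> y /andP[y0 y1].
have s0 : 0 <= sin y by apply: sin_ge0_pi; apply/andP; split; lra.
rewrite -ler_sqr ?nnegrE// ?mulr_ge0 ?sqrtr_ge0// exprMn sqr_sqrtr; last by lra.
have /Hk : - pi <= 2 * y <= pi by apply/andP; split; lra.
have -> : 2 * y = y + y by ring.
rewrite cosD -!expr2; have := cos2Dsin2 y; lra.
Qed.

(* 1 <= (K/j) sin y + exp(-K y) + exp(-K (pi - y)) on [0, pi]; for K large the
   last two terms carry at most half of the mass. *)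
Lemma mean_lower (m M : R) : 0 < m -> 0 <= M -> exists c : R, 0 < c /\
  forall f : R -> R -> R, cont2 f ->
    (forall x y, - pi <= x <= pi -> 0 <= y <= pi -> 0 <= f x y <= M) ->
    I2 0 f = m -> c <= I2 0 (fun x y => f x y * sin y).
Proof.
move=> m0 M0; have [j [j0 Hj]] := jordan_sin; have p0 := @pi_gt0 R.
(* The exponentials integrate to at most [2 / K] in [y], so they carry at most [4 pi M / K <= m / 2]
   of the mass. The summand 1 keeps [K] positive when [M = 0]. *)
pose K := 8 * pi * M / m + 1.
have K0 : 0 < K.
  have : 0 <= 8 * pi * M / m.
    by apply: divr_ge0; [apply: mulr_ge0 => //; apply: mulr_ge0 => //|]; exact: ltW.
  by rewrite /K; lra.
exists (m / 2 * (j / K)); split; first by apply: mulr_gt0; apply: divr_gt0.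
move=> f cf Hf If.
pose h (y : R) := expR (- K * y) + expR (- K * (pi - y)).
pose H (y : R) := K^-1 * (- expR (- K * y) + expR (- K * (pi - y))).
have dE1 (y : R) : is_derive y 1 (fun y => expR (- K * y)) (- K * expR (- K * y)).
  by have := is_derive1_comp (is_derive_expR (- K * y)) (drv_lin (- K) y); rewrite mulrC.
have dE2 (y : R) : is_derive y 1 (fun y => expR (- K * (pi - y))) (K * expR (- K * (pi - y))).
  have dl : is_derive y 1 (fun y => - K * (pi - y)) K.
    by apply: (drv_eq (drvM (drv_cst y (- K)) (drvB (drv_cst y pi) (drv_id y)))); ring.
  by have := is_derive1_comp (g := fun y : R => - K * (pi - y)) (is_derive_expR (- K * (pi - y))) dl; rewrite mulrC.
have dH (y : R) : is_derive y 1 H (h y).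
  apply: (drv_eq (drvM (drv_cst y K^-1) (drvD (drvN (dE1 y)) (dE2 y)))).
  by rewrite /h; field; rewrite gt_eqF.
have ch : continuous h by exact: (contD (drv_continuous dE1) (drv_continuous dE2)).
have Ih : \int[mu]_(y in `[0, pi]) h y <= 2 / K.
  rewrite (FTC_Rintegral (ltW p0) ch dH) /H subrr subr0 mulr0 expR0.
  have e1 := expR_gt0 (- K * pi).
  rewrite -mulrBr mulrC ler_pM2r ?invr_gt0//; lra.
have h1 y : 0 <= y <= pi -> 1 <= K / j * sin y + h y.
  move=> /andP[y0 yp].
  have key z : 0 <= z <= pi / 2 -> 1 <= K / j * sin z + expR (- K * z).
    move=> hz; have := Hj z hz; have := expR_ge1Dx (- K * z).
    rewrite -subr_ge0 => e1 s1.
    have : K / j * (j * z) <= K / j * sin z by rewrite ler_wpM2l// divr_ge0// ltW.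
    have -> : K / j * (j * z) = K * z by field; rewrite gt_eqF.
    by move: e1; lra.
  have e1 := expR_gt0 (- K * y); have e2 := expR_gt0 (- K * (pi - y)).
  rewrite /h; have [y2|y2] := lerP y (pi / 2).
    by have := key y; rewrite y0 y2 => /(_ isT); lra.
  have := key (pi - y); have -> : sin (pi - y) = sin y.
    by rewrite sinB sinpi cospi mul0r sub0r mulN1r opprK.
  have hh : 0 <= pi - y <= pi / 2 by apply/andP; split; lra.
  by move=> /(_ hh); lra.
have chh : cont2 (fun _ y : R => h y) by exact: (cont2_fun ch cont2_proj2).
have cs : cont2 (fun x y => f x y * sin y) by c2.
have cs2 : cont2 (fun x y => K / j * (f x y * sin y)) by c2.
have cM : cont2 (fun x y => M * (1 * h y)) by c2.
have le1 : m <= K / j * I2 0 (fun x y => f x y * sin y) + M * (2 * pi * (2 / K)).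
  rewrite -If; apply: (@le_trans _ _ (I2 0 (fun x y => K / j * (f x y * sin y) + M * (1 * h y)))).
    apply: le_rint; [by []|by c2|].
    move=> x y hx hy; have /andP[f0 fM] := Hf x y hx hy; have := h1 y hy => hh.
    have hy0 : 0 <= h y by rewrite addr_ge0// ltW// expR_gt0.
    have := ler_wpM2l f0 hh; have := ler_wpM2r hy0 fM; rewrite mul1r; lra.
  rewrite (rintD _ _ _ _ cs2 cM) (rintZ _ _ _ _ _ cs) lerD2l.
  have c1h : cont2 (fun _ y : R => 1 * h y) by c2.
  rewrite (rintZ _ _ _ _ _ c1h) (rint_prod _ _ _ _ (f := fun=> 1) (g := h))//; last exact: contC.
  rewrite (Rintegral_cst_itv _ (ltW pi_lt)) mul1r ler_wpM2l//.
  by have := ler_wpM2l (ltW p0) Ih; lra.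
have le2 : M * (2 * pi * (2 / K)) <= m / 2.
  have -> : M * (2 * pi * (2 / K)) = (4 * pi * M) / K by field; rewrite gt_eqF.
  have E : m / 2 * K = 4 * pi * M + m / 2 by rewrite /K; field; rewrite gt_eqF.
  by rewrite ler_pdivrMr// E; lra.
have : m / 2 <= K / j * I2 0 (fun x y => f x y * sin y) by lra.
move: (I2 0 _) => J hJ.
have -> : J = (K / j * J) * (j / K) by field; rewrite !gt_eqF.
by rewrite ler_wpM2r// divr_ge0// ltW.
Qed.

End QuadraticBounds.

Section Interpolation.
Context {R : realType}.

(** A telescoping integral test: by the mean value theorem each term is at most a difference of
    values of [x^-a / a] at consecutive points. *)
Lemma powR_tail (a k : R) (N : nat) : 0 < a -> 0 < k ->
  \sum_(n < N) (k + n.+1%:R) `^ (- (1 + a)) <= k `^ (- a) / a.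
Proof.
move=> a0 k0.
have step (x : R) : 0 < x -> a * (x + 1) `^ (- (1 + a)) <= x `^ (- a) - (x + 1) `^ (- a).
  move=> x0; have xx : x < x + 1 by lra.
  have dd z : z \in `]x, (x + 1)[ -> is_derive z 1 (fun z => z `^ (- a)) (- a * z `^ (- a - 1)).
    by rewrite in_itv/= => /andP[xz _]; apply: is_derive1_powR; exact: lt_trans xz.
  have cc : {within `[x, x + 1], continuous (fun z : R => z `^ (- a))}.
    apply: derivable_within_continuous => z; rewrite in_itv/= => /andP[xz _].
    have z0 : 0 < z by exact: lt_le_trans xz.
    by case: (is_derive1_powR (- a) z0).
  have [c] := MVT xx dd cc; rewrite in_itv/= => /andP[xc cx] h.
  have -> : x `^ (- a) - (x + 1) `^ (- a) = a * c `^ (- a - 1).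
    by rewrite -opprB h; ring.
  apply: (ler_wpM2l (ltW a0)); have -> : - (1 + a) = - (a + 1) by ring.
  have -> : - a - 1 = - (a + 1) by ring.
  have c0 : 0 < c by exact: lt_trans xc.
  rewrite !powRN lef_pV2 ?posrE ?powR_gt0//; last by lra.
  by rewrite ge0_ler_powR ?nnegrE ?ltW//; lra.
suff : a * (\sum_(n < N) (k + n.+1%:R) `^ (- (1 + a))) <= k `^ (- a) - (k + N%:R) `^ (- a).
  move=> h; rewrite ler_pdivlMr// mulrC; apply: le_trans h _.
  by rewrite lerBlDr lerDl powR_ge0.
elim: N => [|N IH]; first by rewrite big_ord0 mulr0 addr0 subrr.
rewrite big_ord_recr /= mulrDr.
have kN : 0 < k + N%:R by rewrite ltr_pwDl// ler0n.
have := step _ kN; have -> : k + N%:R + 1 = k + N.+1%:R by rewrite -natr1 addrA.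
move: IH; lra.
Qed.

Lemma powR_add_le (p x y : R) : 0 <= p -> 0 < x -> 0 < y ->
  (x + y) `^ p <= 2 `^ p * (x `^ p + y `^ p).
Proof.
move=> p0 x0 y0; wlog xy : x y x0 y0 / x <= y.
  move=> W; have [|/ltW] := lerP x y; first exact: W.
  by move=> yx; rewrite addrC [X in _ * X]addrC; exact: W.
apply: (@le_trans _ _ ((2 * y) `^ p)).
  by apply: ge0_ler_powR => //; rewrite ?nnegrE; lra.
rewrite powRM; [|by []|exact: ltW]; apply: ler_wpM2l; first exact: powR_ge0.
by rewrite lerDr powR_ge0.
Qed.

(* Weighted AM-GM on each |b_n| with weight (k + n)^(1+a); the shift k makes the
   tail sum of size k^-a and is then optimised. *)
Lemma interpolation (a c0 : R) : 0 < a -> 0 < c0 -> exists th : R, 0 < th /\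
  forall (b : nat -> R) (A B E : R), 0 < B -> 0 <= E ->
    (forall N, \sum_(n < N) b n ^+ 2 <= A) ->
    (forall N, \sum_(n < N) n.+1%:R `^ (1 + a) * b n ^+ 2 <= B) ->
    (forall N, (0 < N)%N -> c0 <= 2 * (\sum_(n < N) `|b n|) + E / N%:R) ->
    th * B `^ (- a^-1) <= A.
Proof.
move=> a0 c00; pose P : R := 2 `^ (1 + a); have P0 : 0 < P by rewrite powR_gt0.
(* [q] and, below, [nu] are chosen so that the tail term and the term with [B] equal [c0 / 4] each.
   The term with [A] must then be at least [c0 / 2]. *)
pose q := 16 * P / (a * c0 ^+ 2).
have q0 : 0 < q.
  by apply: divr_gt0; [exact: mulr_gt0|apply: mulr_gt0 => //; exact: exprn_gt0].
exists (2 / q * q `^ (- a^-1)); split; first by apply: mulr_gt0; [exact: divr_gt0|exact: powR_gt0].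
move=> b A B E B0 E0 HA HB Hc.
pose k := (q * B) `^ a^-1.
have qB : 0 < q * B by rewrite mulr_gt0.
have k0 : 0 < k by rewrite powR_gt0.
have ka : k `^ a = q * B by rewrite /k -powRrM mulVf ?gt_eqF//; apply: powRr1; exact: ltW.
have kNa : k `^ (- a) = (q * B)^-1 by rewrite powRN ka.
have k1a : k `^ (1 + a) = k * (q * B).
  have hk : (1 + a == 0) ==> (k != 0) by rewrite (gt_eqF k0) implybT.
  by rewrite (powRD hk) ka powRr1//; exact: ltW.
pose nu := c0 / (4 * P * B).
have nu0 : 0 < nu by apply: divr_gt0 => //; apply: mulr_gt0 => //; exact: mulr_gt0.
have H N : 2 * (\sum_(n < N) `|b n|) <= nu * (P * (k `^ (1 + a) * A + B)) + nu^-1 * (k `^ (- a) / a).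
  have t1 (n : nat) : 2 * `|b n| <= nu * ((k + n.+1%:R) `^ (1 + a) * b n ^+ 2) + nu^-1 * (k + n.+1%:R) `^ (- (1 + a)).
    have w0 : 0 < (k + n.+1%:R) `^ (1 + a) by rewrite powR_gt0// addr_gt0.
    rewrite powRN; move: ((k + n.+1%:R) `^ (1 + a)) w0 => w w0.
    rewrite mulrA -invfM -(real_normK (num_real (b n))).
    have u0 : 0 < nu * w by rewrite mulr_gt0.
    move: (nu * w) u0 (`|b n|) => u u0 z.
    rewrite -subr_ge0 (_ : _ - _ = (u * z - 1) ^+ 2 / u); last by field; rewrite gt_eqF.
    by rewrite divr_ge0 ?sqr_ge0// ltW.
  rewrite mulr_sumr.
  apply: (@le_trans _ _ (\sum_(n < N) (nu * ((k + n.+1%:R) `^ (1 + a) * b n ^+ 2) + nu^-1 * (k + n.+1%:R) `^ (- (1 + a))))).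
    by apply: ler_sum => n _; exact: t1.
  rewrite big_split /= -!mulr_sumr; apply: lerD; last first.
    by apply: ler_wpM2l; [rewrite invr_ge0 ltW|exact: powR_tail].
  apply: (ler_wpM2l (ltW nu0)).
  apply: (@le_trans _ _ (\sum_(n < N) P * (k `^ (1 + a) * b n ^+ 2 + n.+1%:R `^ (1 + a) * b n ^+ 2))).
    apply: ler_sum => n _; rewrite -mulrDl mulrA ler_wpM2r ?sqr_ge0//.
    by apply: powR_add_le => //; lra.
  rewrite -mulr_sumr; apply: (ler_wpM2l (ltW P0)); rewrite big_split /= -mulr_sumr; apply: lerD; last exact: HB.
  by apply: ler_wpM2l; [exact: powR_ge0|exact: HA].
(* Letting [N] tend to infinity removes [E / N], so that [th] is independent of [E]. *)
have main : c0 <= nu * (P * (k `^ (1 + a) * A + B)) + nu^-1 * (k `^ (- a) / a).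
  apply/ler_addgt0Pr => e e0.
  pose N := (Num.truncn (E / e)).+1.
  have N0 : 0 < N%:R :> R by rewrite ltr0n.
  have EN : E / N%:R <= e.
    rewrite ler_pdivrMr// mulrC -ler_pdivrMr//; apply: ltW.
    exact: truncnS_gt.
  by apply: le_trans (Hc N _) _ => //; apply: lerD => //; exact: H.
have e1 : nu * (P * B) = c0 / 4 by rewrite /nu; field; rewrite !gt_eqF.
have e2 : nu^-1 * (k `^ (- a) / a) = c0 / 4.
  by rewrite kNa /nu /q; field; rewrite !gt_eqF.
have e3 : nu * (P * (k `^ (1 + a) * A)) = c0 / 4 * (k * q) * A.
  by rewrite k1a /nu; field; rewrite !gt_eqF.
have e4 : c0 / 2 <= c0 / 4 * (k * q) * A.
  by rewrite -e3; move: main; rewrite !mulrDr e1 e2; lra.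
have e5 : 2 / (k * q) <= A.
  rewrite ler_pdivrMr; last exact: mulr_gt0.
  have c4 : 0 < c0 / 4 by exact: divr_gt0.
  by rewrite -(ler_pM2l c4); move: e4; lra.
have -> : 2 / q * q `^ (- a^-1) * B `^ (- a^-1) = 2 / (k * q); last exact: e5.
rewrite -mulrA -powRM; [|exact: ltW|exact: ltW]; rewrite powRN -/k.
by field; rewrite !gt_eqF.
Qed.

End Interpolation.

(** * Sobolev norms *)

Section SobolevLower.
Context {R : realType}.
Local Notation mu := (@lebesgue_measure R).
Local Notation I2 c := (rint (- pi) pi c (pi : R)).

Lemma Rintegral_symm (g : R -> R) (c : R) : 0 <= c -> continuous g ->
  \int[mu]_(y in `[- c, c]) g y = \int[mu]_(y in `[0, c]) (g y + g (- y)).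
Proof.
move=> c0 cg; have ii a b : mu.-integrable `[a, b] (EFin \o g) by exact: continuous_itv_integrable.
have cgN : continuous (fun y => g (- y)).
  by move=> y; apply: (continuous_comp (f := fun y => - y)); [exact: opp_continuous|exact: cg].
rewrite RintegralD//; [|exact: continuous_itv_integrable..].
have E : \int[mu]_(y in `[0, c]) g (- y) = \int[mu]_(y in `[- c, 0]) g y.
  rewrite -{1}oppr0 /Rintegral; congr fine.
  have := @integration_by_substitution_oppr R g 0 c c0; rewrite oppr0 => ->//.
  exact: continuous_subspaceT.
rewrite E -(@Rintegral_itv_obnd_cbnd R 0 (BRight c)); last first.
  apply: (@integrableS _ _ _ mu `[0, c]) => //.
  by move=> y /=; rewrite !in_itv/= => /andP[/ltW -> ->].
rewrite -(@Rintegral_itvB R g (BLeft (- c)) (BRight c) 0) ?subrK// bnd_simp; lra.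
Qed.

Lemma rint_symm2 (f : R -> R -> R) : cont2 f ->
  I2 (- pi) f = I2 0 (fun x y => f x y + f x (- y)).
Proof.
move=> cf; rewrite /rint.
rewrite (Rintegral_symm (pi_ge0 R) (continuous_Rintegral_param (a := - pi) (b := pi) cf)).
apply: eq_Rintegral => y _; rewrite RintegralD//; apply: continuous_itv_integrable.
  exact: (cont2_x1 cf).
exact: (cont2_x1 (y := - y) cf).
Qed.

Lemma rint_odd1 (f : R -> R -> R) (c : R) : cont2 f -> (forall x y, f (- x) y = - f x y) ->
  c < pi -> I2 c f = 0.
Proof.
move=> cf fo cp; transitivity (I2 c (fun _ _ => 0)); last by rewrite (rint_cst pi_lt cp) mul0r.
apply: eq_Rintegral => y _.
rewrite (Rintegral_symm (pi_ge0 R) (cont2_x1 (y := y) cf)).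
rewrite [RHS](Rintegral_cst_itv _ (ltW pi_lt)) mul0r.
transitivity (\int[mu]_(x in `[0, pi]) (0 : R)).
  by apply: eq_Rintegral => x _; rewrite fo subrr.
by rewrite (Rintegral_cst_itv _ (pi_ge0 R)) mul0r.
Qed.

Definition mode (n : nat) : int * int := (n.+1%:Z, 1).

Lemma phase_coef_dx1 (f : R -> R -> R) phi k : smooth_torus f ->
  phase_coef (dx1 f) phi k = k.1%:~R * I2 (- pi) (fun x y => sin (phase k phi x y) * f x y).
Proof.
move=> sf; have sf1 := smooth_dx1 sf.
have cf := smooth_cont2 sf; have cf1 := smooth_cont2 sf1; have cp := @cont2_phase R k phi.
have cpf : cont2 (fun x y => sin (phase k phi x y) * f x y) by c2.
rewrite /phase_coef -(rintZ _ _ _ _ _ cpf).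
apply: (rint_eq_div pi_lt pi_lt
  (F1 := fun x1 x2 => f x1 x2 * cos (phase k phi x1 x2))
  (G1 := fun x1 x2 => dx1 f x1 x2 * cos (phase k phi x1 x2) +
                      f x1 x2 * - (k.1%:~R * sin (phase k phi x1 x2)))
  (F2 := fun _ _ => 0) (G2 := fun _ _ => 0)); try by c2.
- move=> x y; exact: drvM (smooth_drv1 x y sf) (drv_cos (drv_phase1 k phi x y)).
- by move=> y; have [-> _] := phase_pi1 k phi y; rewrite (periodic2_pi1 _ sf.1).
- by move=> x y _ _; ring.
Qed.

(** After an integration by parts the coefficient is an integral against [sin ((n + 1) x + y)].
    Evenness in [x] kills the product of [sin] in [x] with [cos] in [y]; oddness in [y] reduces the
    other product to twice its integral over Q. *)
Lemma fourier_mode (f : R -> R -> R) n : smooth_torus f ->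
  (forall x y, f (- x) y = f x y) -> (forall x y, f x (- y) = - f x y) ->
  complex.Re (fourier (dx1 f) (mode n)) =
  ((2 * pi) ^+ 2)^-1 * (n.+1%:R * (2 * I2 0 (fun x y => f x y * (cosS n x * sin y)))).
Proof.
move=> sf fe fo; rewrite (fourierE _ (smooth_cont2 (smooth_dx1 sf))) /=; congr (_ * _).
rewrite phase_coef_dx1//=; congr (_ * _).
have cf := smooth_cont2 sf; have cS := cont2_fun1 (@sinS_cont R n); have cC := cont2_fun1 (@cosS_cont R n).
have cA : cont2 (fun x y => f x y * (cosS n x * sin y)) by c2.
have cA2 : cont2 (fun x y => 2 * (f x y * (cosS n x * sin y))) by c2.
have cB : cont2 (fun x y => sinS n x * (f x y * cos y)) by c2.
transitivity (I2 (- pi) (fun x y => f x y * (cosS n x * sin y) + sinS n x * (f x y * cos y))).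
  apply: rint_eq => x y _ _; rewrite /phase /dot /mode /= addr0 mul1r sinD /cosS /sinS -pmulrn; ring.
rewrite (rintD _ _ _ _ cA cB) (rint_odd1 cB _ pi_lt) ?addr0; last first.
  by move=> x y; rewrite /sinS fe mulrN sinN mulNr.
rewrite (rint_symm2 cA) -(rintZ _ _ _ _ _ cA); apply: rint_eq => x y _ _.
by rewrite fo sinN; ring.
Qed.

(** From [n + 1 <= |k| <= 2 (n + 1)]. For [s < 0] the power reverses the order, so the upper bound
    is the relevant one and leaves the factor [2^(2 s)]. *)
Lemma kabs_mode_ge s : exists cs : R, 0 < cs /\
  forall n, cs * n.+1%:R `^ (2 * s) <= kabs R (mode n) `^ (2 * s).
Proof.
have kE n : n.+1%:R <= kabs R (mode n) <= 2 * n.+1%:R.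
  have n1 : 1 <= n.+1%:R :> R by rewrite ler1n.
  rewrite /kabs /= -pmulrn expr1n.
  have h0 : 0 <= n.+1%:R ^+ 2 + 1 :> R by rewrite addr_ge0 ?sqr_ge0.
  apply/andP; split.
    by rewrite -ler_sqr ?nnegrE ?sqrtr_ge0// sqr_sqrtr// lerDl.
  rewrite -ler_sqr ?nnegrE ?sqrtr_ge0 ?mulr_ge0// sqr_sqrtr//; nra.
have n0 n : 0 < n.+1%:R :> R by rewrite ltr0n.
have [s0|s0] := lerP 0 s.
  exists 1; split => // n; rewrite mul1r; case/andP: (kE n) => h _.
  by apply: ge0_ler_powR => //; rewrite ?nnegrE ?mulr_ge0 ?sqrtr_ge0.
exists (2 `^ (2 * s)); split; first by rewrite powR_gt0.
move=> n; case/andP: (kE n) => h1 h2.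
have -> : 2 * s = - (- (2 * s)) by rewrite opprK.
have k0 : 0 < kabs R (mode n) by exact: lt_le_trans h1.
rewrite -powRM; [|by []|exact: ltW]; rewrite ![_ `^ (- - _)]powRN lef_pV2 ?posrE ?powR_gt0 ?mulr_gt0//.
by apply: ge0_ler_powR => //; rewrite ?nnegrE ?mulr_ge0 ?sqrtr_ge0//; lra.
Qed.

Lemma sobolev_sqnorm_ge s (f : R -> R -> R) N :
  (((2 * pi) ^+ 2 * \sum_(n < N) kabs R (mode n) `^ (2 * s) *
      complex.Re (fourier f (mode n)) ^+ 2)%:E <= sobolev_sqnorm s f)%E.
Proof.
rewrite /sobolev_sqnorm EFinM lee_wpmul2l//; first by rewrite lee_fin sqr_ge0.
have minj : set_inj `I_N mode by move=> n m _ _ [].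
apply: (@le_trans _ _ (\sum_(k \in mode @` `I_N)
   (kabs R k `^ (2 * s) * ComplexField.Normc.normc (fourier f k) ^+ 2)%:E)%E).
  rewrite fsbig_image// -fsbig_ord -sumEFin; apply: lee_sum => n _; rewrite lee_fin.
  rewrite ler_wpM2l ?powR_ge0//.
  case: (fourier f (mode n)) => u v /=; rewrite sqr_sqrtr ?addr_ge0 ?sqr_ge0//.
  by rewrite lerDl sqr_ge0.
apply: esum_ge; exists (mode @` `I_N) => //; split.
  by apply: finite_image; exact: finite_II.
by move=> _ [n _ <-].
Qed.

End SobolevLower.

Section Weight.
Context {R : realType}.

(* No measurability is assumed: that of t |-> sobolev_weight s (dx1 (rho t)) is not available. *)
Lemma ge0_le_integral_any d (T : measurableType d) (m : {measure set T -> \bar R})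
    (D : set T) (f g : T -> \bar R) :
  (forall x, D x -> (0 <= f x)%E) -> (forall x, D x -> (f x <= g x)%E) ->
  (\int[m]_(x in D) f x <= \int[m]_(x in D) g x)%E.
Proof.
move=> f0 fg; have g0 x : D x -> (0 <= g x)%E by move=> Dx; exact: le_trans (f0 x Dx) (fg x Dx).
rewrite !ge0_integralE//; apply: ge_ereal_sup => _ [h hf <-].
apply: ereal_sup_ubound; exists h => // x; apply: le_trans (hf x) _.
exact: lee_restrict.
Qed.

Lemma sobolev_weight_fin s (f : R -> R -> R) (x : R) : - 2^-1 < s -> 0 < x ->
  sobolev_sqnorm s f = x%:E -> sobolev_weight s f = (x `^ (- (2 * s + 1)^-1))%:E.
Proof.
move=> hs x0 E; rewrite /sobolev_weight /sobolev_norm E !poweR_EFin inver.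
rewrite gt_eqF ?powR_gt0 ?powR_gt0// -powRrM powRN.
by congr (_ `^ _)^-1%:E; field; rewrite gt_eqF//; lra.
Qed.

Lemma sobolev_weight_pinfty s (f : R -> R -> R) : - 2^-1 < s ->
  sobolev_sqnorm s f = +oo%E -> sobolev_weight s f = 0%E.
Proof.
move=> hs E; rewrite /sobolev_weight /sobolev_norm E.
have a0 : 0 < 2 / (2 * s + 1) by rewrite divr_gt0//; lra.
by rewrite !poweRyr ?gt_eqF.
Qed.

Lemma sobolev_weight_ge0 s (f : R -> R -> R) : (0 <= sobolev_weight s f)%E.
Proof. by rewrite /sobolev_weight inve_ge0 poweR_ge0. Qed.

Lemma sobolev_sqnorm_ge0 s (f : R -> R -> R) : (0 <= sobolev_sqnorm s f)%E.
Proof.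
apply: mule_ge0; first by rewrite lee_fin sqr_ge0.
by apply: esum_ge0 => k _; rewrite lee_fin mulr_ge0 ?powR_ge0 ?sqr_ge0.
Qed.

Variable F : @flow R.
Hypothesis odd0 : forall x y, den F 0 x (- y) = - den F 0 x y.
Hypothesis even0 : forall x y, den F 0 (- x) y = den F 0 x y.
Hypothesis axis0 : forall y, den F 0 0 y = 0.
Hypothesis nonneg0 : forall x y, 0 <= x <= pi -> 0 <= y <= pi -> 0 <= den F 0 x y.

(** On the axis the density attains its minimum zero in [x1], so its first derivative vanishes
    there, and Taylor's formula gives [M x^2] with [M] a bound of the second derivative at time [t];
    [quad_cos] turns [x^2] into [1 - cos x]. *)
Lemma den_quadratic t : 0 <= t -> smooth_torus (den F t) ->
  exists C, forall x y, - pi <= x <= pi -> 0 <= y <= pi -> 0 <= den F t x y <= C * (1 - cos x).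
Proof.
move=> t0 st; have [k [k0 Hk]] := @quad_cos R.
have sf11 := smooth_dx1 (smooth_dx1 st).
have [M [M0 HM]] := cont2_bounded (- pi) pi (- pi) pi (smooth_cont2 sf11).
have HM' x y : `|dx1 (dx1 (den F t)) x y| <= M.
  have pf : periodic2 (dx1 (dx1 (den F t))) by case: sf11.
  exact: (periodic2_ind (P := fun z => `|z| <= M) pf HM).
exists (M / k) => x y hx hy; rewrite (den_ge0 odd0 even0 axis0 nonneg0)//=.
have d0 : dx1 (den F t) 0 y = 0.
  apply/eqP; rewrite -oppr_eq0; apply/eqP.
  apply: (drv_global_max (f := fun z => - den F t z y) (df := fun z => - dx1 (den F t) z y)).
    by move=> z; exact: drvN (smooth_drv1 z y st).
  move=> z _; rewrite (den_axis even0 axis0)// oppr0 oppr_le0.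
  exact: (den_ge0 odd0 even0 axis0 nonneg0).
have d1 z := smooth_drv1 z y st.
have d2 z := smooth_drv1 z y (smooth_dx1 st).
have HM'' z := HM' z y.
have := taylor_MVT 0 x d1 d2 HM''.
rewrite add0r (den_axis even0 axis0)// d0 mulr0 !subr0 ler_norml => /andP[_ h].
apply: le_trans h _; have -> : M * x ^+ 2 = M / k * (k * x ^+ 2) by field; rewrite gt_eqF.
by apply: ler_wpM2l; [rewrite divr_ge0// ltW|exact: Hk].
Qed.

End Weight.

(** * The weight is dominated by the dissipation *)

Section Main.
Context {R : realType}.
Local Notation I2 c := (rint (- pi) pi c (pi : R)).
Variable rho0 : R -> R -> R.
Hypothesis rho0_smooth : smooth_torus rho0.
Hypothesis rho0_nonzero : exists x1 x2, rho0 x1 x2 <> 0.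
Hypothesis rho0_odd_x2 : forall x1 x2, rho0 x1 (- x2) = - rho0 x1 x2.
Hypothesis rho0_even_x1 : forall x1 x2, rho0 (- x1) x2 = rho0 x1 x2.
Hypothesis rho0_axis : forall x2, rho0 0 x2 = 0.
Hypothesis rho0_nonneg : forall x1 x2, 0 <= x1 <= pi -> 0 <= x2 <= pi -> 0 <= rho0 x1 x2.

Let rho0_ge0 x y : - pi <= x <= pi -> 0 <= y <= pi -> 0 <= rho0 x y.
Proof.
move=> /andP[x1 x2] hy; have [x0|/ltW x0] := lerP 0 x.
  by apply: rho0_nonneg => //; rewrite x0.
by rewrite -rho0_even_x1; apply: rho0_nonneg => //; apply/andP; split; lra.
Qed.

Lemma mass_gt0 : 0 < I2 0 rho0.
Proof.
have c0 := smooth_cont2 rho0_smooth.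
rewrite lt_neqAle (rint_ge0 c0) ?andbT; last by move=> x y hx hy; exact: rho0_ge0.
apply/eqP => /esym I0.
have Z x y : - pi <= x <= pi -> 0 <= y <= pi -> rho0 x y = 0.
  by apply: (rint_eq0 pi_lt I2_0pi c0) => // x' y' hx hy; exact: rho0_ge0.
have [x1 [x2]] := rho0_nonzero; apply.
have [pf _] := rho0_smooth.
apply: (periodic2_ind (P := fun z => z = 0) pf) => x y hx /andP[y1 y2].
have [y0|/ltW y0] := lerP 0 y; first by apply: Z => //; rewrite y0.
apply/eqP; rewrite -oppr_eq0 -rho0_odd_x2; apply/eqP; apply: Z => //.
by apply/andP; split; lra.
Qed.

Lemma rho0_bounded : exists M, 0 <= M /\ forall x y, `|rho0 x y| <= M.
Proof.
have [M [M0 HM]] := cont2_bounded (- pi) pi (- pi) pi (smooth_cont2 rho0_smooth).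
have [pf _] := rho0_smooth.
by exists M; split => // x y; exact: (periodic2_ind (P := fun z => `|z| <= M) pf HM).
Qed.

Definition flow_for (rho : R -> R -> R -> R) (F : @flow R) :=
  [/\ forall t, 0 <= t -> den F t = rho t, den F 0 = rho0 &
      forall t, 0 <= t -> smooth_torus (den F t)].

Lemma solution_flow rho : global_smooth_solution rho0 rho -> exists F, flow_for rho F.
Proof.
move=> [se ipm ini]; have [F HF] := flow_of_solution se ipm.
exists F; split => // [|t t0].
  by rewrite HF//; apply/funext => x; apply/funext => y; exact: ini.
by rewrite HF//; exact: smooth_evol_torus.
Qed.

Section WithFlow.
Variables (rho : R -> R -> R -> R) (F : @flow R).
Hypothesis HF : flow_for rho F.

Let odd0 x y : den F 0 x (- y) = - den F 0 x y.
Proof. by case: HF => _ -> _. Qed.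
Let even0 x y : den F 0 (- x) y = den F 0 x y.
Proof. by case: HF => _ -> _. Qed.
Let axis0 y : den F 0 0 y = 0.
Proof. by case: HF => _ -> _. Qed.
Let nonneg0 x y : 0 <= x <= pi -> 0 <= y <= pi -> 0 <= den F 0 x y.
Proof. by case: HF => _ -> _; exact: rho0_nonneg. Qed.

Lemma dissipation_ge0 t : 0 <= t -> 0 <= dissipation F t.
Proof. by move=> t0; have := bessel odd0 0 t0; rewrite big_ord0. Qed.

Lemma den_range M : (forall x y, `|rho0 x y| <= M) ->
  forall t x y, 0 <= t -> 0 <= y <= pi -> 0 <= den F t x y <= M.
Proof.
move=> HM t x y t0 hy; rewrite (den_ge0 odd0 even0 axis0 nonneg0)//=.
have HM0 x' y' : `|den F 0 x' y'| <= M by case: HF => _ -> _.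
exact: le_trans (ler_norm _) (den_bounded HM0 x y t0).
Qed.

Lemma fourier_modecoef t n : 0 <= t ->
  complex.Re (fourier (dx1 (rho t)) (mode n)) =
  ((2 * pi) ^+ 2)^-1 * (n.+1%:R * (2 * modecoef F t n)).
Proof.
move=> t0; case: HF => Hd _ Hs; rewrite -Hd// fourier_mode//; first exact: Hs.
- by move=> x y; have [] := flow_even1 even0 x y t0.
- by move=> x y; have [] := flow_odd2 odd0 x y t0.
Qed.

(** The power [1 + (2 s + 1)] consists of [2 s] from the norm and 2 from the [x1]-derivative. The
    factor [pi^2] undoes the normalisation [(2 pi)^2 (2 / (2 pi)^2)^2 = pi^-2]. *)
Lemma sobolev_modes s x t cs N : 0 <= t -> 0 < cs ->
  (forall n, cs * n.+1%:R `^ (2 * s) <= kabs R (mode n) `^ (2 * s)) ->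
  sobolev_sqnorm s (dx1 (rho t)) = x%:E ->
  \sum_(n < N) n.+1%:R `^ (1 + (2 * s + 1)) * modecoef F t n ^+ 2 <= pi ^+ 2 / cs * x.
Proof.
move=> t0 cs0 Hcs E; have p0 := @pi_gt0 R.
have := sobolev_sqnorm_ge s (dx1 (rho t)) N; rewrite E lee_fin => h.
have cp : 0 < pi ^+ 2 / cs by rewrite divr_gt0// exprn_gt0.
have := ler_wpM2l (ltW cp) h; apply: le_trans.
rewrite !mulr_sumr; apply: ler_sum => n _; rewrite fourier_modecoef//.
have n0 : 0 < n.+1%:R :> R by rewrite ltr0n.
have -> : n.+1%:R `^ (1 + (2 * s + 1)) = n.+1%:R `^ (2 * s) * n.+1%:R ^+ 2.
  have -> : 1 + (2 * s + 1) = 2 * s + 2%:R by ring.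
  rewrite powRD; last by rewrite (gt_eqF n0) implybT.
  by rewrite (powR_mulrn 2 (ltW n0)).
have := Hcs n; move: (kabs R (mode n) `^ _) (n.+1%:R `^ _) => K P HK.
move: (n.+1%:R) n0 (modecoef F t n) => m m0 b.
have -> : pi ^+ 2 / cs * ((2 * pi) ^+ 2 * (K * (((2 * pi) ^+ 2)^-1 * (m * (2 * b))) ^+ 2)) =
    (K / cs) * (m ^+ 2 * b ^+ 2).
  by move: (pi : R) p0 => u u0; field; rewrite !gt_eqF.
rewrite -mulrA; apply: ler_wpM2r; first by rewrite mulr_ge0 ?sqr_ge0.
by rewrite ler_pdivlMr// mulrC.
Qed.

End WithFlow.

Lemma weight_le_dissipation s : - 2^-1 < s -> exists C, 0 <= C /\
  forall rho F, flow_for rho F -> forall t, 0 <= t ->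
    (sobolev_weight s (dx1 (rho t)) <= (C * dissipation F t)%:E)%E.
Proof.
move=> hs; pose a := 2 * s + 1; have a0 : 0 < a by rewrite /a; lra.
have p0 := @pi_gt0 R; have pp : 0 < pi ^+ 2 :> R by rewrite exprn_gt0.
have [M [M0 HM]] := rho0_bounded.
have [c0 [c00 Hc0]] := mean_lower mass_gt0 M0.
have [cs [cs0 Hcs]] := @kabs_mode_ge R s.
have [th [th0 Hth]] := interpolation a0 c00.
pose q := pi ^+ 2 / cs; have q0 : 0 < q by rewrite divr_gt0.
pose C := pi ^+ 2 / (th * q `^ (- a^-1)).
have C0 : 0 < C by rewrite divr_gt0// mulr_gt0// powR_gt0.
exists C; split; first exact: ltW.
move=> rho F HF t t0; have [Hd Hd0 Hs] := HF.
have odd0 x y : den F 0 x (- y) = - den F 0 x y by rewrite Hd0.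
have even0 x y : den F 0 (- x) y = den F 0 x y by rewrite Hd0.
have axis0 y : den F 0 0 y = 0 by rewrite Hd0.
have nonneg0 x y : 0 <= x <= pi -> 0 <= y <= pi -> 0 <= den F 0 x y.
  by rewrite Hd0; exact: rho0_nonneg.
have D0 := dissipation_ge0 HF t0.
have [K HK] := den_quadratic odd0 even0 axis0 nonneg0 t0 (Hs t t0).
have K0 : 0 <= K.
  have hx : - pi <= (pi : R) <= pi by rewrite lexx ltW// pi_lt.
  have hy : 0 <= (0 : R) <= pi by rewrite lexx ltW.
  by have /andP[h1 h2] := HK _ _ hx hy; have := le_trans h1 h2; rewrite cospi; lra.
have mean_ge : c0 <= mean0 F t.
  apply: Hc0; first exact: (cont3_at (@den_cont _ F)).
    by move=> x y _ hy; exact: (den_range HF HM).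
  by rewrite (mass_conserved odd0 t0) Hd0.
have HA N : \sum_(n < N) modecoef F t n ^+ 2 <= pi ^+ 2 * dissipation F t.
  by rewrite mulrC -ler_pdivrMr// mulr_suml; exact: bessel.
have Hc N : (0 < N)%N ->
    c0 <= 2 * (\sum_(n < N) `|modecoef F t n|) + 4 * K * pi ^+ 2 / N%:R.
  by move=> N0; apply: le_trans mean_ge _; exact: mean0_le.
have E0 : 0 <= 4 * K * pi ^+ 2 by apply: mulr_ge0; [apply: mulr_ge0|exact: ltW].
(* [B] is left free above [q * x], because a vanishing squared norm [x] has to be excluded with a
   positive [B]. *)
have key x B : sobolev_sqnorm s (dx1 (rho t)) = x%:E -> 0 < B -> q * x <= B ->
    th * B `^ (- a^-1) <= pi ^+ 2 * dissipation F t.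
  move=> E B0 xB; apply: (Hth (modecoef F t) _ _ _ B0 E0 HA _ Hc) => N.
  by apply: le_trans xB; exact: (sobolev_modes HF).
have := sobolev_sqnorm_ge0 s (dx1 (rho t)).
case E : (sobolev_sqnorm s (dx1 (rho t))) => [x| |]//; last first.
  by move=> _; rewrite sobolev_weight_pinfty// lee_fin mulr_ge0// ltW.
rewrite lee_fin le_eqVlt => /predU1P[x0|x0].
  (* A zero norm would give an infinite weight. It cannot occur: every [B > 0] would be admissible,
     and the one chosen makes [th B^(-1/a)] equal to [A + 1], contradicting the bound by [A]. *)
  exfalso; pose A := pi ^+ 2 * dissipation F t.
  have A0 : 0 <= A by apply: mulr_ge0 => //; exact: ltW.
  have A1 : 0 < (A + 1) / th by apply: divr_gt0 => //; lra.
  have B0 : 0 < ((A + 1) / th) `^ (- a) by rewrite powR_gt0.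
  have := key x _ E B0; rewrite -x0 mulr0 => /(_ (ltW B0)).
  rewrite -powRrM mulrNN mulfV ?gt_eqF// powRr1 ?(ltW A1)//.
  by rewrite mulrC divfK ?gt_eqF// -/A; lra.
have qx : 0 < q * x by rewrite mulr_gt0.
have := key x _ E qx (lexx _).
rewrite (sobolev_weight_fin hs x0 E) lee_fin -/a (powRM _ (ltW q0) (ltW x0)).
have Q0 : 0 < q `^ (- a^-1) by rewrite powR_gt0.
rewrite mulrA /C => h.
have T0 : 0 < th * q `^ (- a^-1) by rewrite mulr_gt0.
by rewrite mulrAC ler_pdivlMr// mulrC.
Qed.

End Main.

(** * Integration in time *)

Section Primitive.
Context {R : realType}.
Local Notation mu := (@lebesgue_measure R).

Lemma ge0_integral_primitive_le (G g : R -> R) (B : R) :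
  continuous G -> continuous g -> (forall t, 0 <= t -> 0 <= g t) ->
  (forall t : R, 0 < t -> is_derive t 1 G (g t)) -> (forall t, 0 <= t -> `|G t| <= B) ->
  (\int[mu]_(t in `[0%R, +oo[) (g t)%:E <= (2 * B)%:E)%E.
Proof.
move=> cG cg g0 dG GB.
have mG s t : 0 <= s -> s <= t -> G s <= G t.
  move=> s0; rewrite le_eqVlt => /predU1P[->//|st].
  have [||c hc] := @MVT R G g s t st.
  - by move=> x; rewrite in_itv/= => /andP[sx _]; apply: dG; exact: le_lt_trans sx.
  - exact: continuous_subspaceT.
  move: hc; rewrite in_itv/= => /andP[sc ct] E.
  by rewrite -subr_ge0 E mulr_ge0 ?subr_ge0 ?(ltW st)// g0// ltW// (le_lt_trans s0).
(* Monotonicity of [G] is known for nonnegative times only. Freezing it at [G 0] before gives a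
   function nondecreasing on the whole line, whose limit at infinity is its supremum. *)
pose H t := G (Num.max t 0).
have mx0 t : 0 <= Num.max t 0 :> R by rewrite le_max lexx orbT.
have mH : {homo H : s t / s <= t}.
  by move=> s t st; apply: mG; [exact: mx0|rewrite ge_max !le_max st lexx orbT].
have Hb : has_ubound (range H).
  by exists B => _ [t _ <-]; apply: le_trans (ler_norm _) (GB _ (mx0 t)).
have HG : \forall t \near +oo, H t = G t.
  by exists 0; split => // t /ltW t0; rewrite /H maxr0.
have cv : G t @[t --> +oo] --> sup (range H).
  by apply: cvg_trans (nondecreasing_cvgr mH Hb); apply: near_eq_cvg.
rewrite (ge0_continuous_FTC2y g0 _ cv).
- rewrite -EFinB lee_fin.
  have : sup (range H) <= B.
    apply: ge_sup; first by exists (H 0), 0.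
    by move=> _ [t _ <-]; apply: le_trans (ler_norm _) (GB _ (mx0 t)).
  by have := GB 0 (lexx 0); rewrite ler_norml => /andP[h1 _]; lra.
- exact: continuous_subspaceT.
- by move=> x x0; have [] := dG x x0.
- exact: cvg_at_right_filter (cG 0).
- by move=> x; rewrite in_itv/= andbT => x0; rewrite derive1E; have [] := dG x x0.
Qed.

End Primitive.

Section Integral.
Context {R : realType}.
Local Notation mu := (@lebesgue_measure R).
Variable rho0 : R -> R -> R.
Hypothesis rho0_smooth : smooth_torus rho0.
Hypothesis rho0_nonzero : exists x1 x2, rho0 x1 x2 <> 0.
Hypothesis rho0_odd_x2 : forall x1 x2, rho0 x1 (- x2) = - rho0 x1 x2.
Hypothesis rho0_even_x1 : forall x1 x2, rho0 (- x1) x2 = rho0 x1 x2.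
Hypothesis rho0_axis : forall x2, rho0 0 x2 = 0.
Hypothesis rho0_nonneg : forall x1 x2, 0 <= x1 <= pi -> 0 <= x2 <= pi -> 0 <= rho0 x1 x2.

Lemma energy_bound M rho F t : 0 <= M -> (forall x y, `|rho0 x y| <= M) ->
  flow_for rho0 rho F -> 0 <= t -> `|energy F t| <= pi * M * (2 * pi * pi).
Proof.
move=> M0 HM HF t0; have -> : 2 * pi * pi = (pi - - pi) * (pi - 0) :> R by ring.
have cd := cont3_at (t := t) (@den_cont _ F).
apply: (norm_rint pi_lt I2_0pi); first by c2.
move=> x y _ hy; have /andP[d0 d1] :=
  den_range rho0_odd_x2 rho0_even_x1 rho0_axis rho0_nonneg HF HM x t0 hy.
rewrite normrM (ger0_norm d0); have /andP[y0 y1] := hy; rewrite (ger0_norm y0).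
by apply: ler_pM.
Qed.

Lemma weight_integral_le s : - 2^-1 < s -> exists C : R, forall rho : R -> R -> R -> R,
  global_smooth_solution rho0 rho ->
  (\int[mu]_(t in `[0%R, +oo[) sobolev_weight s (dx1 (rho t)) <= C%:E)%E.
Proof.
move=> hs; have [C [C0 HC]] := weight_le_dissipation rho0_smooth rho0_nonzero
  rho0_odd_x2 rho0_even_x1 rho0_axis rho0_nonneg hs.
have [M [M0 HM]] := rho0_bounded rho0_smooth.
exists (2 * (C * (pi * M * (2 * pi * pi)))) => rho gs.
have [F HF] := solution_flow gs.
apply: (@le_trans _ _ (\int[mu]_(t in `[0%R, +oo[) (C * dissipation F t)%:E)%E).
  apply: ge0_le_integral_any => t /=; rewrite in_itv/= andbT => t0.
    exact: sobolev_weight_ge0.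
  exact: HC.
apply: (@ge0_integral_primitive_le R (fun t => - C * energy F t)).
- exact: (contM (@contC R (- C)) (@energy_cont _ F)).
- exact: (contM (@contC R C) (@dissipation_cont _ F)).
- by move=> t t0; apply: mulr_ge0 => //; exact: (dissipation_ge0 rho0_odd_x2 HF).
- move=> t t0; apply: (drv_eq (drvM (drv_cst t (- C)) (energy_drv F t0))).
  by rewrite mul0r add0r mulrNN.
- move=> t t0; rewrite normrM normrN (ger0_norm C0).
  by apply: ler_wpM2l => //; exact: energy_bound HF t0.
Qed.

End Integral.

(** * Divergence of the upper limits *)

Section Limsup.
Context {R : realType}.
Local Notation mu := (@lebesgue_measure R).
Local Notation I2 c := (rint (- pi) pi c (pi : R)).

Lemma sqr_normc (a b : R) : ComplexField.Normc.normc (a +i* b)%C ^+ 2 = a ^+ 2 + b ^+ 2.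
Proof. by rewrite /ComplexField.Normc.normc sqr_sqrtr// addr_ge0 ?sqr_ge0. Qed.

Lemma normc_fourier_dx1 (f : R -> R -> R) k : smooth_torus f ->
  ComplexField.Normc.normc (fourier (dx1 f) k) ^+ 2 =
  k.1%:~R ^+ 2 * ComplexField.Normc.normc (fourier f k) ^+ 2.
Proof.
move=> sf; have cf := smooth_cont2 sf; have cf1 := smooth_cont2 (smooth_dx1 sf).
have E1 := fourierE k cf1; have E := fourierE k cf.
rewrite E1 E [X in X = _]sqr_normc [X in _ = _ * X]sqr_normc; clear E1 E.
rewrite !phase_coef_dx1//.
have -> : I2 (- pi) (fun x y => sin (phase k 0 x y) * f x y) = phase_coef f (- (pi / 2)) k.
  by apply: rint_eq => x y _ _; rewrite /phase addr0 -cosBpihalf.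
have -> : I2 (- pi) (fun x y => sin (phase k (- (pi / 2)) x y) * f x y) = - phase_coef f 0 k.
  have cp := @cont2_phase R k 0.
  have cc : cont2 (fun x y => cos (phase k 0 x y) * f x y) by c2.
  rewrite -(mulN1r (phase_coef f 0 k)) -(rintZ _ _ _ _ (-1) cc).
  apply: rint_eq => x y _ _; rewrite /phase addr0 sinBpihalf; ring.
move: (((2 * pi) ^+ 2)^-1) (phase_coef f _ k) (phase_coef f 0 k) => q u v; ring.
Qed.

(** Termwise [k_1^2 <= |k|^2]; the two missing orders in [|k|^(2 s)] are those of [s + 1]. *)
Lemma sobolev_norm_dx1_le s (f : R -> R -> R) : smooth_torus f ->
  (sobolev_norm s (dx1 f) <= sobolev_norm (s + 1) f)%E.
Proof.
move=> sf; apply: gt0_ler_poweR.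
- by rewrite invr_ge0.
- by rewrite in_itv/= leey sobolev_sqnorm_ge0.
- by rewrite in_itv/= leey sobolev_sqnorm_ge0.
apply: lee_wpmul2l; first by rewrite lee_fin sqr_ge0.
apply: le_esum => k /= k0; rewrite lee_fin (normc_fourier_dx1 _ sf) mulrA.
apply: ler_wpM2r; first exact: sqr_ge0.
have K1 := @kabs_sqr_ge1 R _ k0.
have Kp : 0 < kabs R k.
  by rewrite lt_neqAle sqrtr_ge0 andbT; apply/eqP => k00; move: K1; rewrite -k00 expr0n/=; lra.
have -> : 2 * (s + 1) = 2 * s + 2%:R by ring.
rewrite powRD; last by rewrite (gt_eqF Kp) implybT.
rewrite (powR_mulrn 2 (ltW Kp)); apply: ler_wpM2l; first exact: powR_ge0.
by rewrite kabs_sqr lerDl sqr_ge0.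
Qed.

Lemma limf_esup_le_near (T : choiceType) (X : filteredType T) (F : set_system X)
    {FF : Filter F} (f g : X -> \bar R) :
  (\forall x \near F, (f x <= g x)%E) -> (limf_esup f F <= limf_esup g F)%E.
Proof.
move=> fg; rewrite !limf_esupE; apply: le_ereal_inf_tmp => _ [V FV <-].
apply: (@le_trans _ _ (ereal_sup (f @` (V `&` [set x | (f x <= g x)%E])))).
  by apply: ereal_inf_lbound; exists (V `&` [set x | (f x <= g x)%E]) => //; exact: filterI.
apply: ge_ereal_sup => _ [x [Vx fgx] <-]; apply: le_trans fgx _.
by apply: ereal_sup_ubound; exists x.
Qed.

(** Because [(s + 1/2) * 2 / (2 s + 1) = 1], a norm of size at most [L t^(s + 1/2)] leaves a weight
    of at least a constant over [t], just beyond integrability. A zero norm is harmless, its weight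
    being infinite. *)
Lemma sobolev_weight_ge s (f : R -> R -> R) (t L : R) : - 2^-1 < s -> 0 < t -> 0 < L ->
  ((t `^ (- (s + 2^-1)))%R%:E * sobolev_norm s f <= L%:E)%E ->
  (((L `^ (2 / (2 * s + 1)))^-1 * t^-1)%:E <= sobolev_weight s f)%E.
Proof.
move=> hs t0 L0; rewrite /sobolev_weight.
have N0 : (0 <= sobolev_norm s f)%E by exact: poweR_ge0.
have tp : 0 < t `^ (- (s + 2^-1)) by rewrite powR_gt0.
have a0 : 0 < 2 * s + 1 by lra.
move: (sobolev_norm s f) N0 => [x| |]//; last by rewrite gt0_muley ?lte_fin.
rewrite lee_fin => x0; rewrite -EFinM lee_fin poweR_EFin inver => h.
have := x0; rewrite le_eqVlt => /predU1P[<-|xp].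
  by rewrite powR0 ?eqxx ?leey// gt_eqF// divr_gt0.
rewrite gt_eqF ?powR_gt0// lee_fin -invfM lef_pV2 ?posrE ?mulr_gt0 ?powR_gt0//.
have xL : x <= L * t `^ (s + 2^-1).
  rewrite -ler_pdivrMr ?powR_gt0//; move: h; rewrite powRN mulrC; exact.
have e0 : 0 <= 2 / (2 * s + 1) by rewrite divr_ge0// ltW.
have Lt0 : 0 <= L * t `^ (s + 2^-1) by exact: le_trans xL.
apply: (le_trans (ge0_ler_powR e0 x0 Lt0 xL)).
rewrite (powRM _ (ltW L0) (powR_ge0 _ _)) -powRrM.
have -> : (s + 2^-1) * (2 / (2 * s + 1)) = 1 by field; rewrite gt_eqF.
by rewrite powRr1 ?lexx// ltW.
Qed.

Lemma integral_inv_unbounded (w : R -> \bar R) (k t1 C : R) : 0 < k -> 0 < t1 ->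
  (forall t, 0 <= t -> (0 <= w t)%E) -> (forall t, t1 <= t -> ((k * t^-1)%:E <= w t)%E) ->
  (\int[mu]_(t in `[0%R, +oo[) w t <= C%:E)%E -> False.
Proof.
move=> k0 t10 w0 wk wC.
(* Chosen so that the integral of [k / t] over [[t1, T]] is [k ln (T / t1) = |C| + 1 > C]. *)
pose T := t1 * expR ((`|C| + 1) / k).
have e1 : 1 < expR ((`|C| + 1) / k).
  by rewrite -expR0 ltr_expR divr_gt0//; have := normr_ge0 C; lra.
have tT : t1 < T by rewrite /T ltr_pMr.
have I1 : (\int[mu]_(t in `[t1, T]) (k * t^-1)%:E = (k * ln T)%:E - (k * ln t1)%:E)%E.
  have dl (x : R) : 0 < x -> is_derive x 1 (fun z => k * ln z) (k * x^-1).
    move=> x0; have d := is_derive1_ln x0.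
    by apply: (drv_eq (drvM (drv_cst x k) d)); rewrite mul0r add0r.
  have cl (x : R) : 0 < x -> {for x, continuous (fun z => k * ln z)}.
    move=> x0; apply/differentiable_continuous/derivable1_diffP.
    by have [] := dl x x0.
  apply: (@continuous_FTC2 R (fun t => k * t^-1) (fun t => k * ln t) t1 T tT).
  - apply: continuous_in_subspaceT => x; rewrite inE/= in_itv/= => /andP[h _].
    apply: cvgM; first exact: cvg_cst.
    by apply: inv_continuous; rewrite gt_eqF// (lt_le_trans t10).
  - split.
    + by move=> x; rewrite in_itv/= => /andP[h _]; have [] := dl x (lt_trans t10 h).
    + by apply: cvg_at_right_filter; exact: cl.
    + by apply: cvg_at_left_filter; apply: cl; exact: lt_trans tT.
  - move=> x; rewrite in_itv/= => /andP[h _]; rewrite derive1E.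
    by have [] := dl x (lt_trans t10 h).
have sub : `[t1, T] `<=` `[0%R, +oo[.
  by move=> x; rewrite /= !in_itv/= andbT => /andP[h _]; exact: le_trans (ltW t10) h.
have : ((k * ln T)%:E - (k * ln t1)%:E <= C%:E)%E.
  rewrite -I1; apply: le_trans wC; rewrite integral_mkcond [leRHS]integral_mkcond.
  apply: ge0_le_integral_any => t _; rewrite !patchE.
    by case: ifPn => //; rewrite inE/= in_itv/= => /andP[h _]; rewrite lee_fin mulr_ge0 ?invr_ge0// ltW// (lt_le_trans t10).
  case: ifPn => tin; last by case: ifPn => //; rewrite inE/= in_itv/= andbT; exact: w0.
  rewrite (_ : t \in `[0%R, +oo[%classic); first by move: tin; rewrite inE/= in_itv/= => /andP[h _]; exact: wk.
  by move: tin; rewrite !inE; exact: sub.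
rewrite -EFinB lee_fin /T lnM ?posrE// ?expR_gt0// expRK.
rewrite (_ : _ - _ = `|C| + 1); first by have := ler_norm C; lra.
by field; rewrite gt_eqF.
Qed.

End Limsup.

Theorem theorem1p2 (R : realType) (rho0 : R -> R -> R)
  (rho0_smooth : smooth_torus rho0)
  (rho0_nonzero : exists x1 x2, rho0 x1 x2 <> 0)
  (rho0_odd_x2 : forall x1 x2, rho0 x1 (- x2) = - rho0 x1 x2)
  (rho0_even_x1 : forall x1 x2, rho0 (- x1) x2 = rho0 x1 x2)
  (rho0_axis : forall x2, rho0 0 x2 = 0)
  (rho0_nonneg : forall x1 x2, 0 <= x1 <= pi -> 0 <= x2 <= pi ->
     0 <= rho0 x1 x2) :
  (forall s : R, - 2^-1 < s ->
     exists C : R, forall rho : R -> R -> R -> R,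
       global_smooth_solution rho0 rho ->
       (\int[lebesgue_measure]_(t in `[0%R, +oo[)
          sobolev_weight s (dx1 (rho t)) <= C%:E)%E)
  /\
  (forall rho : R -> R -> R -> R, global_smooth_solution rho0 rho ->
     forall s : R, - 2^-1 < s ->
       (limf_esup (fun t : R => (t `^ (- (s + 2^-1)))%R%:E
                                  * sobolev_norm (s + 1)%R (rho t)) +oo%R
        >= limf_esup (fun t : R => (t `^ (- (s + 2^-1)))%R%:E
                                    * sobolev_norm s (dx1 (rho t))) +oo%R)%E
       /\
       (limf_esup (fun t : R => (t `^ (- (s + 2^-1)))%R%:E
                                 * sobolev_norm s (dx1 (rho t))) +oo%R
        = +oo)%E).
Proof.
have part1 : forall s : R, - 2^-1 < s -> exists C : R, forall rho : R -> R -> R -> R,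
    global_smooth_solution rho0 rho ->
    (\int[lebesgue_measure]_(t in `[0%R, +oo[) sobolev_weight s (dx1 (rho t)) <= C%:E)%E.
  by move=> s; exact: weight_integral_le.
split; first exact: part1.
move=> rho gs s hs; have [se _ _] := gs; split.
  apply: limf_esup_le_near; exists 0; split; first exact: num_real.
  move=> t t0.
  apply: lee_wpmul2l; first by rewrite lee_fin powR_ge0.
  by apply: sobolev_norm_dx1_le; apply: (smooth_evol_torus se); exact: ltW.
apply/eqP; rewrite eq_le leey /= limf_esupE; apply: le_ereal_inf_tmp => _ [V [M [_ MV]] <-].
have [C HC] := part1 s hs; have {}HC := HC rho gs.
(* The upper limit is an infimum of suprema over neighbourhoods of infinity, so it suffices to
   refute one finite supremum. Such a supremum bounds the norm by [L t^(s + 1/2)] on a ray. *)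
rewrite leNgt; apply/negP => supV.
pose N t := ((t `^ (- (s + 2^-1)))%R%:E * sobolev_norm s (dx1 (rho t)))%E.
have [L [L0 HL]] : exists L : R, 0 < L /\ forall t, V t -> (N t <= L%:E)%E.
  have ub t : V t -> (N t <= ereal_sup (N @` V))%E.
    by move=> Vt; apply: ereal_sup_ubound; exists t.
  move: ub supV; rewrite -/N; case: (ereal_sup _) => [r| |] ub // _.
    exists (Num.max r 1); split; first by rewrite lt_max ltr01 orbT.
    by move=> t Vt; apply: le_trans (ub t Vt) _; rewrite lee_fin le_max lexx.
  by exists 1; split => // t Vt; apply: le_trans (ub t Vt) _; exact: leNye.
have k0 : 0 < (L `^ (2 / (2 * s + 1)))^-1 by rewrite invr_gt0 powR_gt0.
pose t1 := Num.max M 0 + 1.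
have t10 : 0 < t1 by rewrite ltr_pwDr// le_max lexx orbT.
apply: (integral_inv_unbounded k0 t10 _ _ HC) => t ht; first exact: sobolev_weight_ge0.
apply: sobolev_weight_ge => //; first exact: lt_le_trans ht.
apply: HL; apply: MV; apply: lt_le_trans ht.
by rewrite /t1; apply: (@le_lt_trans _ _ (Num.max M 0)); rewrite ?le_max ?lexx// ltrDl.
Qed.
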